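(* Let $(M,\mathcal{T})$ be a triangulated compact 3-manifold and let $r^*\in\mathfrak{M}_{\mathcal{T}}\cap\mathbb{S}^{N-1}$ be a sphere packing metric with nonpositive constant combinatorial scalar curvature. If $r(0)\in\mathfrak{M}_{\mathcal{T}}\cap\mathbb{S}^{N-1}$ and $\|r(0)-r^*\|^2$ is small enough, then the solution of the normalized combinatorial Yamabe flow $$\frac{dg_i}{dt}=(R_{av}-R_i)g_i,\qquad g_i=r_i^2,\quad i\in V,$$ with initial metric $r(0)$ exists for all time $t\in[0,+\infty)$ and converges to $r^*$ as $t\to+\infty$.
   Context: $M$ is a compact connected 3-dimensional manifold (without boundary) with a triangulation $\mathcal{T}=\{V,E,F,T\}$ (vertices, edges, faces, tetrahedra), $V=\{1,\dots,N\}$. A sphere packing metric is a map $r:V\to(0,+\infty)$ such that, with edge lengths $l_{ij}=r_i+r_j$ for $\{i,j\}\in E$, each tetrahedron $\{i,j,k,l\}\in T$ is realized by its six edge lengths as a (nondegenerate) Euclidean tetrahedron; equivalently $Q_{ijkl}=\left(\frac1{r_i}+\frac1{r_j}+\frac1{r_k}+\frac1{r_l}\right)^2-2\left(\frac1{r_i^2}+\frac1{r_j^2}+\frac1{r_k^2}+\frac1{r_l^2}\right)>0$ for every $\{i,j,k,l\}\in T$. The set of all sphere packing metrics is $\mathfrak{M}_{\mathcal{T}}\subset\mathbb{R}^N_{>0}$. Let $\alpha_{ijkl}$ be the solid angle at $i$ of the Euclidean tetrahedron $\{i,j,k,l\}$ and $K_i=4\pi-\sum_{\{i,j,k,l\}\in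 T}\alpha_{ijkl}$ (sum over tetrahedra containing $i$). The combinatorial scalar curvature is $R_i=K_i/r_i^2$; it is constant if $R_i$ is the same for all $i\in V$. The average is $R_{av}=\frac{\sum_{i=1}^N K_ir_i}{\sum_{i=1}^N r_i^3}$. Here $\mathbb{S}^{N-1}=\{r\in\mathbb{R}^N:\ (\sum_i r_i^3)^{1/3}=1\}$. $\|\cdot\|$ is the Euclidean norm. *)

(* Defs.v *)
From HB Require Import structures.
From mathcomp Require Import all_boot all_order all_algebra.
From mathcomp Require Import all_classical all_reals all_analysis.
Set Implicit Arguments.
Unset Strict Implicit.
Unset Printing Implicit Defensive.
Import Order.TTheory GRing.Theory Num.Theory.
Import numFieldNormedType.Exports.
Local Open Scope classical_set_scope.
Local Open Scope ring_scope.

Definition homeomorphic_sets (X Y : topologicalType) (A : set X) (B : set Y) :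
    Prop :=
  exists (f : X -> Y) (g : Y -> X),
    [/\ forall x, A x -> B (f x) /\ g (f x) = x,
        forall y, B y -> A (g y) /\ f (g y) = y,
        {within A, continuous f} &
        {within B, continuous g}].

(* The topology of 'rV[R]_3 is the usual one of R^3. *)
Definition manifold3 (R : realType) (M : topologicalType) : Prop :=
  [/\ hausdorff_space M,
      @second_countable M &
      forall x : M, exists (U : set M) (W : set 'rV[R]_3),
        [/\ open U, U x, open W & homeomorphic_sets U W]].

(* Pure 3-dimensional abstract simplicial complex with vertex set 'I_N. *)
Definition complex3 (N : nat) (K : {set {set 'I_N}}) : Prop :=
  [/\ finset.set0 \notin K,
      forall i : 'I_N, [set i]%SET \in K,
      forall s s' : {set 'I_N},
        s \in K -> s' \subset s -> s' != finset.set0 -> s' \in K &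
      forall s : {set 'I_N}, s \in K ->
        exists t : {set 'I_N}, [/\ t \in K, #|t| = 4%N & s \subset t]].

Definition tetrahedra (N : nat) (K : {set {set 'I_N}}) : {set {set 'I_N}} :=
  [set s in K | #|s| == 4%N]%SET.

(* Geometric realization, in barycentric coordinates. *)
Definition realization (R : realType) (N : nat) (K : {set {set 'I_N}}) :
    set 'rV[R]_N :=
  [set x : 'rV[R]_N | [/\ forall i, 0 <= x 0 i,
               \sum_i x 0 i = 1 &
               [set i | x 0 i != 0]%SET \in K]].

Definition triangulation (R : realType) (M : topologicalType) (N : nat)
    (K : {set {set 'I_N}}) : Prop :=
  complex3 K /\ homeomorphic_sets (@realization R N K) [set: M].

(* The library norm `|u| on row vectors is the sup norm. *)
Definition enorm (R : realType) (n : nat) (u : 'rV[R]_n) : R :=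
  Num.sqrt (\sum_i u 0 i ^+ 2).

Definition vec3 (R : realType) (x y z : R) : 'rV[R]_3 :=
  \row_(j < 3) [:: x; y; z]`_j.

Definition volume3 (R : realType) (A : set 'rV[R]_3) : \bar R :=
  ((@lebesgue_measure R \x @lebesgue_measure R) \x @lebesgue_measure R)%E
    [set q : R * R * R | A (vec3 q.1.1 q.1.2 q.2)].

(* Area of the part of the unit sphere cut out by the cone C: since area scales
   as the square of the radius, the part of the unit ball in C has volume
   (area) * \int_0^1 rho^2 d rho = (area) / 3. *)
Definition solid_angle_cone (R : realType) (C : set 'rV[R]_3) : R :=
  3 * fine (volume3 [set x | C x /\ enorm x <= 1]).

(* For a set t of four vertices placed in R^3 by p. *)
Definition affinely_independent (R : realType) (N : nat) (t : {set 'I_N})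
    (p : 'I_N -> 'rV[R]_3) : Prop :=
  forall c : 'I_N -> R,
    \sum_(i in t) c i = 0 -> \sum_(i in t) c i *: p i = 0 ->
    forall i, i \in t -> c i = 0.

Definition tangent_cone (R : realType) (N : nat) (t : {set 'I_N})
    (p : 'I_N -> 'rV[R]_3) (i : 'I_N) : set 'rV[R]_3 :=
  [set x | exists c : 'I_N -> R, (forall j, 0 <= c j) /\
     x = \sum_(j in t | j != i) c j *: (p j - p i)].

(* p places t as a nondegenerate Euclidean tetrahedron with edge lengths
   l_ij = r_i + r_j. *)
Definition euclidean_placement (R : realType) (N : nat) (r : 'rV[R]_N)
    (t : {set 'I_N}) (p : 'I_N -> 'rV[R]_3) : Prop :=
  affinely_independent t p /\
  forall i j, i \in t -> j \in t -> i != j ->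
    enorm (p i - p j) = r 0 i + r 0 j.

Definition packing_metric (R : realType) (N : nat) (K : {set {set 'I_N}}) :
    set 'rV[R]_N :=
  [set r : 'rV[R]_N | (forall i, 0 < r 0 i) /\
           forall t, t \in tetrahedra K -> exists p, euclidean_placement r t p].

(* Placements are unique up to isometry, so the one chosen here is
   immaterial. *)
Definition solid_angle (R : realType) (N : nat) (r : 'rV[R]_N)
    (t : {set 'I_N}) (i : 'I_N) : R :=
  solid_angle_cone
    (tangent_cone t (xget (fun=> 0) [set p | euclidean_placement r t p]) i).

Definition curvK (R : realType) (N : nat) (K : {set {set 'I_N}})
    (r : 'rV[R]_N) (i : 'I_N) : R :=
  4 * pi - \sum_(t in tetrahedra K | i \in t) solid_angle r t i.

Definition scalar_curv (R : realType) (N : nat) (K : {set {set 'I_N}})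
    (r : 'rV[R]_N) (i : 'I_N) : R :=
  curvK K r i / r 0 i ^+ 2.

Definition average_curv (R : realType) (N : nat) (K : {set {set 'I_N}})
    (r : 'rV[R]_N) : R :=
  (\sum_i curvK K r i * r 0 i) / (\sum_i r 0 i ^+ 3).

Definition nonpositive_constant_curv (R : realType) (N : nat)
    (K : {set {set 'I_N}}) (r : 'rV[R]_N) : Prop :=
  exists2 c : R, c <= 0 & forall i, scalar_curv K r i = c.

(* (\sum_i r_i^3)^(1/3) = 1 with the real cube root; powR is not a cube root
   on negative numbers. *)
Definition sphere3 (R : realType) (N : nat) : set 'rV[R]_N :=
  [set r : 'rV[R]_N | \sum_i r 0 i ^+ 3 = 1].

(* u has derivative l at t relative to [0, +oo[: two-sided for 0 < t,
   right derivative at t = 0. *)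
Definition has_derivative_from0 (R : realType) (u : R -> R) (t l : R) : Prop :=
  (u s - u t) / (s - t) @[s --> within [set s | 0 <= s] t^'] --> l.

(* r solves the normalized combinatorial Yamabe flow on [0, T[ with initial
   metric r0. *)
Definition yamabe_solution (R : realType) (N : nat) (K : {set {set 'I_N}})
    (r0 : 'rV[R]_N) (T : \bar R) (r : R -> 'rV[R]_N) : Prop :=
  r 0 = r0 /\
  forall t : R, 0 <= t -> (t%:E < T)%E ->
    packing_metric K (r t) /\
    forall i, has_derivative_from0 (fun s => r s 0 i ^+ 2) t
      ((average_curv K (r t) - scalar_curv K (r t) i) * r t 0 i ^+ 2).

(* Main.v *)
(* In terms of the bends x_i = 1/r_i, with S their sum over a tetrahedron and Q
   as in the paper, let phi_m = atan ((S - 2 x_m) / sqrt Q).  The dihedral angle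
   along the edge ij is phi_k + phi_l, where k, l are the other two vertices, so
   by Girard's theorem the solid angle at i is 2 (phi_j + phi_k + phi_l) - pi.
   The derivative of the solid angles is therefore explicit, and a weighted
   Cauchy-Schwarz inequality shows that its quadratic form is negative
   semidefinite with kernel spanned by r; since the 1-skeleton is connected, the
   derivative L of the curvature K satisfies u.L u >= 0, with equality only for u
   proportional to r.

   Write c <= 0 for the curvature of r* and u = r - r*.  The flow preserves
   \sum_i r_i^3, hence \sum_i r*_i^2 u_i = O(|u|^2), and the derivative of
   W = \sum_i r*_i u_i^2 along the flow is
   - u.L u + 2 c \sum_i r*_i u_i^2 + o(|u|^2) <= - mu W.  Thus W decays
   exponentially, which traps the solution near r*, where the speed is Lipschitz,
   and makes it converge to r*. *)
Require Import Defs.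
From HB Require Import structures.
From mathcomp Require Import all_boot all_order all_algebra.
From mathcomp Require Import all_classical all_reals all_analysis.
From mathcomp Require Import measurable_realfun ring lra.
Set Implicit Arguments.
Unset Strict Implicit.
Unset Printing Implicit Defensive.
Import Order.TTheory GRing.Theory Num.Theory.
Import numFieldNormedType.Exports.
Local Open Scope classical_set_scope.
Local Open Scope ring_scope.

(** * A quadratic form attached to four radii *)

(** Curvature is defined through Lebesgue measure, as the volume of a cone inside the unit ball, so
    Girard's theorem has to be derived from the invariance of volume under rotations; these are
    composed of shears and exchanges of coordinates, which Fubini handles. The volume of the ball is
    never computed: it enters the solid angles as one positive factor, to which the signs of the
    quadratic forms are insensitive.

    Two degeneracies shape the stability argument. The form u.Lu is blind to scaling, and c may be
    0, so only the constraint on the sum of cubes controls the direction of the fixed point itself.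
    Moreover the average curvature varies to first order; in the derivative of W its differential is
    multiplied by the sum of x_i^2 u_i, which the constraint makes quadratic, so its contribution is
    of third order.

    The flow prescribes the derivative of r_i^2, and only a right derivative at time 0. Existence
    and decay are obtained for an equation in r whose field is modified outside a small ball,
    uniqueness by comparing the squares. *)

Lemma sqr_add_le_mul (R : realFieldType) (x y A B C D : R) :
  0 <= A -> 0 <= B -> 0 <= C -> 0 <= D -> x ^+ 2 <= A * B -> y ^+ 2 <= C * D ->
  (x + y) ^+ 2 <= (A + C) * (B + D).
Proof.
move=> A0 B0 C0 D0 xAB yCD.
(* As (x y)^2 <= (A D)(C B), this is the inequality between the geometric and the arithmetic mean of
   [A * D] and [C * B]. *)
suff : 2 * (x * y) <= A * D + C * B by nra.
have AD0 : 0 <= A * D by exact: mulr_ge0.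
have CB0 : 0 <= C * B by exact: mulr_ge0.
apply: le_trans (ler_norm _) _.
rewrite -(@ler_pXn2r _ 2%N) ?nnegrE ?addr_ge0 // -normrX ger0_norm ?sqr_ge0//.
have -> : (2 * (x * y)) ^+ 2 = 4 * (x ^+ 2 * y ^+ 2) by ring.
have : x ^+ 2 * y ^+ 2 <= (A * B) * (C * D).
  by apply: ler_pM => //; exact: sqr_ge0.
have := sqr_ge0 (A * D - C * B).
nra.
Qed.

(** An equality, put in the shape that [sqr_add_le_mul] takes as hypothesis; 2a is the weight of one
    square in [tetra_form_gt0]. *)
Lemma sqr_mul_weight (R : realFieldType) (a b c : R) : 0 < a ->
  (b * c) ^+ 2 <= (b ^+ 2 / (2 * a)) * (2 * a * c ^+ 2).
Proof. by move=> a0; rewrite le_eqVlt; apply/orP; left; apply/eqP; field; lra. Qed.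

Section tetra_form.
Variables (R : realFieldType) (r1 r2 r3 r4 : R).
Hypotheses (r1_gt0 : 0 < r1) (r2_gt0 : 0 < r2) (r3_gt0 : 0 < r3)
  (r4_gt0 : 0 < r4).
Let e1 := r1 + r2 + r3 + r4.
Let e2 := r1 * r2 + r1 * r3 + r1 * r4 + r2 * r3 + r2 * r4 + r3 * r4.
Let e3 := r1 * r2 * r3 + r1 * r2 * r4 + r1 * r3 * r4 + r2 * r3 * r4.
Let e4 := r1 * r2 * r3 * r4.
Hypothesis Q_gt0 : e3 ^+ 2 < 4 * e2 * e4.

Let w1 := r2 + r3 + r4.
Let w2 := r1 + r3 + r4.
Let w3 := r1 + r2 + r4.
Let w4 := r1 + r2 + r3.
Let S := e3 / e4.
Let Q := (4 * e2 * e4 - e3 ^+ 2) / e4 ^+ 2.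
(** As a polynomial in k, [N] below has linear coefficient [- M] and quadratic coefficient [c2]; see
    [N_quadratic]. *)
Let M := e1 * (e1 * e3 - 2 * e4) / (4 * e4 ^+ 2).
Let c2 := e1 ^+ 2 / (8 * e4) -
  Q / 16 * (1 + (r1 / w1 + r2 / w2 + r3 / w3 + r4 / w4) / 2).

(* For every k and every d orthogonal to r, \sum_i d_i equals
   \sum_i b_i d_i + mu k * \sum_i r_i^2 d_i, so Cauchy-Schwarz bounds
   (\sum_i d_i)^2 by N k times the right-hand side of tetra_form_gt0.
   N is quadratic in k, and its minimum is below 3 / (2 * e4) exactly when
   Q > 0. *)
Let b k r w := r ^+ 3 * w / e4 - k * (S * r ^+ 2 - 2 * r) / 4.
Let mu k := - e2 / e4 + k * S / 4.
Let N k := (b k r1 w1) ^+ 2 / (2 * (r1 ^+ 3 * w1)) +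
 (b k r2 w2) ^+ 2 / (2 * (r2 ^+ 3 * w2)) +
 (b k r3 w3) ^+ 2 / (2 * (r3 ^+ 3 * w3)) +
 (b k r4 w4) ^+ 2 / (2 * (r4 ^+ 3 * w4)) + (mu k) ^+ 2.

Let e4_gt0 : 0 < e4. Proof. by rewrite /e4 !mulr_gt0. Qed.
Let w1_gt0 : 0 < w1. Proof. by rewrite /w1 !addr_gt0. Qed.
Let w2_gt0 : 0 < w2. Proof. by rewrite /w2 !addr_gt0. Qed.
Let w3_gt0 : 0 < w3. Proof. by rewrite /w3 !addr_gt0. Qed.
Let w4_gt0 : 0 < w4. Proof. by rewrite /w4 !addr_gt0. Qed.

(** The hypothesis is Q + q^2 = 4 r w / e4 with q = S - 2 / r, multiplied by r^2. Eliminating q^2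
    leaves terms whose sum over the four radii is symmetric, apart from the fractions r / w. *)
Let b_split k r w : 0 < r -> 0 < w ->
  (S * r - 2) ^+ 2 = 4 * r ^+ 3 * w / e4 - Q * r ^+ 2 ->
  (b k r w) ^+ 2 / (2 * (r ^+ 3 * w)) = r ^+ 3 * w / (2 * e4 ^+ 2)
   - k * (S * r ^+ 2 - 2 * r) / (4 * e4)
   + k ^+ 2 / 32 * (4 * r ^+ 2 / e4 - Q * (r / w)).
Proof.
move=> r0 w0 h.
have -> : (b k r w) ^+ 2 / (2 * (r ^+ 3 * w)) = r ^+ 3 * w / (2 * e4 ^+ 2)
   - k * (S * r ^+ 2 - 2 * r) / (4 * e4)
   + k ^+ 2 / 32 * ((S * r - 2) ^+ 2 / (r * w)).
  by rewrite /b; field; rewrite !gt_eqF.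
by rewrite h; field; rewrite !gt_eqF.
Qed.

Let q1 : (S * r1 - 2) ^+ 2 = 4 * r1 ^+ 3 * w1 / e4 - Q * r1 ^+ 2.
Proof. rewrite /S /Q /e1 /e2 /e3 /e4 /w1; field; rewrite !gt_eqF//. Qed.
Let q2 : (S * r2 - 2) ^+ 2 = 4 * r2 ^+ 3 * w2 / e4 - Q * r2 ^+ 2.
Proof. rewrite /S /Q /e1 /e2 /e3 /e4 /w2; field; rewrite !gt_eqF//. Qed.
Let q3 : (S * r3 - 2) ^+ 2 = 4 * r3 ^+ 3 * w3 / e4 - Q * r3 ^+ 2.
Proof. rewrite /S /Q /e1 /e2 /e3 /e4 /w3; field; rewrite !gt_eqF//. Qed.
Let q4 : (S * r4 - 2) ^+ 2 = 4 * r4 ^+ 3 * w4 / e4 - Q * r4 ^+ 2.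
Proof. rewrite /S /Q /e1 /e2 /e3 /e4 /w4; field; rewrite !gt_eqF//. Qed.

Let N_quadratic k : N k = (e1 ^+ 2 * e2 - e1 * e3 + 4 * e4) / (2 * e4 ^+ 2)
  - k * M + k ^+ 2 * c2.
Proof.
rewrite /N !b_split //.
(* The four fractions are collected in [T], which is then generalised, to keep their denominators
   out of the final [field]. *)
set T := r1 / w1 + r2 / w2 + r3 / w3 + r4 / w4.
have -> : forall A1 A2 A3 A4 B1 B2 B3 B4 C1 C2 C3 C4 : R,
  A1 - B1 + k ^+ 2 / 32 * (C1 - Q * (r1 / w1)) +
  (A2 - B2 + k ^+ 2 / 32 * (C2 - Q * (r2 / w2))) +
  (A3 - B3 + k ^+ 2 / 32 * (C3 - Q * (r3 / w3))) +
  (A4 - B4 + k ^+ 2 / 32 * (C4 - Q * (r4 / w4))) + mu k ^+ 2 =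
  A1 + A2 + A3 + A4 - (B1 + B2 + B3 + B4) +
   k ^+ 2 / 32 * (C1 + C2 + C3 + C4 - Q * T) + mu k ^+ 2.
  by move=> *; rewrite /T; ring.
rewrite /c2 -/T; move: T => T.
rewrite /M /mu /Q /S.
rewrite /e1 /e2 /e3 /e4 /w1 /w2 /w3 /w4; field.
by rewrite !gt_eqF.
Qed.

Let pX := w1 * w2 * w3 * w4.

(** The left-hand side is a positive multiple of 3 / (2 e4) minus the minimum of [N], so this
    identity reduces the sign of that gap to the sign of Q. *)
Let discr : M ^+ 2 * e4 ^+ 2 - 2 * c2 * pX = Q * (e1 * e3 - 2 * e4) / 16.
Proof.
have pE : pX = e1 ^+ 2 * e2 - e1 * e3 + e4.
  by rewrite /pX /e1 /e2 /e3 /e4 /w1 /w2 /w3 /w4; ring.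
have TE : (1 + (r1 / w1 + r2 / w2 + r3 / w3 + r4 / w4) / 2) * pX =
   (e1 ^+ 4 + e1 * e3 - 2 * e4) / 2.
  rewrite /pX /e1 /e2 /e3 /e4 /w1 /w2 /w3 /w4; field.
  by rewrite !gt_eqF.
have -> : 2 * c2 * pX = e1 ^+ 2 / (4 * e4) * pX - Q / 8 *
  ((1 + (r1 / w1 + r2 / w2 + r3 / w3 + r4 / w4) / 2) * pX).
  by rewrite /c2; field; rewrite ?gt_eqF.
rewrite TE pE /M /Q; field; by rewrite gt_eqF.
Qed.

Let c2_gt0 : 0 < c2.
Proof.
(* The subtraction in [c2] hides a sum of squares: [N] is a sum of weighted squares of affine
   functions of k, and [c2] collects the squares of their slopes. *)
have -> : c2 = ((S * r1 - 2) ^+ 2 / (r1 * w1) + (S * r2 - 2) ^+ 2 / (r2 * w2) +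
   (S * r3 - 2) ^+ 2 / (r3 * w3) + (S * r4 - 2) ^+ 2 / (r4 * w4)) / 32 + S ^+ 2 / 16.
  rewrite q1 q2 q3 q4.
  have qw r w : 0 < r -> 0 < w ->
      (4 * r ^+ 3 * w / e4 - Q * r ^+ 2) / (r * w) = 4 * r ^+ 2 / e4 - Q * (r / w).
    by move=> r0 w0; field; rewrite !gt_eqF.
  rewrite !qw //.
  rewrite /c2.
  set T1 := r1 / w1; set T2 := r2 / w2; set T3 := r3 / w3; set T4 := r4 / w4.
  move: T1 T2 T3 T4 => T1 T2 T3 T4.
  rewrite /Q /S /e1 /e2 /e3 /e4; field.
  by rewrite !gt_eqF.
have S0 : 0 < S by rewrite /S divr_gt0 // /e3 !addr_gt0 // !mulr_gt0.
apply: ltr_wpDl; last by rewrite divr_gt0 // exprn_gt0.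
rewrite divr_ge0 // !addr_ge0 // divr_ge0 ?sqr_ge0 // ltW // mulr_gt0 //.
Qed.

Let exists_N_lt : exists k, N k < 3 / (2 * e4).
Proof.
(* The minimiser of the quadratic polynomial. *)
exists (M / (2 * c2)); rewrite N_quadratic.
have Qp : 0 < Q by rewrite /Q divr_gt0 ?subr_gt0 // exprn_gt0.
have e13 : 0 < e1 * e3 - 2 * e4.
  have -> : e1 * e3 - 2 * e4 = 2 * e4 + (r1 ^+ 2 * (r2 * r3 + r2 * r4 + r3 * r4)
    + r2 ^+ 2 * (r1 * r3 + r1 * r4 + r3 * r4)
    + r3 ^+ 2 * (r1 * r2 + r1 * r4 + r2 * r4)
    + r4 ^+ 2 * (r1 * r2 + r1 * r3 + r2 * r3)).
    by rewrite /e1 /e3 /e4; ring.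
  by rewrite !addr_gt0 // !mulr_gt0 ?exprn_gt0 ?addr_gt0 ?mulr_gt0.
have D : 0 < M ^+ 2 * e4 ^+ 2 - 2 * c2 * pX by rewrite discr divr_gt0 // mulr_gt0.
rewrite -subr_gt0.
have -> : 3 / (2 * e4) - ((e1 ^+ 2 * e2 - e1 * e3 + 4 * e4) / (2 * e4 ^+ 2) -
  M / (2 * c2) * M + (M / (2 * c2)) ^+ 2 * c2) =
   (M ^+ 2 * e4 ^+ 2 - 2 * c2 * (e1 ^+ 2 * e2 - e1 * e3 + e4)) / (4 * c2 * e4 ^+ 2).
  by field; rewrite !gt_eqF.
rewrite divr_gt0 //; last by rewrite !mulr_gt0 // exprn_gt0.
by move: D; congr (0 < _ - _ * _); rewrite /pX /e1 /e2 /e3 /e4 /w1 /w2 /w3 /w4; ring.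
Qed.

(** Applied later with d_i proportional to the variation of the solid angle at the vertex i; the
    linear constraint is then Schlaefli's formula for edge lengths r_i + r_j. Strictness is what
    identifies the kernel of the angle form. *)
Lemma tetra_form_gt0 (d1 d2 d3 d4 : R) :
  r1 * d1 + r2 * d2 + r3 * d3 + r4 * d4 = 0 ->
  [|| d1 != 0, d2 != 0, d3 != 0 | d4 != 0] ->
  2 / 3 * e4 * (d1 + d2 + d3 + d4) ^+ 2 <
  2 * (r1 ^+ 3 * w1 * d1 ^+ 2 + r2 ^+ 3 * w2 * d2 ^+ 2 +
       r3 ^+ 3 * w3 * d3 ^+ 2 + r4 ^+ 3 * w4 * d4 ^+ 2) +
  (r1 ^+ 2 * d1 + r2 ^+ 2 * d2 + r3 ^+ 2 * d3 + r4 ^+ 2 * d4) ^+ 2.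
Proof.
move=> rd d_neq0; have [k Nk] := exists_N_lt.
set D := r1 ^+ 2 * d1 + r2 ^+ 2 * d2 + r3 ^+ 2 * d3 + r4 ^+ 2 * d4.
set G := ltRHS.
have a1 : 0 < r1 ^+ 3 * w1 by rewrite mulr_gt0 // exprn_gt0.
have a2 : 0 < r2 ^+ 3 * w2 by rewrite mulr_gt0 // exprn_gt0.
have a3 : 0 < r3 ^+ 3 * w3 by rewrite mulr_gt0 // exprn_gt0.
have a4 : 0 < r4 ^+ 3 * w4 by rewrite mulr_gt0 // exprn_gt0.
(* For every k the two sides differ by a multiple of the constraint; this freedom is what
   [exists_N_lt] optimises. *)
have sumE : d1 + d2 + d3 + d4 = b k r1 w1 * d1 + b k r2 w2 * d2
   + b k r3 w3 * d3 + b k r4 w4 * d4 + mu k * D.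
  have -> : b k r1 w1 * d1 + b k r2 w2 * d2
   + b k r3 w3 * d3 + b k r4 w4 * d4 + mu k * D = d1 + d2 + d3 + d4 +
    (k / 2 - e3 / e4) * (r1 * d1 + r2 * d2 + r3 * d3 + r4 * d4).
    rewrite /b /mu /D /S /e1 /e2 /e3 /e4 /w1 /w2 /w3 /w4; field.
    by rewrite !gt_eqF.
  by rewrite rd mulr0 addr0.
have CS : (d1 + d2 + d3 + d4) ^+ 2 <= N k * G.
  have -> : G = 2 * (r1 ^+ 3 * w1) * d1 ^+ 2 + 2 * (r2 ^+ 3 * w2) * d2 ^+ 2 +
    2 * (r3 ^+ 3 * w3) * d3 ^+ 2 + 2 * (r4 ^+ 3 * w4) * d4 ^+ 2 + D ^+ 2.
    by rewrite /G; ring.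
  rewrite sumE /N.
  have A0 (a x : R) : 0 < a -> 0 <= x ^+ 2 / (2 * a).
    by move=> a0; rewrite divr_ge0 ?sqr_ge0 // mulr_ge0 // ltW.
  have B0 (a x : R) : 0 < a -> 0 <= 2 * a * x ^+ 2.
    by move=> a0; rewrite mulr_ge0 ?sqr_ge0 // mulr_ge0 // ltW.
  apply: sqr_add_le_mul; rewrite ?exprMn ?sqr_ge0 ?addr_ge0 ?A0 ?B0 //.
  apply: sqr_add_le_mul; rewrite ?addr_ge0 ?A0 ?B0 ?sqr_mul_weight //.
  apply: sqr_add_le_mul; rewrite ?addr_ge0 ?A0 ?B0 ?sqr_mul_weight //.
  by apply: sqr_add_le_mul; rewrite ?addr_ge0 ?A0 ?B0 ?sqr_mul_weight.
have G0 : 0 < G.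
  rewrite /G; apply: ltr_pwDl; last exact: sqr_ge0.
  rewrite mulr_gt0 // lt_neqAle eq_sym; apply/andP; split; last first.
    by rewrite !addr_ge0 // mulr_ge0 ?sqr_ge0 // ltW.
  apply/negP.
  have p (a x : R) : 0 < a -> 0 <= a * x ^+ 2 by move=> a0; rewrite mulr_ge0 ?sqr_ge0 // ltW.
  rewrite !paddr_eq0 ?addr_ge0 ?p //.
  rewrite !(mulf_eq0 _ (_ ^+ 2)) !(gt_eqF a1) !(gt_eqF a2) !(gt_eqF a3) !(gt_eqF a4) /= !sqrf_eq0.
  by case/andP=> /andP[/andP[/eqP E1 /eqP E2] /eqP E3] /eqP E4; move: d_neq0; rewrite E1 E2 E3 E4 eqxx.
apply: (@le_lt_trans _ _ (2 / 3 * e4 * (N k * G))).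
  by rewrite ler_pM2l // mulr_gt0 // divr_gt0.
have := Nk; rewrite -(ltr_pM2r G0) => Nk'.
apply: (@lt_le_trans _ _ (2 / 3 * e4 * (3 / (2 * e4) * G))).
  by rewrite ltr_pM2l // mulr_gt0 // divr_gt0.
by rewrite le_eqVlt; apply/orP; left; apply/eqP; field; rewrite gt_eqF.
Qed.

End tetra_form.

(* With x_i = r_i^-1 perturbed by xi_i, t is sqrt Q times the variation of
   atan (q / sqrt Q); the solid angle at i varies like twice the sum of these
   over the other three vertices, so F is the quadratic form of the solid angles
   up to a positive factor. *)
Section angle_form.
Variables (R : realFieldType) (r1 r2 r3 r4 : R).
Hypotheses (r1_gt0 : 0 < r1) (r2_gt0 : 0 < r2) (r3_gt0 : 0 < r3)
  (r4_gt0 : 0 < r4).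
Variables u1 u2 u3 u4 : R.
Let S := r1^-1 + r2^-1 + r3^-1 + r4^-1.
Let Q := S ^+ 2 - 2 * (r1^-1 ^+ 2 + r2^-1 ^+ 2 + r3^-1 ^+ 2 + r4^-1 ^+ 2).
Hypothesis Q_gt0 : 0 < Q.
Let q r := S - 2 * r^-1.
Let xi (r u : R) := - u / r ^+ 2.
Let dS := xi r1 u1 + xi r2 u2 + xi r3 u3 + xi r4 u4.
Let dq r u := dS - 2 * xi r u.
Let B := q r1 * xi r1 u1 + q r2 * xi r2 u2 + q r3 * xi r3 u3 + q r4 * xi r4 u4.
Let t r u := (Q * dq r u - q r * B) / (Q + q r ^+ 2).
Let T := t r1 u1 + t r2 u2 + t r3 u3 + t r4 u4.
Let F := u1 * (T - t r1 u1) + u2 * (T - t r2 u2) + u3 * (T - t r3 u3)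
  + u4 * (T - t r4 u4).

(** The relation between u and t is inverted: u is expressed through the t_i and a multiple of r.
    The multiple of r is orthogonal to the d_i = T - t_i, and what remains of F is - G / (Q e4),
    where G is the difference of the two sides of [tetra_form_gt0]. *)
Lemma angle_form_le0 :
  F <= 0 /\ (F = 0 -> exists a, [/\ u1 = a * r1, u2 = a * r2, u3 = a * r3 & u4 = a * r4]).
Proof.
set e4 := r1 * r2 * r3 * r4.
have e4_gt0 : 0 < e4 by rewrite /e4 !mulr_gt0.
have Qq r : 0 < Q + q r ^+ 2 by rewrite ltr_pwDl // sqr_ge0.
(* The component of u along r turns out to be [- a]. *)
pose a := B / Q.
have tE r u : t r u * (Q + q r ^+ 2) = Q * (dq r u - a * q r).
  by rewrite /t /a; field; rewrite !gt_eqF.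
have E1 : Q + q r1 ^+ 2 = 4 * r1 * (r2 + r3 + r4) / e4.
  by rewrite /Q /q /S /e4; field; rewrite !gt_eqF.
have E2 : Q + q r2 ^+ 2 = 4 * r2 * (r1 + r3 + r4) / e4.
  by rewrite /Q /q /S /e4; field; rewrite !gt_eqF.
have E3 : Q + q r3 ^+ 2 = 4 * r3 * (r1 + r2 + r4) / e4.
  by rewrite /Q /q /S /e4; field; rewrite !gt_eqF.
have E4 : Q + q r4 ^+ 2 = 4 * r4 * (r1 + r2 + r3) / e4.
  by rewrite /Q /q /S /e4; field; rewrite !gt_eqF.
move: (tE r1 u1) (tE r2 u2) (tE r3 u3) (tE r4 u4).
rewrite E1 E2 E3 E4 => t1E t2E t3E t4E.
have aQ : a * Q = B by rewrite /a divfK // gt_eqF.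
(* Schlaefli's formula: the left-hand side is also the sum of the r_i (T - t_i). It reduces to B - a
   Q, which vanishes by the choice of [a]. *)
have wt : t r1 u1 * (r2 + r3 + r4) + t r2 u2 * (r1 + r3 + r4) +
   t r3 u3 * (r1 + r2 + r4) + t r4 u4 * (r1 + r2 + r3) = 0.
  have -> : t r1 u1 * (r2 + r3 + r4) + t r2 u2 * (r1 + r3 + r4) +
   t r3 u3 * (r1 + r2 + r4) + t r4 u4 * (r1 + r2 + r3) =
     e4 / 4 * (t r1 u1 * (4 * r1 * (r2 + r3 + r4) / e4) / r1
     + t r2 u2 * (4 * r2 * (r1 + r3 + r4) / e4) / r2
     + t r3 u3 * (4 * r3 * (r1 + r2 + r4) / e4) / r3
     + t r4 u4 * (4 * r4 * (r1 + r2 + r3) / e4) / r4).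
    by field; rewrite !gt_eqF.
  rewrite t1E t2E t3E t4E.
  have -> : Q * (dq r1 u1 - a * q r1) / r1 + Q * (dq r2 u2 - a * q r2) / r2
    + Q * (dq r3 u3 - a * q r3) / r3 + Q * (dq r4 u4 - a * q r4) / r4 =
    Q * ((dq r1 u1 - a * q r1) / r1 + (dq r2 u2 - a * q r2) / r2
    + (dq r3 u3 - a * q r3) / r3 + (dq r4 u4 - a * q r4) / r4) by ring.
  have -> : (dq r1 u1 - a * q r1) / r1 + (dq r2 u2 - a * q r2) / r2
    + (dq r3 u3 - a * q r3) / r3 + (dq r4 u4 - a * q r4) / r4 = B - a * Q.
    by move: a {aQ tE t1E t2E t3E t4E} => a; rewrite /Q /B /dq /dS /q /S; ring.
  by rewrite aQ subrr !mulr0.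
pose G := 2 * (r1 ^+ 3 * (r2 + r3 + r4) * (T - t r1 u1) ^+ 2 +
    r2 ^+ 3 * (r1 + r3 + r4) * (T - t r2 u2) ^+ 2 +
    r3 ^+ 3 * (r1 + r2 + r4) * (T - t r3 u3) ^+ 2 +
    r4 ^+ 3 * (r1 + r2 + r3) * (T - t r4 u4) ^+ 2) +
  (r1 ^+ 2 * (T - t r1 u1) + r2 ^+ 2 * (T - t r2 u2) +
   r3 ^+ 2 * (T - t r3 u3) + r4 ^+ 2 * (T - t r4 u4)) ^+ 2 -
  2 / 3 * e4 * (T - t r1 u1 + (T - t r2 u2) + (T - t r3 u3) + (T - t r4 u4)) ^+ 2.
have rc : r1 * (T - t r1 u1) + r2 * (T - t r2 u2) + r3 * (T - t r3 u3)
    + r4 * (T - t r4 u4) = 0.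
  by rewrite -[RHS]wt /T; ring.
have FE : F = - (G / (Q * e4)).
  have h r w u : 0 < r -> t r u * (4 * r * w / e4) = Q * (dq r u - a * q r) ->
     dq r u = 4 * r * w * t r u / (Q * e4) + a * q r.
    move=> r0 e; apply/eqP; rewrite -subr_eq; apply/eqP.
    by apply: (mulfI (lt0r_neq0 Q_gt0)); rewrite -e; field; rewrite !gt_eqF.
  have {t1E} d1 := h _ _ _ r1_gt0 t1E; have {t2E} d2 := h _ _ _ r2_gt0 t2E.
  have {t3E} d3 := h _ _ _ r3_gt0 t3E; have {t4E} d4 := h _ _ _ r4_gt0 t4E.
  pose H := (r1 * (r2 + r3 + r4) * t r1 u1 + r2 * (r1 + r3 + r4) * t r2 u2 +
    r3 * (r1 + r2 + r4) * t r3 u3 + r4 * (r1 + r2 + r3) * t r4 u4) / (Q * e4).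
  have xs : dS = 2 * H + a * S.
    have -> : dS = (dq r1 u1 + dq r2 u2 + dq r3 u3 + dq r4 u4) / 2.
      by rewrite /dq /dS; field.
    by rewrite d1 d2 d3 d4 /H /q /S; field; rewrite !gt_eqF.
  have uE r w u : 0 < r -> dq r u = 4 * r * w * t r u / (Q * e4) + a * q r ->
     u = - r ^+ 2 * (H - 2 * r * w * t r u / (Q * e4)) - a * r.
    move=> r0 dE.
    transitivity (- r ^+ 2 * ((dS - dq r u) / 2)).
      by rewrite /dq /xi; field; rewrite gt_eqF.
    rewrite dE xs /q; field; rewrite !gt_eqF //.
  rewrite /F {1}(uE _ _ _ r1_gt0 d1) {1}(uE _ _ _ r2_gt0 d2)
     {1}(uE _ _ _ r3_gt0 d3) {1}(uE _ _ _ r4_gt0 d4).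
  move: wt rc; rewrite /H /G /T.
  move: (t r1 u1) (t r2 u2) (t r3 u3) (t r4 u4) => t1 t2 t3 t4 wt rc.
  set h0 := (X in X = 0) in wt.
  apply/eqP; rewrite -subr_eq0; apply/eqP.
  set T0 := t1 + t2 + t3 + t4.
  (* The identity holds only modulo the relation [wt], so the difference of the two sides is
     exhibited as an explicit multiple of the vanishing [h0], and [field] checks a free identity. *)
  transitivity (- h0 * (a + (2 * T0 * (r1 * r2 * r3 + r1 * r2 * r4 + r1 * r3 * r4 + r2 * r3 * r4)
     - (r1 + r2 + r3 + r4) * (r1 ^+ 2 * (T0 - t1) + r2 ^+ 2 * (T0 - t2)
      + r3 ^+ 2 * (T0 - t3) + r4 ^+ 2 * (T0 - t4))) / (Q * e4))); last first.
    by rewrite wt oppr0 mul0r.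
  rewrite /h0 /T0 /e4; move: Q_gt0; move: (Q) => Q0 Q0_gt0.
  by field; rewrite !gt_eqF.
have Qe : (r1 * r2 * r3 + r1 * r2 * r4 + r1 * r3 * r4 + r2 * r3 * r4) ^+ 2 <
   4 * (r1 * r2 + r1 * r3 + r1 * r4 + r2 * r3 + r2 * r4 + r3 * r4) * e4.
  rewrite -subr_gt0.
  set X := (X in 0 < X).
  have -> : X = Q * e4 ^+ 2 by rewrite /X /Q /S /e4; field; rewrite !gt_eqF.
  by rewrite mulr_gt0 // exprn_gt0.
have G_gt0 : [|| T - t r1 u1 != 0, T - t r2 u2 != 0, T - t r3 u3 != 0 | T - t r4 u4 != 0] -> 0 < G.
  move=> c0; rewrite /G subr_gt0.
  exact: (tetra_form_gt0 r1_gt0 r2_gt0 r3_gt0 r4_gt0 Qe rc c0).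
case: (boolP [|| T - t r1 u1 != 0, T - t r2 u2 != 0, T - t r3 u3 != 0 | T - t r4 u4 != 0]) => c0.
  have := G_gt0 c0; rewrite FE => G0; split.
    by rewrite oppr_le0 divr_ge0 // ltW // mulr_gt0.
  move=> /eqP; rewrite oppr_eq0 mulf_eq0 gt_eqF //= invr_eq0 gt_eqF // mulr_gt0 //.
have {c0}[c1 c2 c3 c4] : [/\ T - t r1 u1 = 0, T - t r2 u2 = 0, T - t r3 u3 = 0 & T - t r4 u4 = 0].
  by move: c0; rewrite !negb_or !negbK => /and4P[/eqP ? /eqP ? /eqP ? /eqP ?].
split; first by rewrite /F c1 c2 c3 c4 !mulr0 !addr0.
move=> _; exists (- a).
(* The four d_i add up to 3 T, so their vanishing forces every t_i to vanish as well. *)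
have T0 : T = 0.
  have : (T - t r1 u1) + (T - t r2 u2) + (T - t r3 u3) + (T - t r4 u4) = 3 * T by rewrite /T; ring.
  by rewrite c1 c2 c3 c4; lra.
have d r u : T - t r u = 0 -> dq r u = a * q r.
  move=> tT; have := tE r u; have -> : t r u = 0 by lra.
  rewrite mul0r => /esym/eqP; rewrite mulf_eq0 gt_eqF //= subr_eq0 => /eqP //.
have xs : dS = a * S.
  have -> : dS = (dq r1 u1 + dq r2 u2 + dq r3 u3 + dq r4 u4) / 2.
    by rewrite /dq /dS; field.
  by rewrite !d // /q /S; field; rewrite !gt_eqF.
have uE r u : 0 < r -> T - t r u = 0 -> u = - a * r.
  move=> r0 tT; have -> : u = - r ^+ 2 * ((dS - dq r u) / 2).
    by rewrite /dq /xi; field; rewrite gt_eqF.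
  by rewrite d // xs /q; field; rewrite gt_eqF.
by split; apply: uE.
Qed.

End angle_form.

(** * Lebesgue measure on R^3 and rotations *)

Notation push_measure m mf :=
  (measure_function_pushforward__canonical__measure_function_Measure m mf).

Definition measure_preserving (d : measure_display) (T : measurableType d)
    (R : realType) (m : set T -> \bar R) (f : T -> T) : Prop :=
  measurable_fun [set: T] f /\ forall A, measurable A -> m (f @^-1` A) = m A.

Lemma measure_preserving_comp d (T : measurableType d) (R : realType)
    (m : set T -> \bar R) (f g : T -> T) :
  measure_preserving m f -> measure_preserving m g ->
  measure_preserving m (g \o f).
Proof.
move=> [mf pf] [mg pg]; split; first exact: measurableT_comp.
move=> A mA; rewrite comp_preimage pf ?pg //.
by rewrite -[X in measurable X]setTI; exact: mg.
Qed.

Lemma measure_preserving_id d (T : measurableType d) (R : realType)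
  (m : set T -> \bar R) : measure_preserving m id.
Proof. by split. Qed.

(** The image measure agrees with the product measure on boxes, and a product of sigma-finite
    measures is determined by its values there. *)
Lemma measure_preserving_boxes d1 d2 (X : measurableType d1)
    (Y : measurableType d2) (R : realType)
    (m1 : {sigma_finite_measure set X -> \bar R})
    (m2 : {sigma_finite_measure set Y -> \bar R}) (f : X * Y -> X * Y) :
  measurable_fun [set: X * Y] f ->
  (forall B C, measurable B -> measurable C ->
     (m1 \x m2)%E (f @^-1` (B `*` C)) = (m1 B * m2 C)%E) ->
  measure_preserving (m1 \x m2)%E f.
Proof.
move=> mf fE; split=> // A mA; apply/esym.
exact: (@product_measure_unique _ _ _ _ _ m1 m2 (push_measure (m1 \x m2)%E mf)).
Qed.

(** Tonelli's theorem for sets: the volume may be computed by slicing along either factor. *)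
Lemma product_measure12 d1 d2 (X : measurableType d1)
    (Y : measurableType d2) (R : realType)
    (m1 : {sigma_finite_measure set X -> \bar R})
    (m2 : {sigma_finite_measure set Y -> \bar R}) (A : set (X * Y)) :
  measurable A -> (m1 \x m2)%E A = (m1 \x^ m2)%E A.
Proof.
by apply: product_measure_unique => *; exact: product_measure2E.
Qed.

Lemma preimage_measurable d d' (X : measurableType d) (Y : measurableType d')
    (f : X -> Y) (A : set Y) :
  measurable_fun [set: X] f -> measurable A -> measurable (f @^-1` A).
Proof. by move=> mf mA; rewrite -[X in measurable X]setTI; exact: mf. Qed.

Lemma measure_preserving_prod d1 d2 (X : measurableType d1)
    (Y : measurableType d2) (R : realType) (m1 : {sigma_finite_measure set X -> \bar R})
    (m2 : {sigma_finite_measure set Y -> \bar R}) (f : X -> X) (g : Y -> Y) :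
  measure_preserving m1 f -> measure_preserving m2 g ->
  measure_preserving (m1 \x m2)%E (fun p => (f p.1, g p.2)).
Proof.
move=> [mf pf] [mg pg].
have mfg : measurable_fun [set: X * Y] (fun p => (f p.1, g p.2)).
  by apply: measurable_fun_pair; apply: measurableT_comp.
apply: measure_preserving_boxes => // B C mB mC.
rewrite -(pf _ mB) -(pg _ mC) -product_measure1E //.
- by rewrite -[X in measurable X]setTI; exact: mf.
- by rewrite -[X in measurable X]setTI; exact: mg.
Qed.

(* The library declares this structure but shadows it by the one on products
   of subprobabilities. *)
Definition product_sigma_finite d1 d2 (X : measurableType d1)
    (Y : measurableType d2) (R : realType)
    (m1 : {sigma_finite_measure set X -> \bar R})
    (m2 : {sigma_finite_measure set Y -> \bar R}) :
  {sigma_finite_measure set (X * Y)%type -> \bar R} :=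
  HB.pack (m1 \x m2)%E (Measure_isSigmaFinite.Build _ _ _ (m1 \x m2)%E
    (let: isSigmaFinite.Axioms_ h := lebesgue_integral_fubini.measure_function_Measure_isSigmaFinite__to__measure_function_isSigmaFinite m1 m2 in h)).

Lemma measure_preserving_swap d (X : measurableType d) (R : realType)
    (m : {sigma_finite_measure set X -> \bar R}) :
  measure_preserving (m \x m)%E (fun p => (p.2, p.1)).
Proof.
apply: measure_preserving_boxes; first exact: measurable_fun_pair.
move=> B C mB mC; rewrite muleC -product_measure1E //; congr ((_ \x _)%E _).
by apply/seteqP; split => -[x y] /= [].
Qed.

(** The triple product is bracketed to the left, so this exchange is not a product of two maps. For
    a box with base B in the plane, the slice of the preimage at height z is a slice of B times
    C. *)
Lemma measure_preserving_swap3 d (X : measurableType d) (R : realType)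
    (m : {sigma_finite_measure set X -> \bar R}) :
  measure_preserving ((m \x m) \x m)%E (fun p => ((p.1.1, p.2), p.1.2)).
Proof.
have mf : measurable_fun [set: X * X * X] (fun p => ((p.1.1, p.2), p.1.2)).
  apply: measurable_fun_pair; last exact: measurableT_comp.
  by apply: measurable_fun_pair => //; exact: measurableT_comp.
apply: (@measure_preserving_boxes _ _ _ _ _ (product_sigma_finite m m) m _ mf) => B C mB mC.
rewrite (product_measure12 (product_sigma_finite m m)); last by apply: preimage_measurable => //; exact: measurableX.
transitivity (\int[m]_z (m (ysection B z) * m C))%E.
  apply: eq_integral => z _ /=; rewrite -product_measure1E //; last exact: measurable_ysection.
  congr ((_ \x _)%E _); rewrite /ysection.
  by apply/seteqP; split => -[x y] /=; rewrite !inE.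
rewrite ge0_integralZr //; last exact: measurable_fun_ysection.
by congr (_ * _)%E; exact/esym/product_measure12.
Qed.

Section lebesgue_preserving.
Variable R : realType.
Local Notation leb := (@lebesgue_measure R).
Local Notation T1 := (measurableTypeR R).

Lemma lebesgue_measure_shift (c : R) :
  measure_preserving leb ((fun x : T1 => x + c) : T1 -> T1).
Proof.
have mc : measurable_fun [set: T1] ((fun x : T1 => x + c) : T1 -> T1).
  exact: measurable_funD.
split=> // A mA.
apply/esym; rewrite -/(pushforward leb (fun x : T1 => x + c : T1) A).
apply: (@lebesgue_measure_unique R (pushforward leb (fun x : T1 => x + c : T1))) => // _ [[a b]] _ <-.
rewrite /= /pushforward /=.
rewrite (_ : _ @^-1` _ = `]a - c, b - c]%classic); last first.
  by apply/seteqP; split=> x /=; rewrite !in_itv /= ltrBlDr lerBrDr.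
rewrite !lebesgue_measure_itv /= !lte_fin ltrD2r.
by case: ifP => // _; rewrite -!EFinB; congr (_%:E); ring.
Qed.

Local Notation leb2 := (leb \x leb)%E.
Local Notation leb3 := (leb2 \x leb)%E.

(** On each horizontal slice the shear is a translation. *)
Lemma measure_preserving_shear (a : R) :
  measure_preserving leb2 ((fun p => (p.1 + a * p.2, p.2)) : T1 * T1 -> T1 * T1).
Proof.
set f := (X in measure_preserving _ X).
have mf : measurable_fun [set: T1 * T1] f.
  apply: measurable_fun_pair => //=.
  by apply: measurable_funD => //; exact: measurable_funM.
apply: measure_preserving_boxes => // B C mB mC.
rewrite product_measure12; last by apply: preimage_measurable => //; exact: measurableX.
transitivity ((leb \x^ leb)%E (B `*` C)); last exact: product_measure2E.
apply: eq_integral => y _ /=.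
have [yC|yC] := pselect (C y).
  transitivity (leb ((fun x : T1 => x + a * y : T1) @^-1` B)).
    by congr leb; rewrite /ysection; apply/seteqP; split => x /=; rewrite !inE /f /=; tauto.
  have -> : ysection (B `*` C) y = B.
    by apply/seteqP; split => x /=; rewrite /ysection /= inE /=; tauto.
  by rewrite (lebesgue_measure_shift _).2.
congr leb; rewrite /ysection; apply/seteqP; split => x /=; rewrite !inE /f /=; tauto.
Qed.

End lebesgue_preserving.

(** * Rotations of the plane and of space preserve Lebesgue measure *)

Section rotations.
Variable R : realType.
Local Notation leb := (@lebesgue_measure R).
Local Notation leb2 := (leb \x leb)%E.
Local Notation leb3 := (leb2 \x leb)%E.
Local Notation T1 := (measurableTypeR R).
Local Notation V := (T1 * T1 * T1)%type.

Lemma measure_preserving_shear' (a : R) :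
  measure_preserving leb2 ((fun p => (p.1, p.2 + a * p.1)) : T1 * T1 -> T1 * T1).
Proof.
have sw := measure_preserving_swap leb.
exact: (measure_preserving_comp sw
  (measure_preserving_comp (measure_preserving_shear a) sw)).
Qed.

Lemma measure_preserving_rot2 (c s : R) : c ^+ 2 + s ^+ 2 = 1 ->
  measure_preserving leb2
    ((fun p => (c * p.1 - s * p.2, s * p.1 + c * p.2)) : T1 * T1 -> T1 * T1).
Proof.
(* A rotation other than the half-turn is a product of three shears. *)
have shears (c' s' : R) : c' ^+ 2 + s' ^+ 2 = 1 -> s' != 0 ->
    measure_preserving leb2 ((fun p =>
      (c' * p.1 - s' * p.2, s' * p.1 + c' * p.2)) : T1 * T1 -> T1 * T1).
  (* For the angle theta this is - tan (theta / 2): the rotation is a horizontal shear by [a], a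
     vertical one by [s'], and again the horizontal one. *)
  move=> cs s0; pose a := (c' - 1) / s'.
  have := measure_preserving_comp (measure_preserving_shear a)
    (measure_preserving_comp (measure_preserving_shear' s')
      (measure_preserving_shear a)).
  congr measure_preserving; apply/funext => -[x y] /=.
  have E : s' * a = c' - 1 by rewrite /a mulrC divfK.
  have E2 : a * (1 + c') = - s'.
    apply: (mulfI s0); rewrite mulrA E mulrN -expr2.
    have -> : s' ^+ 2 = 1 - c' ^+ 2 by rewrite -cs; ring.
    by ring.
  congr pair.
    transitivity (x + (s' * a) * x + (a * (1 + (s' * a)) + a) * y); first by ring.
    have -> : a * (1 + s' * a) + a = a * (1 + c') by rewrite E; ring.
    by rewrite E E2; ring.
  transitivity (s' * x + (1 + s' * a) * y); first by ring.
  by rewrite E; ring.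
move=> cs; have [s0|] := eqVneq s 0; last exact: shears.
have [c1|cN1] : c = 1 \/ c = -1.
- have : (c - 1) * (c + 1) == 0.
    by apply/eqP; rewrite s0 in cs; rewrite -[RHS](subrr 1) -{3}cs; ring.
  by rewrite mulf_eq0 subr_eq0 addr_eq0 => /orP[] /eqP; [left|right].
- have := @measure_preserving_id _ _ _ leb2.
  congr measure_preserving; apply/funext => -[x y] /=; rewrite s0 c1.
  by congr pair; rewrite /=; ring.
(* The half-turn is the square of the quarter-turn, whose sine is 1. *)
- have h : measure_preserving leb2 ((fun p => (0 * p.1 - 1 * p.2, 1 * p.1 + 0 * p.2)) : T1 * T1 -> T1 * T1).
    by apply: shears; rewrite ?oner_eq0 //; ring.
  have := measure_preserving_comp h h.
  congr measure_preserving; apply/funext => -[x y] /=; rewrite s0 cN1.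
  by congr pair; ring.
Qed.

Lemma measure_preserving_opp3 :
  measure_preserving leb3 ((fun p => ((- p.1.1, - p.1.2), - p.2)) : V -> V).
Proof.
have h : measure_preserving leb (-%R : T1 -> T1).
  by split; [exact: oppr_measurable|move=> A mA; exact: lebesgue_measureN].
exact: (@measure_preserving_prod _ _ _ _ _ (product_sigma_finite leb leb) leb
   _ _ (measure_preserving_prod h h) h).
Qed.

Definition dot3 (x y : V) : R :=
  x.1.1 * y.1.1 + x.1.2 * y.1.2 + x.2 * y.2.

Definition isometry3 (f : V -> V) : Prop :=
  measure_preserving leb3 f /\ forall x y, dot3 (f x) (f y) = dot3 x y.

Lemma isometry3_comp f g : isometry3 f -> isometry3 g -> isometry3 (g \o f).
Proof.
move=> [mf df] [mg dg]; split; first exact: measure_preserving_comp.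
by move=> x y /=; rewrite dg df.
Qed.

Lemma isometry3_opp : isometry3 (fun p => ((- p.1.1, - p.1.2), - p.2)).
Proof.
by split; [exact: measure_preserving_opp3|move=> x y; rewrite /dot3 /=; ring].
Qed.

Let swap12 : isometry3 (fun p => ((p.1.2, p.1.1), p.2)).
Proof.
split; last by move=> x y; rewrite /dot3 /=; ring.
exact: (@measure_preserving_prod _ _ _ _ _ (product_sigma_finite leb leb) leb
   _ _ (measure_preserving_swap leb) (measure_preserving_id leb)).
Qed.

Let swap23 : isometry3 (fun p => ((p.1.1, p.2), p.1.2)).
Proof.
split; last by move=> x y; rewrite /dot3 /=; ring.
exact: measure_preserving_swap3.
Qed.

Lemma isometry3_rot12 (c s : R) : c ^+ 2 + s ^+ 2 = 1 ->
  isometry3 (fun p => ((c * p.1.1 - s * p.1.2, s * p.1.1 + c * p.1.2), p.2)).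
Proof.
move=> cs; split; last first.
  move=> x y; rewrite /dot3 /=.
  transitivity ((c ^+ 2 + s ^+ 2) * (x.1.1 * y.1.1 + x.1.2 * y.1.2) + x.2 * y.2).
    by ring.
  by rewrite cs mul1r.
exact: (@measure_preserving_prod _ _ _ _ _ (product_sigma_finite leb leb) leb
   _ _ (measure_preserving_rot2 cs) (measure_preserving_id leb)).
Qed.

Lemma isometry3_rot13 (c s : R) : c ^+ 2 + s ^+ 2 = 1 ->
  isometry3 (fun p => ((c * p.1.1 - s * p.2, p.1.2), s * p.1.1 + c * p.2)).
Proof.
move=> cs.
exact: (isometry3_comp swap23 (isometry3_comp (isometry3_rot12 cs) swap23)).
Qed.

Lemma isometry3_rot23 (c s : R) : c ^+ 2 + s ^+ 2 = 1 ->
  isometry3 (fun p => ((p.1.1, c * p.1.2 - s * p.2), s * p.1.2 + c * p.2)).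
Proof.
move=> cs.
exact: (isometry3_comp swap12 (isometry3_comp (isometry3_rot13 cs) swap12)).
Qed.

Lemma exists_rotation_to_axis (x y : R) : exists c s,
  [/\ c ^+ 2 + s ^+ 2 = 1, 0 <= c * x - s * y & s * x + c * y = 0].
Proof.
have [r0|r0] := eqVneq (x ^+ 2 + y ^+ 2) 0.
  exists 1, 0; move: r0 => /eqP; rewrite paddr_eq0 ?sqr_ge0 // !sqrf_eq0.
  by move=> /andP[/eqP -> /eqP ->]; split; rewrite ?expr1n ?mulr0 ?subrr ?addr0 //; ring.
have r_gt0 : 0 < x ^+ 2 + y ^+ 2 by rewrite lt_neqAle eq_sym r0 addr_ge0 ?sqr_ge0.
set r := Num.sqrt (x ^+ 2 + y ^+ 2).
have rr : r ^+ 2 = x ^+ 2 + y ^+ 2 by rewrite sqr_sqrtr // ltW.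
have rp : 0 < r by rewrite sqrtr_gt0.
exists (x / r), (- y / r); split.
- transitivity ((x ^+ 2 + y ^+ 2) / r ^+ 2); first by field; rewrite gt_eqF.
  by rewrite rr divff.
- have -> : x / r * x - - y / r * y = (x ^+ 2 + y ^+ 2) / r by field; rewrite gt_eqF.
  by rewrite divr_ge0 // ltW.
- by field; rewrite gt_eqF.
Qed.

(** Three Givens rotations: two bring n onto the first half-axis, and the third, about that axis,
    brings m into the upper half of the coordinate plane without moving n. *)
Lemma exists_isometry3_to_plane (n m : V) : exists f,
  [/\ isometry3 f, (f n).1.2 = 0 /\ (f n).2 = 0, 0 <= (f n).1.1,
      (f m).2 = 0 & 0 <= (f m).1.2].
Proof.
have [c1 [s1 [cs1 n1 n2]]] := exists_rotation_to_axis n.1.1 n.1.2.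
set x := c1 * _ - _ in n1.
have [c2 [s2 [cs2 n3 n4]]] := exists_rotation_to_axis x n.2.
pose g := (fun p => ((c2 * p.1.1 - s2 * p.2, p.1.2), s2 * p.1.1 + c2 * p.2))
  \o (fun p : V => ((c1 * p.1.1 - s1 * p.1.2, s1 * p.1.1 + c1 * p.1.2), p.2)).
have [c3 [s3 [cs3 n5 n6]]] := exists_rotation_to_axis (g m).1.2 (g m).2.
exists ((fun p => ((p.1.1, c3 * p.1.2 - s3 * p.2), s3 * p.1.2 + c3 * p.2)) \o g).
split; rewrite /= ?n2 -/x ?n4 ?mulr0 ?subrr ?addr0 //.
apply: isometry3_comp (isometry3_rot23 cs3).
exact: isometry3_comp (isometry3_rot12 cs1) (isometry3_rot13 cs2).
Qed.

End rotations.

(** * Volumes of polyhedral cones in the unit ball *)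

(* Locked: otherwise failing conversions between volumes unfold the Lebesgue
   integral. *)
HB.lock Definition vol (R : realType) (A : set (measurableTypeR R * measurableTypeR R * measurableTypeR R)) : R :=
  fine (((@lebesgue_measure R \x @lebesgue_measure R) \x @lebesgue_measure R)%E A).

Section cells.
Variable R : realType.
Local Notation leb := (@lebesgue_measure R).
Local Notation T1 := (measurableTypeR R).
Local Notation V := (T1 * T1 * T1)%type.
Local Notation leb3 := ((leb \x leb) \x leb)%E.
Implicit Types (n m : V) (s : seq V).

Definition opp3 (n : V) : V := ((- n.1.1, - n.1.2), - n.2).

Definition scale3 (k : R) (n : V) : V := ((k * n.1.1, k * n.1.2), k * n.2).

(** The list holds inward normals. The inequalities are strict, so that a normal and its opposite
    cut out disjoint cells. *)
Definition cell s : set V :=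
  [set x | (forall n, n \in s -> 0 < dot3 n x) /\ dot3 x x <= 1].

Lemma measurable_dot3 n : measurable_fun [set: V] (dot3 n : V -> R).
Proof.
rewrite /dot3; apply: measurable_funD; last by apply: measurable_funM.
by apply: measurable_funD; apply: measurable_funM => //; exact: measurableT_comp.
Qed.

Lemma measurable_dot3_gt0 n : measurable [set x : V | 0 < dot3 n x].
Proof.
have := preimage_measurable (measurable_dot3 n) (measurable_itv `]0, +oo[).
by congr measurable; apply/seteqP; split => x /=; rewrite in_itv /= andbT.
Qed.

Lemma measurable_ball3 : measurable [set x : V | dot3 x x <= 1].
Proof.
have mf : measurable_fun [set: V] ((fun x => dot3 x x) : V -> R).
  rewrite /dot3; apply: measurable_funD; last by apply: measurable_funM.
  by apply: measurable_funD; apply: measurable_funM; exact: measurableT_comp.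
have := preimage_measurable mf (measurable_itv `]-oo, 1]).
by congr measurable; apply/seteqP; split => x /=; rewrite in_itv /=.
Qed.

Lemma cell_cons n s : cell (n :: s) = [set x | 0 < dot3 n x] `&` cell s.
Proof.
apply/seteqP; split => x /=.
  move=> [h b]; split; first by apply: h; rewrite mem_head.
  by split => // m ms; apply: h; rewrite inE ms orbT.
by move=> [nx [h b]]; split => // m; rewrite inE => /orP[/eqP ->//|]; exact: h.
Qed.

Lemma measurable_cell s : measurable (cell s).
Proof.
elim: s => [|n s ih]; last first.
  by rewrite cell_cons; apply: measurableI => //; exact: measurable_dot3_gt0.
have := measurable_ball3; congr measurable.
by apply/seteqP; split => x /= => [?|[]].
Qed.

(** Finiteness is what makes [vol], defined with [fine], additive. The ball is enclosed in a
    cube. *)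
Lemma leb3_ball_lty (A : set V) : measurable A ->
  A `<=` [set x | dot3 x x <= 1] -> (leb3 A < +oo)%E.
Proof.
move=> mA AB.
pose I : set T1 := `[-1, 1]%classic.
have mI : measurable I by exact: measurable_itv.
have sub : A `<=` (I `*` I) `*` I.
  move=> x /AB /=; rewrite /dot3 => h.
  have := sqr_ge0 x.1.1; have := sqr_ge0 x.1.2; have := sqr_ge0 x.2 => h1 h2 h3.
  by rewrite /I /= !in_itv /=; repeat split; apply/andP; split; nra.
apply: (@le_lt_trans _ _ (leb3 ((I `*` I) `*` I))).
  by apply: le_measure => //; rewrite inE //; apply: measurableX => //; exact: measurableX.
have -> : leb3 ((I `*` I) `*` I) = (leb I * leb I * leb I)%E.
  transitivity ((leb \x leb)%E (I `*` I) * leb I)%E.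
    by rewrite product_measure1E //; exact: measurableX.
  by rewrite product_measure1E.
rewrite lebesgue_measure_itv /= lte_fin ifT; last by lra.
by rewrite -EFinB -!EFinM ltry.
Qed.

Lemma cell_sub_ball s : cell s `<=` [set x | dot3 x x <= 1].
Proof. by move=> x []. Qed.

Lemma vol_setU (A B : set V) : measurable A -> measurable B ->
  A `<=` [set x | dot3 x x <= 1] -> B `<=` [set x | dot3 x x <= 1] ->
  A `&` B = set0 -> vol (A `|` B) = vol A + vol B.
Proof.
move=> mA mB Ab Bb AB; rewrite vol.unlock measureU // fineD //.
  by rewrite ge0_fin_numE // leb3_ball_lty.
by rewrite ge0_fin_numE // leb3_ball_lty.
Qed.

Lemma vol_isometry (f : V -> V) (A : set V) :
  isometry3 f -> measurable A -> vol (f @^-1` A) = vol A.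
Proof. by move=> [[_ mf] _] mA; rewrite !vol.unlock mf. Qed.

Lemma cell_isometry (f : V -> V) s : isometry3 f ->
  vol (cell (map f s)) = vol (cell s).
Proof.
move=> If; rewrite -(vol_isometry If (measurable_cell _)); congr vol.
have [_ df] := If; apply/seteqP; split => x /=.
  move=> [h b]; split; last by rewrite -df.
  by move=> n ns; rewrite -df; apply: h; exact: map_f.
move=> [h b]; split; last by rewrite df.
by move=> _ /mapP[n ns ->]; rewrite df; exact: h.
Qed.

(** An isometry turns the plane into {0} x R x R, a box with one factor of measure 0. *)
Lemma leb3_plane n : dot3 n n != 0 -> leb3 [set x | dot3 n x = 0] = 0%E.
Proof.
move=> n0; have [f [If [n2 n3] n1 _ _]] := exists_isometry3_to_plane n n.
have [[_ mf] df] := If.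
have n1_neq0 : (f n).1.1 != 0.
  apply: contra n0 => /eqP e; rewrite -df /dot3 e n2 n3; apply/eqP; ring.
have mE : measurable (([set (0%R : R)] : set T1) `*` [set: T1] `*` [set: T1]).
  by apply: measurableX => //; apply: measurableX => //; exact: measurable_set1.
transitivity (leb3 (f @^-1` (([set (0%R : R)] : set T1) `*` [set: T1] `*` [set: T1]))).
  congr (_ _); apply/seteqP; split => x /=; rewrite -df /dot3 n2 n3 !mul0r !addr0.
    by move/eqP; rewrite mulf_eq0 (negbTE n1_neq0) /= => /eqP.
  by move=> [[-> _] _]; rewrite mulr0.
rewrite mf //.
transitivity ((leb \x leb)%E (([set (0%R : R)] : set T1) `*` [set: T1]) * leb [set: T1])%E.
  by rewrite product_measure1E //; apply: measurableX.
have -> : (leb \x leb)%E (([set (0%R : R)] : set T1) `*` [set: T1]) = (leb [set (0%R : R)] * leb [set: T1])%E.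
  by rewrite product_measure1E.
by rewrite lebesgue_measure_set1 !mul0e.
Qed.

Lemma vol_cell_split n s : dot3 n n != 0 ->
  vol (cell s) = vol (cell (n :: s)) + vol (cell (opp3 n :: s)).
Proof.
move=> n0.
have dopp x : dot3 (opp3 n) x = - dot3 n x by rewrite /dot3 /opp3 /=; ring.
rewrite -vol_setU; [|exact: measurable_cell|exact: measurable_cell|
  exact: cell_sub_ball|exact: cell_sub_ball|]; last first.
  apply/seteqP; split => // x []; rewrite !cell_cons /= dopp.
  by move=> [h _] [h' _]; lra.
rewrite vol.unlock; congr fine; apply/eqP; rewrite eq_le; apply/andP; split; last first.
  apply: le_measure; rewrite ?inE; first by apply: measurableU; exact: measurable_cell.
    exact: measurable_cell.
  by move=> x []; rewrite cell_cons => -[].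
have mP : measurable [set x : V | dot3 n x = 0].
  have := preimage_measurable (measurable_dot3 n) (measurable_set1 (0 : T1)).
  by congr measurable; apply/seteqP; split.
rewrite -[leRHS]adde0 -(leb3_plane n0).
apply: le_trans (measureU2 _ _ _) => //; last by apply: measurableU; exact: measurable_cell.
apply: le_measure; rewrite ?inE.
- exact: measurable_cell.
- by apply: measurableU => //; apply: measurableU; exact: measurable_cell.
move=> x xs; rewrite !cell_cons /= dopp.
by have [h|h|h] := ltgtP (dot3 n x) 0; [left; right|left; left|right]; rewrite ?oppr_gt0.
Qed.

Lemma cell_eq_mem s t : s =i t -> cell s = cell t.
Proof. by move=> st; apply/seteqP; split => x [h b]; split => // n; [rewrite -st|rewrite st]; exact: h. Qed.

Lemma vol_cell_opp s : vol (cell (map opp3 s)) = vol (cell s).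
Proof. exact: (cell_isometry _ (isometry3_opp R)). Qed.

Lemma cell_scale k n s : 0 < k -> cell (scale3 k n :: s) = cell (n :: s).
Proof.
move=> k0; rewrite !cell_cons; congr setI; apply/seteqP; split => x /=;
have -> : dot3 (scale3 k n) x = k * dot3 n x by rewrite /dot3 /scale3 /=; ring.
  by rewrite pmulr_rgt0.
by rewrite pmulr_rgt0.
Qed.

Definition half_ball : R := vol (cell [:: ((1, 0), 0)]).

Lemma half_ball_gt0 : 0 < half_ball.
Proof.
pose I : set T1 := `]0, 2^-1]%classic.
have mI : measurable I by exact: measurable_itv.
have lI : leb I = (2^-1)%:E.
  rewrite /I lebesgue_measure_itv /= lte_fin ifT; last by rewrite invr_gt0.
  by rewrite -EFinB subr0.
rewrite /half_ball vol.unlock fine_gt0 //; apply/andP; split; last first.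
  by apply: leb3_ball_lty; [exact: measurable_cell|exact: cell_sub_ball].
apply: (@lt_le_trans _ _ (leb3 ((I `*` I) `*` I))); last first.
  apply: le_measure; rewrite ?inE.
  - by apply: measurableX => //; exact: measurableX.
  - exact: measurable_cell.
  move=> x /= []; rewrite /I /= => -[]; rewrite !in_itv /= => /andP[h1 h2] /andP[h3 h4] /andP[h5 h6].
  split; last by rewrite /dot3; nra.
  by move=> n; rewrite inE => /eqP ->; rewrite /dot3 /=; lra.
have -> : leb3 ((I `*` I) `*` I) = (leb I * leb I * leb I)%E.
  transitivity ((leb \x leb)%E (I `*` I) * leb I)%E.
    by rewrite product_measure1E //; exact: measurableX.
  by rewrite product_measure1E.
by rewrite lI -!EFinM lte_fin !mulr_gt0 ?invr_gt0.
Qed.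

Lemma vol_cell1 n : dot3 n n != 0 -> vol (cell [:: n]) = half_ball.
Proof.
move=> n0; have [f [If [n2 n3] n1 _ _]] := exists_isometry3_to_plane n n.
have [_ df] := If.
have n1_gt0 : 0 < (f n).1.1.
  rewrite lt_neqAle n1 andbT eq_sym; apply: contra n0 => /eqP e.
  by rewrite -df /dot3 e n2 n3; apply/eqP; ring.
rewrite -(cell_isometry _ If) /half_ball -(cell_scale ((1, 0), 0) [::] n1_gt0) /=.
congr (vol (cell [:: _])); rewrite /scale3 /= mulr1 !mulr0.
by move: n2 n3; case: (f n) => -[/= ? ?] ? -> ->.
Qed.

End cells.

(** Cauchy's functional equation on an interval. Nonnegativity makes f monotone, so f t is squeezed
    between consecutive multiples of f (P / n), and the error f P / n is arbitrarily small. *)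
Lemma additive_linear (R : realType) (f : R -> R) (P : R) : 0 < P ->
  (forall t, 0 < t <= P -> 0 <= f t) ->
  (forall s t, 0 < s -> 0 < t -> s + t <= P -> f (s + t) = f s + f t) ->
  forall t, 0 < t <= P -> f t = f P * t / P.
Proof.
move=> P0 f0 fD.
have fle s t : 0 < s -> s <= t -> t <= P -> f s <= f t.
  move=> s0; rewrite le_eqVlt => /orP[/eqP -> //|st] tP.
  have -> : t = s + (t - s) by ring.
  rewrite fD ?subr_gt0 //; last by rewrite addrC subrK.
  by rewrite lerDl f0 // subr_gt0 st /=; lra.
have fM s k : 0 < s -> k.+1%:R * s <= P -> f (k.+1%:R * s) = k.+1%:R * f s.
  move=> s0; elim: k => [|k ih]; first by rewrite !mul1r.
  move=> kP; have ksP : k.+1%:R * s <= P.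
    by apply: le_trans kP; rewrite ler_pM2r // ler_nat.
  rewrite -natr1 mulrDl mul1r fD ?ih //; first by ring.
    by rewrite mulr_gt0.
  by move: kP; rewrite -natr1 mulrDl mul1r.
move=> t /andP[t0 tP].
have fP0 : 0 <= f P by rewrite f0 // P0 lexx.
have bound n : `|f t - f P * t / P| <= f P / n.+1%:R.
  set d := P / n.+1%:R.
  have d0 : 0 < d by rewrite divr_gt0.
  have nd : n.+1%:R * d = P by rewrite /d mulrC divfK.
  have fd : f P / n.+1%:R = f d.
    by rewrite -nd fM ?nd // mulrAC divff // mul1r.
  pose k := Num.truncn (t / d).
  have td0 : 0 <= t / d by rewrite divr_ge0 // ltW.
  have /andP[k1 k2] : (k%:R <= t / d < k.+1%:R) by exact: truncn_itv.
  rewrite ler_pdivlMr // in k1; rewrite ltr_pdivrMr // in k2.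
  have lb : k%:R * f d <= f t.
    case: k k1 {k2} => [|k] k1; first by rewrite mul0r f0 // t0.
    by rewrite -fM // ?(le_trans k1) // fle // mulr_gt0.
  have ub : f t <= k.+1%:R * f d.
    (* The multiple just above t may leave the interval; then k is at least n + 1 and f P serves as
       the upper bound. *)
    have [kP|Pk] := leP (k.+1%:R * d) P.
      by rewrite -fM // fle // ltW.
    apply: (@le_trans _ _ (f P)); first exact: fle.
    rewrite -{1}nd fM ?nd // ler_wpM2r // ?f0 ?d0 //=; last first.
      by rewrite ler_nat; move: Pk; rewrite -{1}nd ltr_pM2r // ltr_nat => /ltnW.
    by rewrite -nd ler_peMl // ?(ltW d0) // ler1n.
  have -> : f P * t / P = (t / d) * f d.
    by rewrite -fd /d; field; rewrite !gt_eqF //= pnatr_eq0.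
  have fd0 : 0 <= f d by rewrite -fd divr_ge0.
  rewrite fd ler_norml; apply/andP; split.
    have : t / d * f d <= k.+1%:R * f d by rewrite ler_wpM2r // ler_pdivrMr // ltW.
    by rewrite -natr1 mulrDl mul1r; lra.
  have : k%:R * f d <= t / d * f d by rewrite ler_wpM2r // ler_pdivlMr.
  by move: ub; rewrite -natr1 mulrDl mul1r; lra.
apply/eqP; rewrite -subr_eq0 -normr_le0 leNgt; apply/negP => e0.
set e := `|_| in e0 bound.
have [n] : exists n : nat, f P / e < n%:R by exists (Num.truncn (f P / e)).+1; exact: truncnS_gt.
rewrite ltr_pdivrMr // => h.
have := bound n; rewrite ler_pdivlMr //.
by rewrite -natr1 mulrDr mulr1; lra.
Qed.

(** * Volumes of wedges, and the spherical excess formula *)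

Section wedges.
Variable R : realType.
Local Notation leb := (@lebesgue_measure R).
Local Notation T1 := (measurableTypeR R).
Local Notation V := (T1 * T1 * T1)%type.
Local Notation leb3 := ((leb \x leb) \x leb)%E.
Implicit Types (n m : V) (s : seq V).

Lemma cell2C n m : cell [:: n; m] = cell [:: m; n].
Proof. by apply: cell_eq_mem => x; rewrite !inE orbC. Qed.

Lemma vol_cell2_to_plane n m : dot3 n n != 0 -> 0 < dot3 m m ->
  exists2 b : R, 0 <= b &
    vol (cell [:: n; m]) = vol (cell [:: ((1, 0), 0);
      ((dot3 n m / Num.sqrt (dot3 n n), b), 0)]) /\
    b ^+ 2 = dot3 m m - (dot3 n m) ^+ 2 / dot3 n n.
Proof.
move=> n0 m0; have [f [If [n2 n3] n1 m3 m2]] := exists_isometry3_to_plane n m.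
have [_ df] := If.
have nn : dot3 n n = (f n).1.1 ^+ 2 by rewrite -df /dot3 n2 n3; ring.
have nm : dot3 n m = (f n).1.1 * (f m).1.1 by rewrite -df /dot3 n2 n3; ring.
have mm : dot3 m m = (f m).1.1 ^+ 2 + (f m).1.2 ^+ 2 by rewrite -df /dot3 m3; ring.
have n1_neq0 : (f n).1.1 != 0 by move: n0; rewrite nn sqrf_eq0.
have n1_gt0 : 0 < (f n).1.1 by rewrite lt_neqAle n1 andbT eq_sym.
exists (f m).1.2 => //; split; last first.
  by rewrite nn nm mm; field.
rewrite -(cell_isometry _ If) -(cell_scale ((1, 0), 0) _ n1_gt0) /=.
rewrite nm nn sqrtr_sqr gtr0_norm // mulrAC divff // mul1r.
congr (vol (cell [:: _; _])); rewrite /scale3 /= ?mulr1 ?mulr0.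
  by move: n2 n3; case: (f n) => -[/= ? ?] ? -> ->.
by move: m3; case: (f m) => -[/= ? ?] ? ->.
Qed.

(** The two inward normals make the angle pi - t, so the faces of the wedge make the dihedral angle
    t. Hence the minus sign before the cosine in the lemmas below. *)
Definition wedge (t : R) : set V :=
  cell [:: ((1, 0), 0); ((- cos t, sin t), 0)].

Lemma vol_cell2_wedge n m t : 0 < dot3 n n -> 0 < dot3 m m -> 0 < t < pi ->
  dot3 n m = - (Num.sqrt (dot3 n n) * Num.sqrt (dot3 m m) * cos t) ->
  vol (cell [:: n; m]) = vol (wedge t).
Proof.
move=> n0 m0 /andP[t0 tpi] nm.
have [||b b0 [-> bE]] := @vol_cell2_to_plane n m; rewrite ?gt_eqF //.
have sn : 0 < Num.sqrt (dot3 n n) by rewrite sqrtr_gt0.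
have sm : 0 < Num.sqrt (dot3 m m) by rewrite sqrtr_gt0.
have st : 0 < sin t by apply: sin_gt0_pi; rewrite t0.
have -> : dot3 n m / Num.sqrt (dot3 n n) = Num.sqrt (dot3 m m) * - cos t.
  by rewrite nm; field; rewrite gt_eqF.
have -> : b = Num.sqrt (dot3 m m) * sin t.
  apply/eqP; rewrite -(@eqrXn2 _ 2%N) //; last by rewrite mulr_ge0 // ltW.
  have En : Num.sqrt (dot3 n n) ^+ 2 = dot3 n n by rewrite sqr_sqrtr // ltW.
  have Em : Num.sqrt (dot3 m m) ^+ 2 = dot3 m m by rewrite sqr_sqrtr // ltW.
  apply/eqP; rewrite bE nm sqrrN !exprMn sin2cos2 En Em; field.
  by rewrite gt_eqF.
rewrite /wedge !(cell2C (1, 0, 0)) -[in RHS](cell_scale _ _ sm).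
by congr (vol (cell [:: _; _])); rewrite /scale3 /= mulr0.
Qed.

Lemma vol_wedgeD (t1 t2 : R) : 0 < t1 -> 0 < t2 -> t1 + t2 <= pi ->
  vol (wedge (t1 + t2)) = vol (wedge t1) + vol (wedge t2).
Proof.
move=> t1_gt0 t2_gt0 t12.
have s1 : 0 < sin t1 by apply: sin_gt0_pi; rewrite t1_gt0 /=; lra.
have s2 : 0 < sin t2 by apply: sin_gt0_pi; rewrite t2_gt0 /=; lra.
have s12 : 0 <= sin (t1 + t2) by apply: sin_ge0_pi; rewrite t12 andbT addr_ge0 // ltW.
pose h t : V := ((- cos t, sin t), 0).
have hh t : dot3 (h t) (h t) = 1.
  by rewrite /dot3 /h /= -[RHS](cos2Dsin2 t); ring.
(* The three normals are coplanar and related with coefficients of known sign. The wedge is cut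
   along the middle one, and on each side of the cut this relation makes one of the three
   constraints redundant. *)
have key x : sin t1 * dot3 (h (t1 + t2)) x =
    sin (t1 + t2) * dot3 (h t1) x + sin t2 * x.1.1.
  have -> : sin t2 = sin (t1 + t2) * cos t1 - cos (t1 + t2) * sin t1.
    by rewrite -sinB; congr sin; ring.
  by rewrite /dot3 /h /=; ring.
have e1 x : dot3 ((1, 0), 0) x = x.1.1 by rewrite /dot3 /=; ring.
have eo x : dot3 (opp3 (h t1)) x = - dot3 (h t1) x by rewrite /dot3 /opp3 /=; ring.
rewrite /wedge -/(h (t1 + t2)) -/(h t1) (@vol_cell_split _ (h t1)); last first.
  by rewrite hh oner_eq0.
have -> : cell [:: h t1; ((1, 0), 0); h (t1 + t2)] = cell [:: ((1, 0), 0); h t1].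
  rewrite !cell_cons; apply/seteqP; split => x /=; rewrite e1; first by tauto.
  move=> [x1 [hx c]]; repeat split => //; rewrite -(pmulr_rgt0 _ s1) key.
  by rewrite ltr_wpDl ?mulr_gt0 // mulr_ge0 // ltW.
have -> : cell [:: opp3 (h t1); ((1, 0), 0); h (t1 + t2)] =
          cell [:: opp3 (h t1); h (t1 + t2)].
  rewrite !cell_cons; apply/seteqP; split => x /=; rewrite e1; first by tauto.
  move=> [hx [h12 c]]; repeat split => //; rewrite -(pmulr_rgt0 _ s2).
  have : 0 < sin t1 * dot3 (h (t1 + t2)) x by rewrite mulr_gt0.
  rewrite key; move: hx; rewrite eo oppr_gt0 => hx.
  have : sin (t1 + t2) * dot3 (h t1) x <= 0 by rewrite mulr_ge0_le0 // ltW.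
  by lra.
congr (_ + _); rewrite (@vol_cell2_wedge _ _ t2) //.
- by rewrite eo; rewrite /dot3 /opp3 /= -[X in _ < X]opprK; have := hh t1; rewrite /dot3 /h /=; lra.
- by rewrite hh.
- by rewrite t2_gt0 /=; lra.
have -> : dot3 (opp3 (h t1)) (opp3 (h t1)) = 1.
  by rewrite -[RHS](hh t1) /dot3 /opp3 /=; ring.
rewrite hh sqrtr1 !mul1r eo /dot3 /h /=.
have -> : cos t2 = cos (t1 + t2) * cos t1 + sin (t1 + t2) * sin t1.
  by rewrite -cosB; congr cos; ring.
ring.
Qed.

Lemma vol_wedge (t : R) : 0 < t <= pi -> vol (wedge t) = half_ball R * t / pi.
Proof.
move=> t_pi; rewrite (@additive_linear _ (fun t => vol (wedge t)) pi) ?pi_gt0 //.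
(* At t = pi the two normals coincide. *)
- congr (_ * _ / _); rewrite /half_ball; congr vol.
  rewrite /wedge cospi sinpi opprK.
  by apply: cell_eq_mem => x; rewrite !inE orbb.
- by move=> *; rewrite vol.unlock fine_ge0.
- by move=> *; exact: vol_wedgeD.
Qed.

(* The antipodal map identifies opposite octants cut out by n1, n2, n3, so the
   eight octants have only four distinct volumes, which are determined by the
   half ball and the three wedges. *)
Lemma girard (n1 n2 n3 : V) (t12 t13 t23 : R) :
  0 < dot3 n1 n1 -> 0 < dot3 n2 n2 -> 0 < dot3 n3 n3 ->
  0 < t12 < pi -> 0 < t13 < pi -> 0 < t23 < pi ->
  dot3 n1 n2 = - (Num.sqrt (dot3 n1 n1) * Num.sqrt (dot3 n2 n2) * cos t12) ->
  dot3 n1 n3 = - (Num.sqrt (dot3 n1 n1) * Num.sqrt (dot3 n3 n3) * cos t13) ->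
  dot3 n2 n3 = - (Num.sqrt (dot3 n2 n2) * Num.sqrt (dot3 n3 n3) * cos t23) ->
  vol (cell [:: n1; n2; n3]) = half_ball R / (2 * pi) * (t12 + t13 + t23 - pi).
Proof.
move=> n1_gt0 n2_gt0 n3_gt0 h12 h13 h23 e12 e13 e23.
have lune (n m : V) t : 0 < dot3 n n -> 0 < dot3 m m -> 0 < t < pi ->
    dot3 n m = - (Num.sqrt (dot3 n n) * Num.sqrt (dot3 m m) * cos t) ->
    vol (cell [:: n; m]) = half_ball R * t / pi.
  move=> n0 m0 t0pi nm; rewrite (vol_cell2_wedge n0 m0 t0pi nm) vol_wedge //.
  by move/andP: t0pi => [-> /ltW].
have := vol_cell1 (lt0r_neq0 n1_gt0).
rewrite (vol_cell_split _ (lt0r_neq0 n2_gt0)) cell2C (lune _ _ _ _ _ h12 e12) //.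
rewrite (vol_cell_split [:: opp3 n2; n1] (lt0r_neq0 n3_gt0)).
have := lune _ _ _ n1_gt0 n3_gt0 h13 e13.
rewrite (vol_cell_split _ (lt0r_neq0 n2_gt0)).
have := lune _ _ _ n2_gt0 n3_gt0 h23 e23.
rewrite (vol_cell_split _ (lt0r_neq0 n1_gt0)).
rewrite (@cell_eq_mem _ [:: n2; n1; n3] [:: n1; n2; n3]); last first.
  by move=> x; rewrite !inE orbCA.
rewrite (@cell_eq_mem _ [:: n3; opp3 n2; n1] [:: opp3 n2; n1; n3]); last first.
  by move=> x; rewrite !inE; do 3!case: (x == _).
have oppK : involutive (@opp3 R) by move=> [[a b] c]; rewrite /opp3 /= !opprK.
rewrite -(vol_cell_opp [:: opp3 n3; opp3 n2; n1]) /= !oppK.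
rewrite (@cell_eq_mem _ [:: n3; n2; opp3 n1] [:: opp3 n1; n2; n3]); last first.
  by move=> x; rewrite !inE; do 3!case: (x == _).
move=> E1 E2 E3.
have p0 : pi != 0 :> R by rewrite gt_eqF // pi_gt0.
have field_id (p h : R) : p != 0 -> h / (2 * p) * (t12 + t13 + t23 - p) =
    (h * t12 / p + h * t13 / p + h * t23 / p - h) / 2.
  by move=> ?; field.
rewrite field_id //.
by lra.
Qed.

End wedges.

(** * Solid angles of a sphere packing tetrahedron *)

Section apex.
Variable R : realType.
Local Notation T1 := (measurableTypeR R).
Local Notation V := (T1 * T1 * T1)%type.

Definition cross3 (x y : V) : V :=
  ((x.1.2 * y.2 - x.2 * y.1.2, x.2 * y.1.1 - x.1.1 * y.2),
   x.1.1 * y.1.2 - x.1.2 * y.1.1).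

Definition add3 (x y : V) : V := ((x.1.1 + y.1.1, x.1.2 + y.1.2), x.2 + y.2).

Definition det3 (x y z : V) : R := dot3 x (cross3 y z).

Lemma dot3C (x y : V) : dot3 x y = dot3 y x.
Proof. by rewrite /dot3; ring. Qed.

Lemma dot3_cross (a b c d : V) :
  dot3 (cross3 a b) (cross3 c d) = dot3 a c * dot3 b d - dot3 a d * dot3 b c.
Proof. by rewrite /dot3 /cross3 /=; ring. Qed.

Lemma dot3_scale k l (a b : V) :
  dot3 (scale3 k a) (scale3 l b) = k * l * dot3 a b.
Proof. by rewrite /dot3 /scale3 /=; ring. Qed.

Lemma det3_sqr (a b c : V) : (det3 a b c) ^+ 2 =
  dot3 a a * (dot3 b b * dot3 c c - dot3 b c ^+ 2)
  - dot3 a b * (dot3 a b * dot3 c c - dot3 b c * dot3 a c)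
  + dot3 a c * (dot3 a b * dot3 b c - dot3 b b * dot3 a c).
Proof. by rewrite /det3 /dot3 /cross3 /=; ring. Qed.

(* The angle between a face and the plane through one of its edges and the
   centre of the sphere tangent to the six edges; the dihedral angle along an
   edge is the sum of two such angles. *)
Definition half_dihedral (Q q : R) : R := atan (q / Num.sqrt Q).

Lemma half_dihedral_cos (Q q : R) : 0 < Q ->
  Num.sqrt (Q + q ^+ 2) * cos (half_dihedral Q q) = Num.sqrt Q.
Proof.
move=> Q0; have sQ : 0 < Num.sqrt Q by rewrite sqrtr_gt0.
have -> : Q + q ^+ 2 = Q * (1 + (q / Num.sqrt Q) ^+ 2).
  rewrite exprMn exprVn sqr_sqrtr ?ltW //; field; by rewrite gt_eqF.
rewrite cos_atan sqrtrM ?ltW // mulfK // gt_eqF // sqrtr_gt0 ltr_pwDl //.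
exact: sqr_ge0.
Qed.

Lemma half_dihedral_sin (Q q : R) : 0 < Q ->
  Num.sqrt (Q + q ^+ 2) * sin (half_dihedral Q q) = q.
Proof.
move=> Q0; have sQ : 0 < Num.sqrt Q by rewrite sqrtr_gt0.
have c0 : cos (half_dihedral Q q) != 0.
  by rewrite gt_eqF // cos_gt0_pihalf // atan_gtNpi2 atan_ltpi2.
have : tan (half_dihedral Q q) = q / Num.sqrt Q by rewrite atanK.
move=> /(congr1 (fun z => z * cos (half_dihedral Q q))); rewrite /tan divfK // => ->.
by rewrite mulrCA half_dihedral_cos // divfK // gt_eqF.
Qed.

Lemma half_dihedral_cosD (Q q p : R) : 0 < Q ->
  Num.sqrt (Q + q ^+ 2) * Num.sqrt (Q + p ^+ 2) *
    cos (half_dihedral Q q + half_dihedral Q p) = Q - q * p.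
Proof.
move=> Q0; rewrite cosD.
have -> : forall A B a b c d : R, A * B * (a * b - c * d) = (A * a) * (B * b) - (A * c) * (B * d).
  by move=> *; ring.
by rewrite !half_dihedral_cos // !half_dihedral_sin // -expr2 sqr_sqrtr // ltW.
Qed.

Lemma half_dihedral_addition (Q q p : R) : 0 < Q -> 0 < q + p ->
  0 < half_dihedral Q q + half_dihedral Q p < pi.
Proof.
move=> Q0 qp; have sQ : 0 < Num.sqrt Q by rewrite sqrtr_gt0.
apply/andP; split.
  rewrite -ltrBlDr sub0r -atanN; apply: lt_atan.
  by rewrite -subr_gt0 opprK -mulrDl divr_gt0.
have := atan_ltpi2 (q / Num.sqrt Q); have := atan_ltpi2 (p / Num.sqrt Q).
by rewrite /half_dihedral; lra.
Qed.

(* The three edges issued from the vertex of radius [r1]. *)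
Lemma apex_volume (r1 r2 r3 r4 : R) (a b c : V) :
  0 < r1 -> 0 < r2 -> 0 < r3 -> 0 < r4 ->
  dot3 a a = (r1 + r2) ^+ 2 -> dot3 b b = (r1 + r3) ^+ 2 ->
  dot3 c c = (r1 + r4) ^+ 2 ->
  dot3 a b = r1 ^+ 2 + r1 * r2 + r1 * r3 - r2 * r3 ->
  dot3 a c = r1 ^+ 2 + r1 * r2 + r1 * r4 - r2 * r4 ->
  dot3 b c = r1 ^+ 2 + r1 * r3 + r1 * r4 - r3 * r4 ->
  let S := r1^-1 + r2^-1 + r3^-1 + r4^-1 in
  let Q := S ^+ 2 - 2 * (r1^-1 ^+ 2 + r2^-1 ^+ 2 + r3^-1 ^+ 2 + r4^-1 ^+ 2) in
  let phi r := half_dihedral Q (S - 2 * r^-1) in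
  let d := det3 a b c in
  d ^+ 2 = 4 * (r1 * r2 * r3 * r4) ^+ 2 * Q /\
  (d != 0 -> vol (cell [:: scale3 d (cross3 b c); scale3 d (cross3 c a);
    scale3 d (cross3 a b)]) =
    half_ball R / (2 * pi) * (2 * (phi r2 + phi r3 + phi r4) - pi)).
Proof.
move=> r1_gt0 r2_gt0 r3_gt0 r4_gt0 aa bb cc ab ac bc S Q phi d.
(* Gram's determinant: nondegeneracy of the tetrahedron and positivity of Q are thus the same
   condition. *)
have dE : d ^+ 2 = 4 * (r1 * r2 * r3 * r4) ^+ 2 * Q.
  rewrite /d det3_sqr aa bb cc ab ac bc /Q /S; field.
  by rewrite !gt_eqF.
split=> // d0.
have d2_gt0 : 0 < d ^+ 2 by rewrite lt_neqAle sqr_ge0 eq_sym sqrf_eq0 d0.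
have Q_gt0 : 0 < Q.
  have := d2_gt0; rewrite dE pmulr_rgt0 // mulr_gt0 // exprn_gt0 // !mulr_gt0 //.
pose q r := S - 2 * r^-1.
have n1n1 : dot3 (cross3 b c) (cross3 b c) = (r1 * r3 * r4) ^+ 2 * (Q + q r2 ^+ 2).
  by rewrite dot3_cross (dot3C c b) bb cc bc /q /Q /S; field; rewrite !gt_eqF.
have n2n2 : dot3 (cross3 c a) (cross3 c a) = (r1 * r2 * r4) ^+ 2 * (Q + q r3 ^+ 2).
  by rewrite dot3_cross (dot3C c a) aa cc ac /q /Q /S; field; rewrite !gt_eqF.
have n3n3 : dot3 (cross3 a b) (cross3 a b) = (r1 * r2 * r3) ^+ 2 * (Q + q r4 ^+ 2).
  by rewrite dot3_cross (dot3C b a) aa bb ab /q /Q /S; field; rewrite !gt_eqF.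
have n1n2 : dot3 (cross3 b c) (cross3 c a) =
    - ((r1 * r3 * r4) * (r1 * r2 * r4) * (Q - q r2 * q r3)).
  rewrite dot3_cross (dot3C b a) (dot3C c a) cc bc ac ab /q /Q /S; field.
  by rewrite !gt_eqF.
have n1n3 : dot3 (cross3 b c) (cross3 a b) =
    - ((r1 * r3 * r4) * (r1 * r2 * r3) * (Q - q r2 * q r4)).
  rewrite dot3_cross (dot3C b a) (dot3C c a) (dot3C c b) bb bc ac ab /q /Q /S; field.
  by rewrite !gt_eqF.
have n2n3 : dot3 (cross3 c a) (cross3 a b) =
    - ((r1 * r2 * r4) * (r1 * r2 * r3) * (Q - q r3 * q r4)).
  rewrite dot3_cross (dot3C c a) (dot3C c b) aa bc ac ab /q /Q /S; field.
  by rewrite !gt_eqF.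
have Qq x : 0 < Q + q x ^+ 2 by rewrite ltr_pwDl // sqr_ge0.
have nn k x : 0 < k -> d * d * (k ^+ 2 * (Q + q x ^+ 2)) > 0.
  by move=> k0; rewrite -expr2 mulr_gt0 // mulr_gt0 // exprn_gt0.
have sqrtE k x : 0 < k -> Num.sqrt (d * d * (k ^+ 2 * (Q + q x ^+ 2))) =
    `|d| * k * Num.sqrt (Q + q x ^+ 2).
  move=> k0; rewrite mulrA -expr2 -exprMn sqrtrM ?sqr_ge0 // sqrtr_sqr normrM.
  by rewrite (gtr0_norm k0).
have cE k l x y : 0 < k -> 0 < l -> d * d * - (k * l * (Q - q x * q y)) =
   - (`|d| * k * Num.sqrt (Q + q x ^+ 2) * (`|d| * l * Num.sqrt (Q + q y ^+ 2)) *
      cos (phi x + phi y)).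
  move=> k0 l0; rewrite -(half_dihedral_cosD _ _ Q_gt0).
  have -> : d * d = `|d| * `|d| by rewrite -normrM ger0_norm // -expr2 sqr_ge0.
  by rewrite /phi -/(q x) -/(q y); ring.
have k1 : 0 < r1 * r3 * r4 by rewrite !mulr_gt0.
have k2 : 0 < r1 * r2 * r4 by rewrite !mulr_gt0.
have k3 : 0 < r1 * r2 * r3 by rewrite !mulr_gt0.
(* The factor d makes the normals point inwards for either orientation of a, b, c. The faces
   opposite the vertices 2 and 3 meet along the edge from 1 to 4, at the dihedral angle phi r2 + phi
   r3; likewise for the other pairs. *)
rewrite (@girard _ _ _ _ (phi r2 + phi r3) (phi r2 + phi r4) (phi r3 + phi r4))
  ?dot3_scale ?n1n1 ?n2n2 ?n3n3 ?n1n2 ?n1n3 ?n2n3 ?nn ?sqrtE ?cE //.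
- by congr (_ * (_ - _)); ring.
- apply: half_dihedral_addition => //.
  have -> : S - 2 * r2^-1 + (S - 2 * r3^-1) = 2 * (r1^-1 + r4^-1) by rewrite /S; ring.
  by rewrite mulr_gt0 // addr_gt0 // invr_gt0.
- apply: half_dihedral_addition => //.
  have -> : S - 2 * r2^-1 + (S - 2 * r4^-1) = 2 * (r1^-1 + r3^-1) by rewrite /S; ring.
  by rewrite mulr_gt0 // addr_gt0 // invr_gt0.
- apply: half_dihedral_addition => //.
  have -> : S - 2 * r3^-1 + (S - 2 * r4^-1) = 2 * (r1^-1 + r2^-1) by rewrite /S; ring.
  by rewrite mulr_gt0 // addr_gt0 // invr_gt0.
Qed.

End apex.

(** * From tangent cones to cells *)

Section closed_cells.
Variable R : realType.
Local Notation leb := (@lebesgue_measure R).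
Local Notation T1 := (measurableTypeR R).
Local Notation V := (T1 * T1 * T1)%type.

(** A tangent cone allows zero coefficients and is therefore closed, whereas cells are open cones;
    the difference lies in finitely many planes. *)
Definition closed_cell (s : seq V) : set V :=
  [set x | (forall n, n \in s -> 0 <= dot3 n x) /\ dot3 x x <= 1].

Lemma measurable_closed_cell s : measurable (closed_cell s).
Proof.
elim: s => [|n s ih].
  have := @measurable_ball3 R; congr measurable.
  by apply/seteqP; split => x /= => [?|[]].
have mn : measurable [set x : V | 0 <= dot3 n x].
  have := preimage_measurable (measurable_dot3 n) (measurable_itv `[0, +oo[).
  by congr measurable; apply/seteqP; split => x /=; rewrite in_itv /= andbT.
have -> : closed_cell (n :: s) = [set x | 0 <= dot3 n x] `&` closed_cell s.
  apply/seteqP; split => x /=.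
    move=> [h b]; split; first by apply: h; rewrite mem_head.
    by split => // m ms; apply: h; rewrite inE ms orbT.
  by move=> [nx [h b]]; split => // m; rewrite inE => /orP[/eqP ->//|]; exact: h.
exact: measurableI.
Qed.

Lemma vol_closed_cell s : (forall n, n \in s -> dot3 n n != 0) ->
  vol (closed_cell s) = vol (cell s).
Proof.
move=> s0.
have null (u : seq V) : (forall n, n \in u -> dot3 n n != 0) ->
    exists2 P : set V, measurable P & ((leb \x leb) \x leb)%E P = 0%E /\
    forall x, (exists2 n, n \in u & dot3 n x = 0) -> P x.
  elim: u => [|n u ih] u0.
    by exists set0 => //; split; [exact: measure0|move=> x []].
  have [|P mP [P0 hP]] := ih; first by move=> m mu; apply: u0; rewrite inE mu orbT.
  have mn : measurable [set x : V | dot3 n x = 0].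
    have := preimage_measurable (measurable_dot3 n) (measurable_set1 (0 : T1)).
    by congr measurable; apply/seteqP; split.
  exists ([set x | dot3 n x = 0] `|` P); first exact: measurableU.
  split; last first.
    move=> x [m]; rewrite inE => /orP[/eqP ->|mu mx]; first by left.
    by right; apply: hP; exists m.
  apply/eqP; rewrite eq_le measure_ge0 andbT.
  apply: le_trans (measureU2 _ _ _) _ => //.
  have n0 : dot3 n n != 0 by apply: u0; rewrite mem_head.
  by rewrite [X in (_ + X)%E]P0 adde0 [X in (X <= _)%E](leb3_plane n0).
have [P mP [P0 hP]] := null s s0.
rewrite vol.unlock; congr fine; apply/eqP; rewrite eq_le; apply/andP; split; last first.
  apply: le_measure; rewrite ?inE; [exact: measurable_cell|exact: measurable_closed_cell|].
  by move=> x [h b]; split => // n ns; exact/ltW/h.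
rewrite -[leRHS]adde0 -P0.
apply: le_trans (measureU2 _ _ _) => //; last exact: measurable_cell.
apply: le_measure; rewrite ?inE; [exact: measurable_closed_cell| |].
  by apply: measurableU => //; exact: measurable_cell.
move=> x [h b]; have [?|/negP nP] := boolP (x \in P); first by right; rewrite -inE.
left; split => // n ns; rewrite lt_neqAle h // andbT; apply/negP => /eqP e.
by apply: nP; rewrite inE; apply: hP; exists n.
Qed.

End closed_cells.

Section placements.
Variable R : realType.
Local Notation T1 := (measurableTypeR R).
Local Notation V := (T1 * T1 * T1)%type.

(** Cramer's rule, with coefficients written through the oriented normals: q has nonnegative
    coefficients on a, b, c exactly when its products with these normals are nonnegative. *)
Lemma cramer3 (a b c q : V) : det3 a b c != 0 ->
  let d := det3 a b c in
  q = add3 (add3 (scale3 (dot3 (scale3 d (cross3 b c)) q / d ^+ 2) a)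
      (scale3 (dot3 (scale3 d (cross3 c a)) q / d ^+ 2) b))
      (scale3 (dot3 (scale3 d (cross3 a b)) q / d ^+ 2) c).
Proof.
move: a b c q => [[a1 a2] a3] [[b1 b2] b3] [[c1 c2] c3] [[q1 q2] q3].
rewrite /det3 /dot3 /cross3 /scale3 /add3 /= => d0.
by congr ((_, _), _); field.
Qed.

Definition coords (v : 'rV[R]_3) : V := ((v 0 0, v 0 1), v 0 2%:R).

Lemma coords_vec3 (q : V) : coords (vec3 q.1.1 q.1.2 q.2) = q.
Proof. by rewrite /coords /vec3 !mxE /=; case: q => -[]. Qed.

Lemma coords_inj : injective coords.
Proof.
move=> u v [] e0 e1 e2; apply/rowP => -[[|[|[|//]]] i].
- by move: e0; congr (_ = _); congr (_ _ _); apply/val_inj.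
- by move: e1; congr (_ = _); congr (_ _ _); apply/val_inj.
- by move: e2; congr (_ = _); congr (_ _ _); apply/val_inj.
Qed.

Lemma coordsD u v : coords (u + v) = add3 (coords u) (coords v).
Proof. by rewrite /coords /add3 !mxE. Qed.

Lemma coordsZ k u : coords (k *: u) = scale3 k (coords u).
Proof. by rewrite /coords /scale3 !mxE. Qed.

Lemma dot3_coords u : dot3 (coords u) (coords u) = enorm u ^+ 2.
Proof.
rewrite /enorm sqr_sqrtr ?sumr_ge0 // => [|i _]; last exact: sqr_ge0.
rewrite !big_ord_recl big_ord0 /dot3 /coords /= !expr2 addr0 addrA.
by congr (_ * _ + _ * _ + _ * _); congr (u _ _); apply/val_inj.
Qed.

Lemma enorm_ge0 n (u : 'rV[R]_n) : 0 <= enorm u.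
Proof. exact: sqrtr_ge0. Qed.

Lemma solid_angle_cone_span (a b c : 'rV[R]_3) :
  let d := det3 (coords a) (coords b) (coords c) in
  d != 0 ->
  (forall n, n \in [:: cross3 (coords b) (coords c); cross3 (coords c) (coords a);
    cross3 (coords a) (coords b)] -> dot3 n n != 0) ->
  solid_angle_cone [set x | exists k1 k2 k3, [/\ 0 <= k1, 0 <= k2, 0 <= k3 &
    x = k1 *: a + k2 *: b + k3 *: c]] =
  3 * vol (cell [:: scale3 d (cross3 (coords b) (coords c));
    scale3 d (cross3 (coords c) (coords a));
    scale3 d (cross3 (coords a) (coords b))]).
Proof.
move=> d d0 n0; rewrite -vol_closed_cell; last first.
  move=> m; rewrite -(map_id [:: _ ; _; _]) /= !inE => mE.
  have {mE}[n ns ->] : exists2 n, n \in [:: cross3 (coords b) (coords c); cross3 (coords c) (coords a);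
    cross3 (coords a) (coords b)] & m = scale3 d n.
    by case/or3P: mE => /eqP ->; eexists; try reflexivity; rewrite !inE eqxx ?orbT.
  by rewrite dot3_scale !mulf_neq0 // n0.
set C : set 'rV[R]_3 := (X in solid_angle_cone X); set s := (X in closed_cell X).
suff CE : [set q : R * R * R | [set x | C x /\ enorm x <= 1]
    (vec3 q.1.1 q.1.2 q.2)] = closed_cell s.
  by rewrite /solid_angle_cone /volume3 CE vol.unlock.
apply/seteqP; split => q /=.
  move=> [[k1 [k2 [k3 [k1_ge0 k2_ge0 k3_ge0 /(congr1 coords)]]]]].
  rewrite coords_vec3 !coordsD !coordsZ => qE.
  rewrite -(@expr_le1 _ 2%N) ?enorm_ge0 // -dot3_coords coords_vec3 => q1.
  split=> // n; rewrite !inE => /or3P[] /eqP ->.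
  - have -> : dot3 (scale3 d (cross3 (coords b) (coords c))) q = k1 * d ^+ 2.
      by rewrite qE /d /det3 /dot3 /cross3 /scale3 /add3 /=; ring.
    by rewrite mulr_ge0 // sqr_ge0.
  - have -> : dot3 (scale3 d (cross3 (coords c) (coords a))) q = k2 * d ^+ 2.
      by rewrite qE /d /det3 /dot3 /cross3 /scale3 /add3 /=; ring.
    by rewrite mulr_ge0 // sqr_ge0.
  - have -> : dot3 (scale3 d (cross3 (coords a) (coords b))) q = k3 * d ^+ 2.
      by rewrite qE /d /det3 /dot3 /cross3 /scale3 /add3 /=; ring.
    by rewrite mulr_ge0 // sqr_ge0.
move=> [h q1]; split; last first.
  by rewrite -(@expr_le1 _ 2%N) ?enorm_ge0 // -dot3_coords coords_vec3.
exists (dot3 (scale3 d (cross3 (coords b) (coords c))) q / d ^+ 2),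
  (dot3 (scale3 d (cross3 (coords c) (coords a))) q / d ^+ 2),
  (dot3 (scale3 d (cross3 (coords a) (coords b))) q / d ^+ 2).
split; rewrite ?divr_ge0 ?sqr_ge0 ?h ?inE ?eqxx ?orbT //.
apply: coords_inj; rewrite coords_vec3 !coordsD !coordsZ.
exact: cramer3.
Qed.

End placements.

(** Translates sums over a set of four vertices into the explicit four-term expressions of the
    identities above, for scalar and for vector summands. *)
Lemma tetra_enum (T : finType) (t : {set T}) (i : T) :
  i \in t -> #|t| = 4%N ->
  exists j k l, [/\ uniq [:: i; j; k; l], t =i [:: i; j; k; l],
    (forall (V : zmodType) (F : T -> V), \sum_(m in t) F m = F i + F j + F k + F l) &
    (forall (V : zmodType) (F : T -> V),
      \sum_(m in t | m != i) F m = F j + F k + F l)].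
Proof.
move=> it t4.
have : size (enum (t :\ i)) = 3%N.
  by rewrite -cardE; have := cardsD1 i t; rewrite it t4 => -[].
case E : (enum (t :\ i)) => [|j [|k [|l [|]]]] // _.
have mE m : (m \in t :\ i) = (m \in [:: j; k; l]) by rewrite -E mem_enum.
have u3 : uniq [:: j; k; l] by rewrite -E enum_uniq.
have tE : t =i [:: i; j; k; l].
  by move=> m; rewrite -(finset.setD1K it) in_setU1 mE inE.
have sum3 (V : zmodType) (F : T -> V) : \sum_(m in t | m != i) F m = F j + F k + F l.
  rewrite (eq_bigl (fun m => m \in t :\ i)) => [|m]; last by rewrite !inE andbC.
  by rewrite -big_enum /= E !big_cons big_nil addr0 addrA.
exists j, k, l; split => //.
  by rewrite cons_uniq u3 andbT -mE !inE eqxx.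
by move=> V F; rewrite (bigD1 i) //= sum3 !addrA.
Qed.

Lemma uniq4E (T : eqType) (i j k l : T) : uniq [:: i; j; k; l] =
  [&& i != j, i != k, i != l, j != k, j != l & k != l].
Proof. by rewrite /= !inE !negb_or andbT -!andbA. Qed.

Section solid_angles.
Variables (R : realType) (N : nat).
Local Notation T1 := (measurableTypeR R).
Local Notation V := (T1 * T1 * T1)%type.
Implicit Types (r : 'rV[R]_N) (t : {set 'I_N}) (p : 'I_N -> 'rV[R]_3).

Definition bend_sum r t : R := \sum_(m in t) (r 0 m)^-1.

(* Q_{ijkl} of the paper. *)
Definition soddy r t : R :=
  bend_sum r t ^+ 2 - 2 * \sum_(m in t) (r 0 m)^-1 ^+ 2.

Definition face_angle r t (m : 'I_N) : R :=
  half_dihedral (soddy r t) (bend_sum r t - 2 * (r 0 m)^-1).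

(* This is 1, but only its positivity matters. *)
Definition angle_unit : R := 3 * half_ball R / (2 * pi).

Lemma angle_unit_gt0 : 0 < angle_unit.
Proof. by rewrite /angle_unit divr_gt0 // mulr_gt0 // ?half_ball_gt0 // pi_gt0. Qed.

Lemma dot3_polar (u v : 'rV[R]_3) : dot3 (coords u) (coords v) =
  (enorm u ^+ 2 + enorm v ^+ 2 - enorm (u - v) ^+ 2) / 2.
Proof. by rewrite -!dot3_coords /dot3 /coords /= !mxE; field. Qed.

Lemma enormC (u v : 'rV[R]_3) : enorm (u - v) = enorm (v - u).
Proof. by rewrite /enorm; congr Num.sqrt; apply: eq_bigr => i _; rewrite !mxE; ring. Qed.

(** The law of cosines in the face i, j, k, with edge lengths r_i + r_j. *)
Lemma placement_gram r t p i j k : euclidean_placement r t p ->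
  i \in t -> j \in t -> k \in t -> i != j -> i != k ->
  let a := coords (p j - p i) in let b := coords (p k - p i) in
  dot3 a a = (r 0 i + r 0 j) ^+ 2 /\ (j != k ->
  dot3 a b = r 0 i ^+ 2 + r 0 i * r 0 j + r 0 i * r 0 k - r 0 j * r 0 k).
Proof.
move=> [_ pE] it jt kt ij ik a b; split.
  by rewrite /a dot3_coords enormC pE.
move=> jk; rewrite /a /b dot3_polar.
have -> : p j - p i - (p k - p i) = p j - p k by rewrite opprB addrA subrK.
by rewrite (enormC (p j)) (enormC (p k)) !pE //; field.
Qed.

Lemma det3_neq0_of_span (a b c : 'rV[R]_3) : dot3 (coords c) (coords c) != 0 ->
  (forall k1 k2 k3, k1 *: a + k2 *: b + k3 *: c = 0 ->
     [/\ k1 = 0, k2 = 0 & k3 = 0]) ->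
  det3 (coords a) (coords b) (coords c) != 0.
Proof.
move=> c0 free; apply/negP => /eqP d0.
set A := coords a in d0; set B := coords b in d0; set C := coords c in d0 c0.
pose n := cross3 B C.
(* With n = b x c, the combination of a, b, c with these coefficients equals det n, hence 0. So n =
   0, and then c x n = (c.c) b - (b.c) c is a second vanishing combination, which forces c.c = 0. *)
have [k1 _ _] : [/\ dot3 n n = 0, dot3 n (cross3 C A) = 0 & dot3 n (cross3 A B) = 0].
  apply: free; apply: coords_inj; rewrite !coordsD !coordsZ -/A -/B -/C.
  have -> : coords 0 = ((0, 0), 0) :> V by rewrite /coords !mxE.
  transitivity (scale3 (det3 A B C) n); last by rewrite d0 /scale3 !mul0r.
  rewrite /n; move: A B C {d0 c0 n} => [[a1 a2] a3] [[b1 b2] b3] [[c1 c2] c3].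
  by rewrite /det3 /dot3 /cross3 /scale3 /add3 /=; congr ((_, _), _); ring.
have n0 : n = ((0, 0), 0).
  move: k1; rewrite /dot3; case: n => -[x y] z /= /eqP.
  rewrite -!expr2 !paddr_eq0 ?addr_ge0 ?sqr_ge0 // !sqrf_eq0.
  by move=> /andP[/andP[/eqP -> /eqP ->] /eqP ->].
have [_ h _] : [/\ 0 = 0 :> R, dot3 C C = 0 & - dot3 B C = 0].
  apply: free; apply: coords_inj; rewrite !coordsD !coordsZ -/A -/B -/C.
  have -> : coords 0 = ((0, 0), 0) :> V by rewrite /coords !mxE.
  transitivity (cross3 C n); last by rewrite n0 /cross3 /= !mulr0 !subrr.
  rewrite /n; move: A B C {d0 c0 n n0 k1} => [[a1 a2] a3] [[b1 b2] b3] [[c1 c2] c3].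
  by rewrite /det3 /dot3 /cross3 /scale3 /add3 /=; congr ((_, _), _); ring.
by move: c0; rewrite h eqxx.
Qed.

Lemma tangent_cone_span t p i j k l : uniq [:: i; j; k; l] ->
  (forall (W : zmodType) (F : 'I_N -> W),
      \sum_(m in t | m != i) F m = F j + F k + F l) ->
  tangent_cone t p i = [set x | exists k1 k2 k3, [/\ 0 <= k1, 0 <= k2, 0 <= k3 &
    x = k1 *: (p j - p i) + k2 *: (p k - p i) + k3 *: (p l - p i)]].
Proof.
rewrite uniq4E => /and5P[_ _ _ jk /andP[jl kl]] sum3; apply/seteqP; split => x /=.
  by move=> [c [c0 ->]]; rewrite sum3; exists (c j), (c k), (c l).
move=> [k1 [k2 [k3 [k1_ge0 k2_ge0 k3_ge0 ->]]]].
exists (fun m => if m == j then k1 else if m == k then k2 else k3); split.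
  by move=> m; case: (m == j) => //; case: (m == k).
rewrite sum3 eqxx.
by rewrite (eq_sym k) (negbTE jk) eqxx !(eq_sym l) (negbTE jl) (negbTE kl).
Qed.

Lemma placement_solid_angle r t p i : (forall m, 0 < r 0 m) -> #|t| = 4%N ->
  i \in t -> euclidean_placement r t p ->
  0 < soddy r t /\ solid_angle_cone (tangent_cone t p i) =
    angle_unit * (2 * \sum_(m in t | m != i) face_angle r t m - pi).
Proof.
move=> r0 t4 it plc; have [j [k [l [u tE sum4 sum3]]]] := tetra_enum it t4.
have [jt kt lt] : [/\ j \in t, k \in t & l \in t] by rewrite !tE !inE !eqxx !orbT.
have := u; rewrite uniq4E => /and5P[ij ik il jk /andP[jl kl]].
have [aa ab] := placement_gram plc it jt kt ij ik; have {}ab := ab jk.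
have [bb bc] := placement_gram plc it kt lt ik il; have {}bc := bc kl.
have [cc _] := placement_gram plc it lt jt il ij.
have [_ ac] := placement_gram plc it jt lt ij il; have {}ac := ac jl.
have := apex_volume (r0 i) (r0 j) (r0 k) (r0 l) aa bb cc ab ac bc.
pose S := (r 0 i)^-1 + (r 0 j)^-1 + (r 0 k)^-1 + (r 0 l)^-1.
pose Q := S ^+ 2 - 2 * ((r 0 i)^-1 ^+ 2 + (r 0 j)^-1 ^+ 2 + (r 0 k)^-1 ^+ 2
  + (r 0 l)^-1 ^+ 2).
rewrite /= -/S -/Q.
have SE : bend_sum r t = S by rewrite /bend_sum sum4.
have QE : soddy r t = Q by rewrite /soddy SE sum4.
have cone := tangent_cone_span p u sum3.
set A := coords (p j - p i) in aa ab ac *.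
set B := coords (p k - p i) in ab bb bc *.
set C := coords (p l - p i) in ac bc cc *.
move=> [dE volE].
have d0 : det3 A B C != 0.
  apply: det3_neq0_of_span.
    by rewrite cc expf_neq0 // gt_eqF // addr_gt0.
  move=> k1 k2 k3 h; have [aff _] := plc.
  (* A linear relation between the edges at i becomes an affine relation between the vertices: i
     receives minus the sum of the coefficients. *)
  pose c m := if m == j then k1 else if m == k then k2 else if m == l then k3
    else - (k1 + k2 + k3).
  have ci : c i = - (k1 + k2 + k3).
    by rewrite /c (negbTE ij) (negbTE ik) (negbTE il).
  have cj : c j = k1 by rewrite /c eqxx.
  have ck : c k = k2 by rewrite /c eq_sym (negbTE jk) eqxx.
  have cl : c l = k3.
    by rewrite /c eq_sym (negbTE jl) eq_sym (negbTE kl) eqxx.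
  have c0 m : m \in t -> c m = 0.
    apply: aff; rewrite sum4 ci cj ck cl; first by ring.
    by rewrite -[RHS]h scaleNr !scalerDl !scalerBr !opprD; apply/rowP => m'; rewrite !mxE; ring.
  by rewrite -cj -ck -cl !c0.
have Q0 : 0 < Q.
  have : 0 < det3 A B C ^+ 2 by rewrite lt_neqAle sqr_ge0 eq_sym sqrf_eq0 d0.
  rewrite dE pmulr_rgt0 // mulr_gt0 // exprn_gt0 // !mulr_gt0 //.
split; first by rewrite QE.
rewrite cone solid_angle_cone_span // -/A -/B -/C.
  rewrite volE // sum3 /face_angle QE SE /angle_unit.
  by rewrite !mulrA.
(* Heron's formula: the sides x + y, x + z, y + z have half-perimeter x + y + z, and the squared
   norm of the cross product is 4 x y z (x + y + z). *)
have gramB (a b : V) (x y z : R) : 0 < x -> 0 < y -> 0 < z ->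
    dot3 a a = (x + y) ^+ 2 -> dot3 b b = (x + z) ^+ 2 ->
    dot3 a b = x ^+ 2 + x * y + x * z - y * z ->
    dot3 (cross3 a b) (cross3 a b) != 0.
  move=> x0 y0 z0 h1 h2 h3; rewrite dot3_cross (dot3C b a) h1 h2 h3.
  have -> : (x + y) ^+ 2 * (x + z) ^+ 2 - (x ^+ 2 + x * y + x * z - y * z) * (x ^+ 2 + x * y + x * z - y * z)
   = 4 * (x * y * z) * (x + y + z) by ring.
  by rewrite gt_eqF // !mulr_gt0 // !addr_gt0.
move=> n; rewrite !inE => /or3P[] /eqP ->.
- exact: (gramB _ _ _ _ _ (r0 i) (r0 k) (r0 l)).
- apply: (gramB _ _ _ _ _ (r0 i) (r0 l) (r0 j)) => //.
  by rewrite dot3C ac; ring.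
- exact: (gramB _ _ _ _ _ (r0 i) (r0 j) (r0 k)).
Qed.

(** The formula was proved for every placement, hence holds for the one chosen by [xget]. *)
Lemma solid_angleE r t i : (forall m, 0 < r 0 m) -> #|t| = 4%N -> i \in t ->
  (exists p, euclidean_placement r t p) ->
  solid_angle r t i =
    angle_unit * (2 * \sum_(m in t | m != i) face_angle r t m - pi).
Proof.
move=> r0 t4 it ex; rewrite /solid_angle.
by have [_ ->] := placement_solid_angle r0 t4 it (xgetPex (fun=> 0) ex).
Qed.

End solid_angles.

(** * Construction of a tetrahedron from its radii *)

Section exist_placement.
Variables (R : realType) (N : nat).
Local Notation T1 := (measurableTypeR R).
Local Notation V := (T1 * T1 * T1)%type.
Implicit Types (r : 'rV[R]_N) (t : {set 'I_N}).

(** Cholesky factorisation: the hypotheses say that the leading minors of the Gram matrix are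
    positive, and x, y, z are the diagonal entries of the triangular factor. *)
Lemma exists_gram (aa bb cc ab ac bc : R) : 0 < aa -> 0 < aa * bb - ab ^+ 2 ->
  0 < aa * (bb * cc - bc ^+ 2) - ab * (ab * cc - bc * ac)
    + ac * (ab * bc - bb * ac) ->
  exists a b c : V, [/\ dot3 a a = aa, dot3 b b = bb, dot3 c c = cc &
    [/\ dot3 a b = ab, dot3 a c = ac & dot3 b c = bc]].
Proof.
move=> aa0 m0 D0.
pose x := Num.sqrt aa; pose y := Num.sqrt ((aa * bb - ab ^+ 2) / aa).
pose z := Num.sqrt ((aa * (bb * cc - bc ^+ 2) - ab * (ab * cc - bc * ac)
    + ac * (ab * bc - bb * ac)) / (aa * bb - ab ^+ 2)).
have x2 : x ^+ 2 = aa by rewrite sqr_sqrtr // ltW.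
have y2 : y ^+ 2 = (aa * bb - ab ^+ 2) / aa by rewrite sqr_sqrtr // divr_ge0 // ltW.
have z2 : z ^+ 2 = (aa * (bb * cc - bc ^+ 2) - ab * (ab * cc - bc * ac)
    + ac * (ab * bc - bb * ac)) / (aa * bb - ab ^+ 2).
  by rewrite sqr_sqrtr // divr_ge0 // ltW.
have x0 : x != 0 by rewrite gt_eqF // sqrtr_gt0.
have y0 : y != 0 by rewrite gt_eqF // sqrtr_gt0 divr_gt0.
exists ((x, 0), 0), ((ab / x, y), 0), ((ac / x, (bc - ab * ac / aa) / y), z).
rewrite /dot3 /=; split; last split.
- by rewrite -[RHS]x2; ring.
- have -> : ab / x * (ab / x) + y * y + 0 * 0 = ab ^+ 2 / x ^+ 2 + y ^+ 2 by field.
  by rewrite x2 y2; field; rewrite gt_eqF.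
- have -> : ac / x * (ac / x) + (bc - ab * ac / aa) / y * ((bc - ab * ac / aa) / y) + z * z
    = ac ^+ 2 / x ^+ 2 + (bc - ab * ac / aa) ^+ 2 / y ^+ 2 + z ^+ 2.
    by field; rewrite x0 y0 gt_eqF.
  by rewrite x2 y2 z2; field; rewrite !gt_eqF.
- by rewrite !mul0r !addr0 mulrC divfK.
- by rewrite !mul0r !addr0 mulrC divfK.
- have -> : ab / x * (ac / x) + y * ((bc - ab * ac / aa) / y) + 0 * z =
    ab * ac / x ^+ 2 + bc - ab * ac / aa.
    by field; rewrite x0 y0 gt_eqF.
  by rewrite x2; ring.
Qed.

(** Converse of the positivity in [placement_solid_angle]: the existence of a placement becomes the
    explicit open condition Q > 0. The second minor is Heron's expression, and the determinant is a
    positive multiple of Q. *)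
Lemma exists_placement r t : (forall m, 0 < r 0 m) -> #|t| = 4%N ->
  0 < soddy r t -> exists p, euclidean_placement r t p.
Proof.
move=> r0 t4 Q0.
have [i it] : exists i, i \in t by apply/set0Pn; rewrite -card_gt0 t4.
have [j [k [l [u tE sum4 sum3]]]] := tetra_enum it t4.
have := u; rewrite uniq4E => /and5P[ij ik il jk /andP[jl kl]].
have := Q0; rewrite /soddy /bend_sum !sum4.
have := r0 i; have := r0 j; have := r0 k; have := r0 l.
set ri := r 0 i; set rj := r 0 j; set rk := r 0 k; set rl := r 0 l.
move=> rl0 rk0 rj0 ri0 Qpos.
pose g x y := ri ^+ 2 + ri * x + ri * y - x * y.
have [a [b [c [aa bb cc [ab ac bc]]]]] : exists a b c : V,
  [/\ dot3 a a = (ri + rj) ^+ 2, dot3 b b = (ri + rk) ^+ 2,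
    dot3 c c = (ri + rl) ^+ 2 &
    [/\ dot3 a b = g rj rk, dot3 a c = g rj rl & dot3 b c = g rk rl]].
  apply: exists_gram.
  - by rewrite exprn_gt0 // addr_gt0.
  - have -> : (ri + rj) ^+ 2 * (ri + rk) ^+ 2 - g rj rk ^+ 2 =
      4 * (ri * rj * rk) * (ri + rj + rk) by rewrite /g; ring.
    by rewrite !mulr_gt0 // !addr_gt0.
  set D := (X in 0 < X).
  have -> : D = 4 * (ri * rj * rk * rl) ^+ 2 *
      ((ri^-1 + rj^-1 + rk^-1 + rl^-1) ^+ 2
      - 2 * (ri^-1 ^+ 2 + rj^-1 ^+ 2 + rk^-1 ^+ 2 + rl^-1 ^+ 2)).
    by rewrite /D /g; field; rewrite !gt_eqF.
  by rewrite mulr_gt0 // mulr_gt0 // exprn_gt0 // !mulr_gt0.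
have d0 : det3 a b c != 0.
  have [dE _] := apex_volume ri0 rj0 rk0 rl0 aa bb cc ab ac bc.
  by rewrite -sqrf_eq0 dE gt_eqF // mulr_gt0 // mulr_gt0 // exprn_gt0 // !mulr_gt0.
pose v (q : V) := vec3 q.1.1 q.1.2 q.2.
pose p m := if m == j then v a else if m == k then v b else if m == l then v c else 0.
have pi0 : p i = 0 by rewrite /p (negbTE ij) (negbTE ik) (negbTE il).
have pj : p j = v a by rewrite /p eqxx.
have pk : p k = v b by rewrite /p (eq_sym k) (negbTE jk) eqxx.
have pl : p l = v c by rewrite /p !(eq_sym l) (negbTE jl) (negbTE kl) eqxx.
have en (u0 u1 : 'rV[R]_3) (s : R) : 0 <= s -> dot3 (coords (u0 - u1)) (coords (u0 - u1)) = s ^+ 2 -> enorm (u0 - u1) = s.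
  move=> s0; rewrite dot3_coords => /eqP; rewrite eqrXn2 ?enorm_ge0 // => /eqP //.
have dv (q s : V) : dot3 (coords (v q - v s)) (coords (v q - v s)) =
    dot3 q q + dot3 s s - 2 * dot3 q s.
  rewrite /coords /dot3 /= !mxE /=; ring.
have dv0 (q : V) : dot3 (coords (v q - 0)) (coords (v q - 0)) = dot3 q q.
  by rewrite /coords /dot3 /= !mxE /=; ring.
exists p; split.
  move=> f; rewrite !sum4 pi0 pj pk pl scaler0 add0r => f0 /(congr1 (@coords R)).
  rewrite !coordsD !coordsZ !coords_vec3 => h.
  have h0 : coords 0 = ((0, 0), 0) :> V by rewrite /coords !mxE.
  have fj : f j = 0.
    have : dot3 (cross3 b c) (add3 (add3 (scale3 (f j) a) (scale3 (f k) b)) (scale3 (f l) c)) = f j * det3 a b c.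
      by rewrite /det3 /dot3 /cross3 /scale3 /add3 /=; ring.
    rewrite h h0 /dot3 /= !mulr0 !addr0 => /esym/eqP.
    by rewrite mulf_eq0 (negbTE d0) orbF => /eqP.
  have fk : f k = 0.
    have : dot3 (cross3 c a) (add3 (add3 (scale3 (f j) a) (scale3 (f k) b)) (scale3 (f l) c)) = f k * det3 a b c.
      by rewrite /det3 /dot3 /cross3 /scale3 /add3 /=; ring.
    rewrite h h0 /dot3 /= !mulr0 !addr0 => /esym/eqP.
    by rewrite mulf_eq0 (negbTE d0) orbF => /eqP.
  have fl : f l = 0.
    have : dot3 (cross3 a b) (add3 (add3 (scale3 (f j) a) (scale3 (f k) b)) (scale3 (f l) c)) = f l * det3 a b c.
      by rewrite /det3 /dot3 /cross3 /scale3 /add3 /=; ring.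
    rewrite h h0 /dot3 /= !mulr0 !addr0 => /esym/eqP.
    by rewrite mulf_eq0 (negbTE d0) orbF => /eqP.
  have fi : f i = 0 by move: f0; rewrite fj fk fl !addr0.
  by move=> m; rewrite tE !inE => /or4P[] /eqP ->.
have s0 (x y : R) : 0 < x -> 0 < y -> 0 <= x + y by move=> *; rewrite addr_ge0 // ltW.
have eij : enorm (p j - p i) = ri + rj by rewrite pj pi0; apply: en; rewrite ?s0 ?dv0.
have eik : enorm (p k - p i) = ri + rk by rewrite pk pi0; apply: en; rewrite ?s0 ?dv0.
have eil : enorm (p l - p i) = ri + rl by rewrite pl pi0; apply: en; rewrite ?s0 ?dv0.
have ejk : enorm (p j - p k) = rj + rk.
  by rewrite pj pk; apply: en; rewrite ?s0 // dv aa bb ab /g; ring.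
have ejl : enorm (p j - p l) = rj + rl.
  by rewrite pj pl; apply: en; rewrite ?s0 // dv aa cc ac /g; ring.
have ekl : enorm (p k - p l) = rk + rl.
  by rewrite pk pl; apply: en; rewrite ?s0 // dv bb cc bc /g; ring.
move=> x y; rewrite !tE !inE.
move=> /or4P[] /eqP -> /or4P[] /eqP ->; rewrite ?eqxx // => _;
first [by rewrite ?eij ?eik ?eil ?ejk ?ejl ?ekl // addrC
      |by rewrite enormC ?eij ?eik ?eil ?ejk ?ejl ?ekl // addrC].
Qed.

End exist_placement.

(** * Strict differentiability *)

Section strict_diff.
Variables (R : realType) (V : normedModType R).
Implicit Types (f g : V -> R) (x : V) (L : V -> R).

(* Differentiability at x, uniformly in the two points compared: it implies a
   local Lipschitz bound and is stable under the algebraic operations, so no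
   derivative away from x is ever needed. *)
Definition strict_diff f x L : Prop :=
  (exists C, forall v, `|L v| <= C * `|v|) /\
  forall e, 0 < e -> \forall z \near (x, x),
    `|f z.1 - f z.2 - L (z.1 - z.2)| <= e * `|z.1 - z.2|.

Lemma strict_diff_lip f x L : strict_diff f x L ->
  exists2 C, 0 <= C & \forall z \near (x, x), `|f z.1 - f z.2| <= C * `|z.1 - z.2|.
Proof.
move=> [[C LC] fL]; exists (`|C| + 1); first by rewrite addr_ge0.
have := fL 1 ltr01; apply: filterS => z h.
have -> : f z.1 - f z.2 = (f z.1 - f z.2 - L (z.1 - z.2)) + L (z.1 - z.2) by ring.
apply: le_trans (ler_normD _ _) _; rewrite mulrDl addrC lerD //.
apply: le_trans (LC _) _; rewrite ler_wpM2r //; exact: ler_norm.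
Qed.

Lemma near_pair1 x (P : V -> Prop) : (\forall y \near x, P y) ->
  \forall z \near (x, x), P z.1 /\ P z.2.
Proof. by move=> nP; exists (P, P) => //= z []. Qed.

Lemma strict_diff_continuous f x L : strict_diff f x L -> {for x, continuous f}.
Proof.
move=> /strict_diff_lip[C C0 fC]; apply/cvgrPdist_le => e e0.
have : \forall y \near x, `|f x - f y| <= C * `|x - y|.
  have := fC => -[[A B] /= [nA nB] AB]; apply: filterS nB => y By.
  by apply: (AB (x, y)); split => //=; exact: nbhs_singleton.
have : \forall y \near x, `|x - y| <= e / (C + 1).
  have /cvgrPdist_le : id y @[y --> x] --> x by exact: cvg_id.
  by apply; rewrite divr_gt0 // ltr_wpDl.
apply: filterS2 => y xy fxy; apply: le_trans fxy _.
apply: (@le_trans _ _ ((C + 1) * (e / (C + 1)))).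
  by rewrite ler_pM // lerDl.
by rewrite mulrC divfK // gt_eqF // ltr_wpDl.
Qed.

Lemma strict_diff_ext f g x L : (\forall y \near x, f y = g y) ->
  strict_diff f x L -> strict_diff g x L.
Proof.
move=> fg [LC fL]; split => // e e0.
by apply: filterS2 (near_pair1 fg) (fL e e0) => z [-> ->].
Qed.

Lemma strict_diff_extL f x L L' : L =1 L' -> strict_diff f x L ->
  strict_diff f x L'.
Proof. by move=> /funext <-. Qed.

Lemma strict_diff_cst (c : R) x : strict_diff (fun=> c) x (fun=> 0).
Proof.
split; first by exists 0 => v; rewrite normr0 mul0r.
by move=> e e0; near=> z; rewrite !subrr normr0 mulr_ge0 // ltW.
Unshelve. all: by end_near. Qed.

Lemma strict_diffD f g x Lf Lg : strict_diff f x Lf -> strict_diff g x Lg ->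
  strict_diff (fun y => f y + g y) x (fun v => Lf v + Lg v).
Proof.
move=> [[C1 h1] f1] [[C2 h2] g2]; split.
  exists (C1 + C2) => v; rewrite mulrDl.
  by apply: le_trans (ler_normD _ _) _; rewrite lerD.
move=> e e0; have e20 : 0 < e / 2 by rewrite divr_gt0.
apply: filterS2 (f1 _ e20) (g2 _ e20) => z h k.
rewrite (splitr e) mulrDl; apply: le_trans _ (lerD h k).
by apply: le_trans _ (ler_normD _ _); rewrite le_eqVlt; apply/orP; left; apply/eqP; congr (`|_|); ring.
Qed.

Lemma strict_diffM f g x Lf Lg : strict_diff f x Lf -> strict_diff g x Lg ->
  strict_diff (fun y => f y * g y) x (fun v => f x * Lg v + g x * Lf v).
Proof.
move=> sf sg; have cf := strict_diff_continuous sf.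
have cg := strict_diff_continuous sg.
have [[C1 h1] f1] := sf; have [[C2 h2] g2] := sg; split.
  exists (`|f x| * C2 + `|g x| * C1) => v; rewrite mulrDl.
  apply: le_trans (ler_normD _ _) _; rewrite !normrM -!mulrA lerD // ler_wpM2l //.
move=> e e0.
pose M := `|f x| + `|g x| + `|C1| + `|C2| + 2.
have M0 : 0 < M by rewrite /M ltr_pwDr // !addr_ge0.
(* The remainder splits into four terms, each at most M d |v|. The bound 1 keeps the values of f and
   g near x below [M]. *)
pose d := Num.min 1 (e / (4 * M)).
have d0 : 0 < d by rewrite lt_min ltr01 divr_gt0 // mulr_gt0.
have d1 : d <= 1 by rewrite ge_min lexx.
have dM : 4 * (M * d) <= e.
  rewrite mulrA mulrC -ler_pdivlMr ?mulr_gt0 //.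
  by rewrite ge_min lexx orbT.
have nf : \forall z \near (x, x), `|f x - f z.1| <= d /\ `|f x - f z.2| <= d.
  by apply: (@near_pair1 x (fun y => `|f x - f y| <= d)); by have /cvgrPdist_le := cf; apply.
have ng : \forall z \near (x, x), `|g x - g z.1| <= d /\ `|g x - g z.2| <= d.
  by apply: (@near_pair1 x (fun y => `|g x - g y| <= d)); by have /cvgrPdist_le := cg; apply.
apply: filterS2 (filterI nf ng) (filterI (f1 _ d0) (g2 _ d0)) => z [[fz1 _] [_ gz2]] [].
set v := z.1 - z.2 => hf hg.
have -> : f z.1 * g z.1 - f z.2 * g z.2 - (f x * Lg v + g x * Lf v) =
   f z.1 * (g z.1 - g z.2 - Lg v) + g z.2 * (f z.1 - f z.2 - Lf v)
   + (f z.1 - f x) * Lg v + (g z.2 - g x) * Lf v by ring.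
have v0 : 0 <= `|v| by [].
have fz : `|f z.1| <= M.
  have -> : f z.1 = f x - (f x - f z.1) by ring.
  apply: le_trans (ler_normB _ _) _; rewrite /M.
  have := normr_ge0 (g x); have := normr_ge0 C1; have := normr_ge0 C2; lra.
have gz : `|g z.2| <= M.
  have -> : g z.2 = g x - (g x - g z.2) by ring.
  apply: le_trans (ler_normB _ _) _; rewrite /M.
  have := normr_ge0 (f x); have := normr_ge0 C1; have := normr_ge0 C2; lra.
have LgM : `|Lg v| <= M * `|v|.
  apply: le_trans (h2 _) _; rewrite ler_wpM2r // /M.
  have := ler_norm C2; have := normr_ge0 (f x); have := normr_ge0 (g x); have := normr_ge0 C1; lra.
have LfM : `|Lf v| <= M * `|v|.
  apply: le_trans (h1 _) _; rewrite ler_wpM2r // /M.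
  have := ler_norm C1; have := normr_ge0 (f x); have := normr_ge0 (g x); have := normr_ge0 C2; lra.
apply: (@le_trans _ _ (4 * (M * d) * `|v|)); last by rewrite ler_wpM2r.
have -> : 4 * (M * d) * `|v| = M * (d * `|v|) + M * (d * `|v|) + d * (M * `|v|) + d * (M * `|v|) by ring.
apply: le_trans (ler_normD _ _) (lerD _ _); last first.
  by rewrite normrM ler_pM // distrC.
apply: le_trans (ler_normD _ _) (lerD _ _); last first.
  by rewrite normrM ler_pM // distrC.
by apply: le_trans (ler_normD _ _) (lerD _ _); rewrite normrM ler_pM.
Qed.

Lemma strict_diffZ (c : R) f x L : strict_diff f x L ->
  strict_diff (fun y => c * f y) x (fun v => c * L v).
Proof.
move=> sf; have := strict_diffM (strict_diff_cst c x) sf.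
by apply: strict_diff_extL => v; rewrite mulr0 addr0.
Qed.

Lemma strict_diffB f g x Lf Lg : strict_diff f x Lf -> strict_diff g x Lg ->
  strict_diff (fun y => f y - g y) x (fun v => Lf v - Lg v).
Proof.
move=> sf sg; have := strict_diffD sf (strict_diffZ (-1) sg).
by congr strict_diff; apply/funext => v; rewrite mulN1r.
Qed.

Lemma strict_diff_sum (I : finType) (P : pred I) (f L : I -> V -> R) x :
  (forall i, P i -> strict_diff (f i) x (L i)) ->
  strict_diff (fun y => \sum_(i | P i) f i y) x (fun v => \sum_(i | P i) L i v).
Proof.
move=> h; rewrite -!fct_sumE; elim/big_rec2 : _ => [|i F G Pi FG].
  exact: strict_diff_cst.
by apply: strict_diffD => //; exact: h.
Qed.

Lemma strict_diff_comp (phi : R -> R) (l : R) f x L : strict_diff f x L ->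
  (forall e, 0 < e -> \forall w \near (f x, f x),
    `|phi w.1 - phi w.2 - l * (w.1 - w.2)| <= e * `|w.1 - w.2|) ->
  strict_diff (fun y => phi (f y)) x (fun v => l * L v).
Proof.
move=> sf sphi; have cf := strict_diff_continuous sf.
have [C C0 fC] := strict_diff_lip sf.
have [[C1 h1] f1] := sf; split.
  by exists (`|l| * C1) => v; rewrite normrM -mulrA ler_wpM2l.
move=> e e0.
pose e1 := e / (2 * (C + 1)); pose e2 := e / (2 * (`|l| + 1)).
have e1_gt0 : 0 < e1 by rewrite divr_gt0 // mulr_gt0 // ltr_wpDl.
have e2_gt0 : 0 < e2 by rewrite divr_gt0 // mulr_gt0 // ltr_wpDl.
have nphi : \forall z \near (x, x),
    `|phi (f z.1) - phi (f z.2) - l * (f z.1 - f z.2)| <= e1 * `|f z.1 - f z.2|.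
  have [[A B] /= [nA nB] AB] := sphi _ e1_gt0.
  exists (f @^-1` A, f @^-1` B); first by split; exact: cf.
  by move=> z [zA zB]; exact: (AB (f z.1, f z.2)).
apply: filterS2 (filterI nphi fC) (f1 _ e2_gt0) => z [hphi hC] hf.
set v := z.1 - z.2 in hC hf *.
have -> : phi (f z.1) - phi (f z.2) - l * L v =
  (phi (f z.1) - phi (f z.2) - l * (f z.1 - f z.2)) + l * (f z.1 - f z.2 - L v) by ring.
rewrite (splitr e) mulrDl.
apply: le_trans (ler_normD _ _) (lerD _ _).
  apply: le_trans hphi _; apply: (@le_trans _ _ (e1 * (C * `|v|))).
    by rewrite ler_wpM2l // ltW.
  rewrite mulrA ler_wpM2r // /e1.
  have -> : e / (2 * (C + 1)) * C = e / 2 * (C / (C + 1)) by field; lra.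
  by rewrite ler_piMr ?(ltW (divr_gt0 _ _)) // ler_pdivrMr ?ltr_wpDl // mul1r lerDl.
rewrite normrM; apply: (@le_trans _ _ (`|l| * (e2 * `|v|))).
  by rewrite ler_wpM2l.
rewrite mulrA ler_wpM2r // /e2.
have l0 := normr_ge0 l.
have -> : `|l| * (e / (2 * (`|l| + 1))) = e / 2 * (`|l| / (`|l| + 1)) by field; lra.
by rewrite ler_piMr ?(ltW (divr_gt0 _ _)) // ler_pdivrMr ?ltr_wpDl // mul1r lerDl.
Qed.

End strict_diff.

Section scalar_strict.
Variable R : realType.

(** The mean value theorem turns continuity of the derivative at a into strictness. *)
Lemma strict_derive (phi dphi : R -> R) (a : R) :
  (\forall s \near a, is_derive s (1 : R) phi (dphi s)) ->
  {for a, continuous dphi} ->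
  forall e, 0 < e -> \forall w \near (a, a),
    `|phi w.1 - phi w.2 - dphi a * (w.1 - w.2)| <= e * `|w.1 - w.2|.
Proof.
move=> nd cd e e0.
have : \forall s \near a, is_derive s (1 : R) phi (dphi s) /\ `|dphi a - dphi s| <= e.
  by apply: filterI => //; by have /cvgrPdist_le := cd; apply.
move=> /nbhs_ballP[d /= d0 h].
have : \forall s \near a, ball a d s by exact: nbhsx_ballx.
move=> nb; exists (ball a d, ball a d) => //= -[s t] [/= s_a t_a].
wlog st : s t s_a t_a / t < s.
  move=> H; have [st|ts|->] := ltgtP s t; last by rewrite !subrr mulr0 subr0 normr0 mulr0.
    have := H t s t_a s_a st; rewrite distrC.
    by rewrite (_ : `|t - s| = `|s - t|); [congr (`|_| <= _); ring|exact: distrC].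
  exact: H.
have inball c : t <= c <= s -> ball a d c.
  move=> /andP[tc cs]; move: s_a t_a; rewrite /ball /= !ltr_norml => /andP[s1 s2] /andP[t1 t2].
  by apply/andP; split; lra.
have dphiE c : c \in `]t, s[ -> is_derive c (1 : R) phi (dphi c).
  rewrite in_itv /= => /andP[tc cs].
  by apply: (h c _).1; apply: inball; rewrite !ltW.
have cphi : {within `[t, s], continuous phi}.
  apply: derivable_within_continuous => c; rewrite in_itv /= => cts.
  have [D _] := h c (inball c cts); exact: ex_derive.
have [c] := MVT st dphiE cphi; rewrite in_itv /= => /andP[tc cs] E.
have [_ hc] : is_derive c (1 : R) phi (dphi c) /\ `|dphi a - dphi c| <= e.
  by apply: h; apply: inball; rewrite !ltW.
by rewrite E -mulrBl normrM distrC ler_wpM2r.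
Qed.

Lemma strict_inv (a : R) : a != 0 -> forall e, 0 < e -> \forall w \near (a, a),
  `|w.1^-1 - w.2^-1 - (- (a ^- 2)) * (w.1 - w.2)| <= e * `|w.1 - w.2|.
Proof.
move=> a0; apply: (@strict_derive (fun s => s^-1) (fun s => - (s ^- 2))).
  have : \forall s \near a, s != 0.
    by have := @cvgr_neq0 _ _ _ (nbhs a) _ id a; apply => //; exact: cvg_id.
  apply: filterS => s s0; split; first exact: derivableV.
  by rewrite deriveV // derive_id /GRing.scale /= mulr1.
apply: continuousN; apply: continuousV; first by rewrite expf_neq0.
exact: exprn_continuous.
Qed.

Lemma strict_sqrt (a : R) : 0 < a -> forall e, 0 < e -> \forall w \near (a, a),
  `|Num.sqrt w.1 - Num.sqrt w.2 - (2 * Num.sqrt a)^-1 * (w.1 - w.2)| <= e * `|w.1 - w.2|.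
Proof.
move=> a0; apply: (@strict_derive Num.sqrt (fun s => (2 * Num.sqrt s)^-1)).
  have : \forall s \near a, 0 < s by exact: lt_nbhsr.
  by apply: filterS => s s0; exact: is_derive1_sqrt.
apply: continuousV; first by rewrite mulf_neq0 // gt_eqF // sqrtr_gt0.
apply: continuousM; [exact: cst_continuous|exact: sqrt_continuous].
Qed.

Lemma strict_atan (a : R) : forall e, 0 < e -> \forall w \near (a, a),
  `|atan w.1 - atan w.2 - (1 + a ^+ 2)^-1 * (w.1 - w.2)| <= e * `|w.1 - w.2|.
Proof.
apply: (@strict_derive atan (fun s => (1 + s ^+ 2)^-1)).
  by near=> s; exact: is_derive1_atan.
apply: continuousV; first by rewrite gt_eqF // ltr_pwDl // sqr_ge0.
apply: continuousD; [exact: cst_continuous|exact: exprn_continuous].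
Unshelve. all: by end_near. Qed.

End scalar_strict.

(** * Derivative of the curvature *)

Section row_norm.
Variables (R : realType) (N : nat).

Lemma coord_le_norm (u : 'rV[R]_N) i : `|u 0 i| <= `|u|.
Proof. by rewrite [leRHS]mx_normrE; apply: (le_bigmax _ _ (0, i)). Qed.

Lemma norm_le_coord (u : 'rV[R]_N) C : 0 <= C -> (forall i, `|u 0 i| <= C) ->
  `|u| <= C.
Proof.
move=> C0 uC; rewrite [leLHS]mx_normrE; apply: bigmax_le => // -[i j] _ /=.
by rewrite (ord1 i).
Qed.

Lemma strict_diff_coord (x : 'rV[R]_N) i :
  strict_diff (fun y : 'rV[R]_N => y 0 i) x (fun v => v 0 i).
Proof.
split; first by exists 1 => v; rewrite mul1r coord_le_norm.
move=> e e0; near=> z; rewrite !mxE subrr normr0 mulr_ge0 // ltW.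
Unshelve. all: by end_near. Qed.

End row_norm.

Section curvature_derivative.
Variables (R : realType) (N : nat) (K : {set {set 'I_N}}).
Implicit Types (r u : 'rV[R]_N) (t : {set 'I_N}) (m : 'I_N).

Definition dbend r m u : R := - (r 0 m ^- 2) * u 0 m.

Definition face_slope r t m : R := bend_sum r t - 2 * (r 0 m)^-1.

(** The derivative of atan (q / sqrt Q), arranged to be the [t] of [angle_form_le0] divided by sqrt
    Q. *)
Definition dface r t m u : R :=
  (soddy r t * ((\sum_(j in t) dbend r j u) - 2 * dbend r m u)
   - face_slope r t m * (\sum_(j in t) face_slope r t j * dbend r j u))
  / (soddy r t + face_slope r t m ^+ 2) / Num.sqrt (soddy r t).

Lemma strict_diff_inv r m : 0 < r 0 m ->
  strict_diff (fun s : 'rV[R]_N => (s 0 m)^-1) r (dbend r m).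
Proof.
move=> r0; apply: (strict_diff_comp (strict_diff_coord r m)).
by apply: strict_inv; rewrite gt_eqF.
Qed.

Lemma strict_diff_soddy r t : (forall m, 0 < r 0 m) ->
  strict_diff (fun s : 'rV[R]_N => soddy s t) r
    (fun u => 2 * \sum_(j in t) face_slope r t j * dbend r j u).
Proof.
move=> r0.
have hS : strict_diff (fun s : 'rV[R]_N => bend_sum s t) r (fun u => \sum_(j in t) dbend r j u).
  by apply: strict_diff_sum => j _; exact: strict_diff_inv.
have h2 : strict_diff (fun s : 'rV[R]_N => \sum_(m in t) (s 0 m)^-1 ^+ 2) r
    (fun u => \sum_(j in t) (2 * (r 0 j)^-1 * dbend r j u)).
  apply: strict_diff_sum => j _.
  have := strict_diffM (strict_diff_inv (r0 j)) (strict_diff_inv (r0 j)).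
  by apply: strict_diff_extL => v; ring.
have := strict_diffB (strict_diffM hS hS) (strict_diffZ 2 h2).
apply: strict_diff_extL => v.
rewrite /face_slope; under [in RHS]eq_bigr do rewrite mulrBl.
by rewrite sumrB -mulr_sumr; ring.
Qed.

Lemma strict_diff_face_angle r t m : (forall m, 0 < r 0 m) -> 0 < soddy r t ->
  strict_diff (fun s : 'rV[R]_N => face_angle s t m) r (dface r t m).
Proof.
move=> r0 Q0.
have hS : strict_diff (fun s : 'rV[R]_N => bend_sum s t) r (fun u => \sum_(j in t) dbend r j u).
  by apply: strict_diff_sum => j _; exact: strict_diff_inv.
have hq := strict_diffB hS (strict_diffZ 2 (strict_diff_inv (r0 m))).
have hs := strict_diff_comp (strict_diff_soddy t r0) (strict_sqrt Q0).
have s0 : 0 < Num.sqrt (soddy r t) by rewrite sqrtr_gt0.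
have hi := strict_diff_comp hs (strict_inv (lt0r_neq0 s0)).
have := strict_diff_comp (strict_diffM hq hi) (strict_atan _).
apply: strict_diff_extL => v; rewrite /dface -/(face_slope r t m).
set B := \sum_(j in t) face_slope _ _ _ * _; set dS := \sum_(j in t) _.
(* Q is replaced by s^2, where s is its square root, so that [field] sees a rational identity. *)
have := sqr_sqrtr (ltW Q0); move: (Num.sqrt _) s0 => s s0 <-.
move: (face_slope r t m) (dbend r m v) => q x; field.
rewrite !gt_eqF //=; by rewrite ltr_pwDl ?exprn_gt0 // sqr_ge0.
Qed.

Lemma tetrahedra_card t : t \in tetrahedra K -> #|t| = 4%N.
Proof. by rewrite inE => /andP[_ /eqP]. Qed.

Definition nondegenerate r : Prop :=
  (forall m, 0 < r 0 m) /\ (forall t, t \in tetrahedra K -> 0 < soddy r t).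

Lemma packing_metricP r : packing_metric K r <-> nondegenerate r.
Proof.
split=> [[r0 pl]|[r0 Q0]]; split=> // t tK.
  have [p plp] := pl t tK; have t4 := tetrahedra_card tK.
  have [i it] : exists i, i \in t by apply/set0Pn; rewrite -card_gt0 t4.
  by have [] := placement_solid_angle r0 t4 it plp.
exact: exists_placement r0 (tetrahedra_card tK) (Q0 t tK).
Qed.

Lemma near_packing_metric r : packing_metric K r ->
  \forall s \near r, packing_metric K s.
Proof.
move=> /packing_metricP[r0 Q0].
have h1 : \forall s \near r, forall m, 0 < (s : 'rV[R]_N) 0 m.
  apply: (@filter_forall _ _ (fun m (s : 'rV[R]_N) => 0 < s 0 m) (nbhs r)) => m.
  have := strict_diff_continuous (strict_diff_coord r m).
  by move/cvgr_gt; apply.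
have h2 : \forall s \near r, forall t, t \in tetrahedra K -> 0 < soddy s t.
  apply: (@filter_forall _ _ (fun t (s : 'rV[R]_N) => t \in tetrahedra K -> 0 < soddy s t) (nbhs r)) => t; have [tK|tK] := boolP (t \in tetrahedra K); last first.
    by near=> s.
  have := strict_diff_continuous (strict_diff_soddy t r0).
  move/cvgr_gt => /(_ _ (Q0 t tK)); apply: filterS => s //.
by apply: filterS2 h1 h2 => s s0 sQ; apply/packing_metricP; split.
Unshelve. all: by end_near. Qed.

Definition dcurv r i u : R :=
  - \sum_(t in tetrahedra K | i \in t)
      (angle_unit R * (2 * \sum_(m in t | m != i) dface r t m u)).

Lemma strict_diff_curvK r i : packing_metric K r ->
  strict_diff (fun s : 'rV[R]_N => curvK K s i) r (dcurv r i).
Proof.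
move=> rK; have [r0 Q0] := (packing_metricP r).1 rK.
have : strict_diff (fun s : 'rV[R]_N => 4 * pi - \sum_(t in tetrahedra K | i \in t)
    (angle_unit R * (2 * \sum_(m in t | m != i) face_angle s t m - pi))) r (dcurv r i).
  have h : strict_diff (fun s : 'rV[R]_N => \sum_(t in tetrahedra K | i \in t)
      (angle_unit R * (2 * \sum_(m in t | m != i) face_angle s t m - pi))) r
      (fun u => \sum_(t in tetrahedra K | i \in t)
        (angle_unit R * (2 * \sum_(m in t | m != i) dface r t m u))).
    apply: strict_diff_sum => t /andP[tK it]; apply: strict_diffZ.
    have hm : strict_diff (fun s : 'rV[R]_N => \sum_(m in t | m != i) face_angle s t m) r
        (fun u => \sum_(m in t | m != i) dface r t m u).
      by apply: strict_diff_sum => m _; apply: strict_diff_face_angle => //; exact: Q0.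
    have := strict_diffB (strict_diffZ 2 hm) (strict_diff_cst (pi : R) r).
    by apply: strict_diff_extL => v; rewrite subr0.
  have := strict_diffB (strict_diff_cst (4 * pi : R) r) h.
  by apply: strict_diff_extL => v; rewrite sub0r.
(* The closed formula for solid angles holds only at packing metrics; these form a neighbourhood of
   r. *)
apply: strict_diff_ext; have := near_packing_metric rK.
apply: filterS => s [s0 pl]; rewrite /curvK; congr (_ - _).
apply: eq_bigr => t /andP[tK it]; rewrite solid_angleE //.
  exact: tetrahedra_card tK.
exact: pl.
Qed.

Lemma tetra_form_sign r t u : (forall m, 0 < r 0 m) -> #|t| = 4%N ->
  0 < soddy r t ->
  \sum_(i in t) u 0 i * (\sum_(m in t | m != i) dface r t m u) <= 0 /\
  (\sum_(i in t) u 0 i * (\sum_(m in t | m != i) dface r t m u) = 0 ->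
   exists a, forall m, m \in t -> u 0 m = a * r 0 m).
Proof.
move=> r0 t4 Q0.
have [i it] : exists i, i \in t by apply/set0Pn; rewrite -card_gt0 t4.
have [j [k [l [_ tE sum4 _]]]] := tetra_enum it t4.
have sumD1 n : n \in t -> \sum_(m in t | m != n) dface r t m u =
    (\sum_(m in t) dface r t m u) - dface r t n u.
  by move=> nt; rewrite [in RHS](bigD1 n) //= addrAC subrr add0r.
under eq_bigr => n nt do rewrite sumD1 //.
rewrite !sum4.
have := Q0; rewrite /soddy /bend_sum !sum4 => Q1.
have [h1 h2] := angle_form_le0 (r0 i) (r0 j) (r0 k) (r0 l) (u 0 i) (u 0 j)
  (u 0 k) (u 0 l) Q1.
set F := (X in X <= 0) in h1 h2.
set G := (X in X <= 0).
have s0 : 0 < Num.sqrt (soddy r t) by rewrite sqrtr_gt0.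
have GE : G = F / Num.sqrt (soddy r t).
  rewrite /G /F /dface /face_slope /dbend /bend_sum.
  have -> : soddy r t = ((r 0 i)^-1 + (r 0 j)^-1 + (r 0 k)^-1 + (r 0 l)^-1) ^+ 2 -
    2 * ((r 0 i)^-1 ^+ 2 + (r 0 j)^-1 ^+ 2 + (r 0 k)^-1 ^+ 2 + (r 0 l)^-1 ^+ 2).
    by rewrite /soddy /bend_sum !sum4.
  rewrite !sum4.
  have e (m : 'I_N) : - (r 0 m ^- 2) * u 0 m = - u 0 m / r 0 m ^+ 2 by ring.
  rewrite !e; move: (Num.sqrt _) => s; ring.
split; first by rewrite GE pmulr_lle0 // invr_gt0.
move=> G0; have {G0}/eqP : G = 0 := G0.
rewrite GE mulf_eq0 invr_eq0 (gt_eqF s0) orbF => /eqP /h2 [a [a1 a2 a3 a4]].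
by exists a => m; rewrite tE !inE => /or4P[] /eqP ->.
Qed.

(** Exchanging the sums over vertices and tetrahedra reduces the claim to single tetrahedra. At this
    stage the factor a may still depend on t. *)
Lemma dcurv_form r u : packing_metric K r ->
  0 <= \sum_i u 0 i * dcurv r i u /\
  (\sum_i u 0 i * dcurv r i u = 0 -> forall t, t \in tetrahedra K ->
   exists a, forall m, m \in t -> u 0 m = a * r 0 m).
Proof.
move=> /packing_metricP [r0 Q0].
pose G t := \sum_(i in t) u 0 i * (\sum_(m in t | m != i) dface r t m u).
have E : \sum_i u 0 i * dcurv r i u =
    (2 * angle_unit R) * \sum_(t in tetrahedra K) (- G t).
  rewrite mulr_sumr.
  transitivity (\sum_i \sum_(t in tetrahedra K | i \in t)
    - (2 * angle_unit R) * (u 0 i * \sum_(m in t | m != i) dface r t m u)).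
    apply: eq_bigr => i _; rewrite /dcurv mulrN mulr_sumr -sumrN.
    by apply: eq_bigr => t _; ring.
  rewrite (exchange_big_dep (fun t => t \in tetrahedra K)) /=; last by move=> i t _ /andP[].
  apply: eq_bigr => t tK; rewrite /G mulrN -mulNr mulr_sumr.
  by apply: eq_bigl => i; rewrite tK.
have c0 : 0 < 2 * angle_unit R by rewrite mulr_gt0 // angle_unit_gt0.
have G0 t : t \in tetrahedra K -> 0 <= - G t.
  move=> tK; rewrite oppr_ge0.
  by have [] := tetra_form_sign u r0 (tetrahedra_card tK) (Q0 t tK).
rewrite E; split; first by rewrite pmulr_rge0 // sumr_ge0.
move/eqP; rewrite mulf_eq0 (gt_eqF c0) /= psumr_eq0 // => /allP h t tK.
have := h t (mem_index_enum _); rewrite tK /= oppr_eq0 => /eqP Gt.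
by have [_] := tetra_form_sign u r0 (tetrahedra_card tK) (Q0 t tK); apply.
Qed.

End curvature_derivative.

(** * Connectedness of the complex *)

(** Let h be the total barycentric weight of the vertices where w takes the value w i. All vertices
    of a simplex share one value of w, so h is 0 or 1 on the realization; pulled back to the
    connected M it would have to take the value 1/2 if w j differed from w i. *)
Lemma simplexwise_constant (R : realType) (M : topologicalType) (N : nat)
    (K : {set {set 'I_N}}) (w : 'I_N -> R) :
  connected [set: M] -> triangulation R M K ->
  (forall t, t \in tetrahedra K -> forall i j, i \in t -> j \in t -> w i = w j) ->
  forall i j, w i = w j.
Proof.
move=> M_conn [[_ K1 _ Kpure] [f [g [fP gP _ cg]]]] wt i j.
apply/eqP/negP => /negP wij.
pose h (x : 'rV[R]_N) : R := \sum_(m | w m == w i) x 0 m.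
have h01 (x : 'rV[R]_N) : realization K x -> h x = 0 \/ h x = 1.
  move=> [x0 x1 sK].
  have [t [tK t4 st]] := Kpure _ sK.
  have tT : t \in tetrahedra K by rewrite inE tK t4 eqxx.
  have [m0 /andP[/eqP wm0 xm0]|none] := pickP (fun m => (w m == w i) && (x 0 m != 0)).
    right; rewrite -[RHS]x1 [in RHS](bigID (fun m => w m == w i)) /= [X in _ + X]big1 ?addr0 //.
    move=> m wm; apply/eqP/negP => /negP xm; move: wm; rewrite -wm0.
    rewrite (wt t tT m m0) ?eqxx //; apply: (fintype.subsetP st); rewrite inE //.
  left; apply: big1 => m /eqP wm; apply/eqP/negP => /negP xm.
  by have := none m; rewrite wm eqxx xm.
have ver k : realization K (delta_mx 0 k : 'rV[R]_N).
  split.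
  - by move=> m; rewrite mxE eqxx /=; case: (m == k).
  - rewrite (bigD1 k) //= mxE !eqxx big1 ?addr0 // => m mk.
    by rewrite mxE (negbTE mk) andbF.
  - rewrite (_ : [set _ | _]%SET = [set k]%SET) //; apply/setP => m.
    by rewrite !inE mxE eqxx /=; case: (m == k); rewrite ?oner_eq0 ?eqxx.
have hv k : h (delta_mx 0 k) = (w k == w i)%:R.
  rewrite /h; under eq_bigr do rewrite mxE eqxx /=.
  rewrite big_mkcond /= (bigD1 k) //= eqxx big1 ?addr0; first by case: ifP.
  by move=> m mk; rewrite (negbTE mk); case: ifP.
have ch : continuous h.
  move=> x; rewrite /h -fct_sumE; elim/big_ind : _ => [|a b ca cb|m _].
  - exact: cst_continuous.
  - exact: continuousD.
  - exact: coord_continuous.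
have chg : {within [set: M], continuous (h \o g)}.
  have cg' : continuous g := (@continuous_subspace_setT _ _ g).2 cg.
  apply: (@continuous_subspace_setT M R (h \o g)).1 => x.
  by apply: continuous_comp; [exact: cg'|exact: ch].
have := connected_continuous_connected M_conn chg.
move/connected_intervalP => itv.
have im k : [set (h \o g) x | x in [set: M]] (w k == w i)%:R.
  have [_ fk] := fP _ (ver k); exists (f (delta_mx 0 k)) => //=.
  by rewrite fk hv.
have := itv _ _ (im j) (im i) (2^-1).
rewrite eqxx eq_sym (negbTE wij) => -[|x _ /= hx].
  by apply/andP; split; [rewrite invr_ge0|rewrite invf_le1 // ler1n].
have [gx _] := gP x I.
by have [] := h01 _ gx; rewrite hx => e; lra.
Qed.

(** * Ordinary differential equations *)

Lemma coord_dist_le_norm (R : realType) (N : nat) (x y : 'rV[R]_N) i :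
  `|x 0 i - y 0 i| <= `|x - y|.
Proof. by have := coord_le_norm (x - y) i; rewrite !mxE. Qed.

Section real_line.
Variable R : realType.

(** Induction along the half-line: the supremum of the initial segments on which P holds could be
    passed if it were finite. *)
Lemma real_induction (P : R -> Prop) :
  P 0 ->
  (forall t, 0 <= t -> P t -> exists2 d, 0 < d & forall s, t <= s <= t + d -> P s) ->
  (forall t, 0 < t -> (forall s, 0 <= s < t -> P s) -> P t) ->
  forall t, 0 <= t -> P t.
Proof.
move=> P0 Pstep Plim t t0; apply: contrapT => nPt.
pose S : set R := [set s | 0 <= s /\ forall x, 0 <= x <= s -> P x].
have S0 : S 0.
  by split => // x /andP[x0 x0']; have -> : x = 0 by apply/eqP; rewrite eq_le x0 x0'.
have St s : S s -> s <= t.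
  by move=> [_ h]; rewrite leNgt; apply/negP => ts; apply: nPt; apply: h; rewrite t0 ltW.
have hS : has_sup S by split; [exists 0|exists t].
pose m := sup S.
have m0 : 0 <= m by apply: ub_le_sup => //; exists t.
have Pm s : 0 <= s < m -> P s.
  move=> /andP[s0 sm]; have [x [_ hx] sx] := sup_adherent (etrans (subr_gt0 s m) sm) hS.
  by apply: hx; rewrite s0 /=; move: sx; rewrite -/m; lra.
have PM : P m.
  by move: m0; rewrite le_eqVlt => /orP[/eqP <-//|m0]; exact: Plim.
have [d d0 hd] := Pstep m m0 PM.
have : S (m + d).
  split; first by rewrite addr_ge0 // ltW.
  move=> x /andP[x0 xmd]; have [xm|mx] := ltP x m; first by apply: Pm; rewrite x0.
  by apply: hd; rewrite mx.
move=> /(ub_le_sup (ltac:(by exists t) : has_ubound S)); rewrite -/m; lra.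
Qed.

Lemma le_of_derive_ge0 (f df : R -> R) (a b : R) : a <= b ->
  {within `[a, b], continuous f} ->
  (forall x, a < x < b -> is_derive x (1 : R) f (df x)) ->
  (forall x, a < x < b -> 0 <= df x) -> f a <= f b.
Proof.
rewrite le_eqVlt => /orP[/eqP -> //|ab] cf fd df0.
have fd' x : x \in `]a, b[ -> is_derive x (1 : R) f (df x).
  by rewrite in_itv /=; exact: fd.
have [c] := MVT ab fd' cf.
rewrite in_itv /= => cab E; rewrite -subr_ge0 E mulr_ge0 ?df0 //.
by rewrite subr_ge0 ltW.
Qed.

(** The intervals of radius 2 c / 2^n about u n are nested, and the limit is a point common to all
    of them. *)
Lemma geometric_limit (u : nat -> R) (c : R) :
  (forall n, `|u n.+1 - u n| <= c / 2 ^+ n) ->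
  exists l, forall n, `|l - u n| <= 2 * c / 2 ^+ n.
Proof.
move=> uc.
pose v n := u n - 2 * c / 2 ^+ n; pose w n := u n + 2 * c / 2 ^+ n.
have h n : 2 * c / 2 ^+ n.+1 = 2 * c / 2 ^+ n - c / 2 ^+ n.
  by rewrite exprS; field; rewrite expf_neq0.
have c0 n : 0 <= c / 2 ^+ n by exact: le_trans (normr_ge0 _) (uc n).
have vS n : v n <= v n.+1.
  by rewrite /v h; have := uc n; rewrite ler_norml => /andP[]; lra.
have wS n : w n.+1 <= w n.
  by rewrite /w h; have := uc n; rewrite ler_norml => /andP[]; lra.
have vw n m : v n <= w m.
  have vm : nondecreasing_seq v by apply/nondecreasing_seqP.
  have wm : nonincreasing_seq w by apply/nonincreasing_seqP.
  apply: (@le_trans _ _ (v (maxn n m))); first by apply: vm; exact: leq_maxl.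
  apply: (@le_trans _ _ (w (maxn n m))); last by apply: wm; exact: leq_maxr.
  by rewrite /v /w; have := c0 (maxn n m); rewrite -mulrA; lra.
have vb : has_ubound (range v) by exists (w 0%N) => _ [n _ <-].
exists (sup (range v)) => n.
have lv : v n <= sup (range v) by apply: ub_le_sup => //; exists n.
have lw : sup (range v) <= w n.
  by apply: ge_sup; [exists (v 0%N); exists 0%N|move=> _ [m _ <-]].
by rewrite ler_norml; move: lv lw; rewrite /v /w; lra.
Qed.

(* The base point -1 makes 0 an interior point of the domain. *)
Definition prim (f : R -> R) (t : R) : R :=
  \int[@lebesgue_measure R]_(s in `[-1, t]) f s
  - \int[@lebesgue_measure R]_(s in `[-1, 0]) f s.

Lemma prim0 f : prim f 0 = 0.
Proof. by rewrite /prim subrr. Qed.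

Lemma is_derive_prim (f : R -> R) (t : R) : continuous f -> -1 < t ->
  is_derive t (1 : R) (prim f) (f t).
Proof.
move=> cf t1.
have int : (@lebesgue_measure R).-integrable `[-1, t + 1] (EFin \o f).
  apply: continuous_compact_integrable; first exact: segment_compact.
  exact: continuous_subspaceT.
pose I : R -> R := fun x : R => \int[@lebesgue_measure R]_(s in `[-1, x]) f s.
have [d1 d2] : derivable I t 1 /\ derive1 I t = f t.
  exact: (@continuous_FTC1_closed R f (-1) t (t + 1) (etrans (ltrDl t 1) ltr01) int t1 (cf t)).
have -> : prim f = I - cst (I 0) by [].
move: I d1 d2 => I d1 d2.
have dI : is_derive t (1 : R) I (f t) by split => //; rewrite -derive1E.
by apply: is_derive_eq; rewrite subr0.
Qed.

End real_line.

(** * Global existence for bounded Lipschitz fields *)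

Section picard.
Variable R : realType.

Lemma lipschitz_continuous (g : R -> R) (C : R) :
  (forall s t, `|g s - g t| <= C * `|s - t|) -> continuous g.
Proof.
move=> gC t; apply/cvgrPdist_le => e e0.
have C0 : 0 < `|C| + 1 by rewrite ltr_pwDr.
have /cvgrPdist_le : id s @[s --> t] --> t by exact: cvg_id.
move=> /(_ (e / (`|C| + 1)) (divr_gt0 e0 C0)); apply: filterS => s h.
apply: le_trans (gC _ _) _; apply: (@le_trans _ _ ((`|C| + 1) * `|t - s|)).
  by rewrite ler_wpM2r //; apply: le_trans (ler_norm _) _; rewrite lerDl.
by rewrite mulrC -ler_pdivlMr.
Qed.

(** Mean value inequality with a variable majorant: c + D and c - D are nondecreasing. *)
Lemma derive_bound (D d c dc : R -> R) (a b : R) : a <= b ->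
  (forall t, a <= t <= b -> is_derive t (1 : R) D (d t)) ->
  (forall t, a <= t <= b -> is_derive t (1 : R) c (dc t)) ->
  (forall t, a <= t <= b -> `|d t| <= dc t) ->
  `|D b - D a| <= c b - c a.
Proof.
move=> ab hD hc hd.
have cont (f df : R -> R) : (forall t, a <= t <= b -> is_derive t (1 : R) f (df t)) ->
    {within `[a, b], continuous f}.
  move=> hf; apply: derivable_within_continuous => t; rewrite in_itv /= => tab.
  by have [] := hf t tab.
have W t : a < t < b -> a <= t <= b by move=> /andP[/ltW -> /ltW ->].
rewrite ler_norml; apply/andP; split.
  have h1 t : a <= t <= b -> is_derive t (1 : R) (c + D) (dc t + d t).
    by move=> tab; apply: is_deriveD; [exact: hc|exact: hD].
  have := le_of_derive_ge0 ab (cont _ _ h1) (fun t tab => h1 t (W t tab)).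
  rewrite !fctE => H.
  suff : c a + D a <= c b + D b by lra.
  by apply: H => t /W tab; have := hd t tab; rewrite ler_norml => /andP[]; lra.
have h1 t : a <= t <= b -> is_derive t (1 : R) (c - D) (dc t - d t).
  by move=> tab; apply: is_deriveB; [exact: hc|exact: hD].
have := le_of_derive_ge0 ab (cont _ _ h1) (fun t tab => h1 t (W t tab)).
rewrite !fctE => H.
suff : c a - D a <= c b - D b by lra.
by apply: H => t /W tab; have := hd t tab; rewrite ler_norml => /andP[]; lra.
Qed.

Lemma is_derive_expR_scale (C a t : R) : a != 0 ->
  is_derive t (1 : R) (fun s => C / a * expR (a * s)) (C * expR (a * t)).
Proof.
move=> a0.
have h : is_derive t (1 : R) (fun s : R => a * s) a.
  by apply: is_derive_eq; rewrite /GRing.scale /= mulr1.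
have := is_deriveZ (C / a) (is_derive1_comp (is_derive_expR _) h).
have -> : (fun s => C / a * expR (a * s)) = C / a *: (expR \o (fun s => a * s)).
  by apply/funext.
move=> H; apply: (is_derive_eq H).
by rewrite /GRing.scale /=; field.
Qed.

Lemma exp_bound (D d : R -> R) (C a t : R) : 0 < a -> 0 <= t -> 0 <= C -> D 0 = 0 ->
  (forall s : R, 0 <= s -> is_derive s (1 : R) D (d s)) ->
  (forall s : R, 0 <= s -> `|d s| <= C * expR (a * s)) ->
  `|D t| <= C / a * expR (a * t).
Proof.
move=> a0 t0 C0 D0 hD hd.
have := @derive_bound D d (fun s => C / a * expR (a * s)) (fun s => C * expR (a * s)) 0 t t0.
rewrite D0 subr0 mulr0 expR0 mulr1 => H.
apply: le_trans (H _ _ _) _.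
- by move=> s /andP[s0 _]; exact: hD.
- by move=> s _; apply: is_derive_expR_scale; rewrite gt_eqF.
- by move=> s /andP[s0 _]; exact: hd.
- by rewrite lerBlDr lerDl divr_ge0 // ltW.
Qed.

Variables (N : nat) (F : 'rV[R]_N -> 'rV[R]_N) (x0 : 'rV[R]_N) (B L : R).
Hypotheses (B0 : 0 <= B) (L0 : 0 < L).
Hypothesis FB : forall x i, `|F x 0 i| <= B.
Hypothesis FL : forall x y i, `|F x 0 i - F y 0 i| <= L * `|x - y|.

Let step (y : R -> 'rV[R]_N) (t : R) : 'rV[R]_N :=
  \row_i (x0 0 i + prim (fun s => F (y s) 0 i) t).

(** [Num.max t 0] keeps the iterates at x0 for negative times, so that they are Lipschitz on the
    whole line and the integrands are continuous there, as [is_derive_prim] requires. *)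
Let picard := fix picard n : R -> 'rV[R]_N :=
  if n is n'.+1 then fun t => step (picard n') (Num.max t 0) else fun=> x0.

Let lip (y : R -> 'rV[R]_N) := forall s t, `|y s - y t| <= B * `|s - t|.

Let max0_lip (s t : R) : `|Num.max s 0 - Num.max t 0| <= `|s - t|.
Proof.
rewrite /Num.max; case: ltP => s0; case: ltP => t0.
- by rewrite subrr normr0.
- rewrite sub0r normrN ger0_norm // distrC ger0_norm; lra.
- rewrite subr0 ger0_norm // ger0_norm; lra.
- by [].
Qed.

Let lipF y i : lip y -> continuous (fun s => F (y s) 0 i).
Proof.
move=> ly; apply: (@lipschitz_continuous _ (L * B)) => s t.
by apply: le_trans (FL _ _ _) _; rewrite -mulrA ler_wpM2l // ltW.
Qed.

Let step_lip y : lip y -> lip (fun t => step y (Num.max t 0)).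
Proof.
move=> ly s t; apply: norm_le_coord => [|i]; first exact: mulr_ge0.
rewrite !mxE.
have W a b : 0 <= a -> a <= b ->
    `|prim (fun s => F (y s) 0 i) b - prim (fun s => F (y s) 0 i) a| <= B * (b - a).
  move=> a0 ab; rewrite mulrBr.
  apply: (@derive_bound _ (fun s => F (y s) 0 i) (fun s => B * s) (fun=> B) a b ab).
  - move=> c /andP[ac _]; apply: is_derive_prim; first exact: lipF.
    by apply: lt_le_trans ac; apply: lt_le_trans a0; rewrite ltrN10.
  - by move=> c _; apply: is_derive_eq; rewrite /GRing.scale /= mulr1.
  - by move=> c _; exact: FB.
have m0 (a : R) : 0 <= Num.max a 0 by rewrite le_max lexx orbT.
apply: (@le_trans _ _ (B * `|Num.max s 0 - Num.max t 0|)); last first.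
  by rewrite ler_wpM2l.
move: (Num.max s 0) (Num.max t 0) (m0 s) (m0 t) => a b a0 b0.
have -> : forall x p q : R, x + p - (x + q) = p - q by move=> *; ring.
have [ab|ba] := leP a b.
  have n : `|a - b| = b - a by rewrite distrC ger0_norm // subr_ge0.
  by rewrite distrC n; exact: W.
have n : `|a - b| = a - b by rewrite ger0_norm // subr_ge0 ltW.
by rewrite n; apply: W => //; exact: ltW.
Qed.

Let picard_lip n : lip (picard n).
Proof.
elim: n => [|n ih]; last exact: step_lip.
by move=> s t; rewrite subrr normr0 mulr_ge0.
Qed.

(* In the norm weighted by exp (-a t) each Picard step halves distances. *)
Let a := 2 * L.
Let a0 : 0 < a. Proof. by rewrite mulr_gt0. Qed.

Let A := B / a.
Let A0 : 0 <= A. Proof. by rewrite divr_ge0 // ltW. Qed.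

Let step_dist y z (C t : R) : lip y -> lip z -> 0 <= C -> 0 <= t ->
  (forall s, 0 <= s -> `|y s - z s| <= C * expR (a * s)) ->
  `|step y t - step z t| <= C / 2 * expR (a * t).
Proof.
move=> ly lz C0 t0 yz; apply: norm_le_coord => [|i].
  by rewrite mulr_ge0 ?expR_ge0 // divr_ge0.
rewrite !mxE.
have -> : forall x p q : R, x + p - (x + q) = p - q by move=> *; ring.
have -> : C / 2 = L * C / a by rewrite /a; field; rewrite gt_eqF.
apply: (@exp_bound (prim (fun s => F (y s) 0 i) - prim (fun s => F (z s) 0 i))
  (fun s => F (y s) 0 i - F (z s) 0 i)) => //.
- by rewrite mulr_ge0 // ltW.
- by rewrite !fctE !prim0 subrr.
- move=> s s0; have s1 : -1 < s by apply: lt_le_trans s0; rewrite ltrN10.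
  by apply: is_deriveB; apply: is_derive_prim => //; exact: lipF.
- move=> s s0; apply: le_trans (FL _ _ _) _.
  by rewrite -mulrA ler_wpM2l ?yz // ltW.
Qed.

Let picard_dist n t : 0 <= t ->
  `|picard n.+1 t - picard n t| <= A / 2 ^+ n * expR (a * t).
Proof.
elim: n t => [|n ih] t t0.
  rewrite /= (max_l t0) expr0 divr1 /A; apply: norm_le_coord => [|i].
    by rewrite mulr_ge0 ?expR_ge0.
  rewrite !mxE addrAC subrr add0r.
  apply: (@exp_bound _ (fun s => F x0 0 i)) => //; first exact: prim0.
    move=> s s0; have s1 : -1 < s by apply: lt_le_trans s0; rewrite ltrN10.
    by apply: is_derive_prim => //; exact: cst_continuous.
  move=> s s0; apply: le_trans (FB _ _) _.
  rewrite ler_peMr //; apply: le_trans (expR_ge1Dx _).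
  by rewrite lerDl mulr_ge0 // ltW.
have -> : A / 2 ^+ n.+1 = A / 2 ^+ n / 2 by rewrite exprS; field; rewrite expf_neq0.
have E m : picard m.+1 t = step (picard m) t by rewrite /= max_l.
rewrite !E; apply: step_dist => //; try exact: picard_lip.
by rewrite divr_ge0 // exprn_ge0.
Qed.

Lemma ode_exists : exists z : R -> 'rV[R]_N, z 0 = x0 /\
  forall t : R, 0 <= t -> forall i,
    is_derive t (1 : R) (fun s => z s 0 i) (F (z t) 0 i).
Proof.
have pmax n t : picard n t = picard n (Num.max t 0).
  by case: n => [//|n] /=; rewrite (max_l (_ : 0 <= Num.max t 0)) // le_max lexx orbT.
have lim t i : exists l, forall n,
    `|l - picard n t 0 i| <= 2 * (A * expR (a * Num.max t 0)) / 2 ^+ n.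
  apply: geometric_limit => n; rewrite !(pmax _ t).
  have m0 : 0 <= Num.max t 0 by rewrite le_max lexx orbT.
  apply: le_trans (coord_dist_le_norm _ _ _) _.
  by apply: le_trans (picard_dist n m0) _; rewrite mulrAC.
pose y0 t := projT1 (choice (lim t)).
have hy0 t := projT2 (choice (lim t)).
pose y t : 'rV[R]_N := \row_i y0 t i.
have hy t n : `|y t - picard n t| <= 2 * (A * expR (a * Num.max t 0)) / 2 ^+ n.
  apply: norm_le_coord => [|i].
    by rewrite divr_ge0 ?exprn_ge0 // mulr_ge0 // mulr_ge0 // expR_ge0.
  have -> : (y t - picard n t) 0 i = y0 t i - picard n t 0 i by rewrite !mxE.
  exact: hy0.
have eps_0 (c x : R) : 0 <= c -> (forall n, x <= c / 2 ^+ n) -> x <= 0.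
  move=> c0 h; rewrite leNgt; apply/negP => x_gt0.
  have [n hn] : exists n : nat, c / x < n%:R.
    by exists (Num.truncn (c / x)).+1; exact: truncnS_gt.
  have := h n; rewrite ler_pdivlMr ?exprn_gt0 // => hx.
  have : n%:R <= 2 ^+ n :> R by rewrite -natrX ler_nat ltnW // ltn_expl.
  move: hn; rewrite ltr_pdivrMr //; nra.
have ly : lip y.
  move=> s t; rewrite -subr_le0.
  pose c := 2 * (A * expR (a * Num.max s 0)) + 2 * (A * expR (a * Num.max t 0)).
  apply: (eps_0 c) => [|n].
    by rewrite addr_ge0 // mulr_ge0 // mulr_ge0 // expR_ge0.
  rewrite lerBlDr /c mulrDl.
  have -> : y s - y t = (y s - picard n s) + (picard n s - picard n t) - (y t - picard n t).
    move: (y s) (y t) (picard n s) (picard n t) => p q p' q'.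
    by apply/rowP => j; rewrite !mxE; ring.
  apply: le_trans (ler_normB _ _) _; rewrite [leRHS]addrAC; apply: lerD; last exact: hy.
  by apply: le_trans (ler_normD _ _) _; apply: lerD; [exact: hy|exact: picard_lip].
have yE t : 0 <= t -> y t = step y t.
  move=> t0; apply/eqP; rewrite -subr_eq0 -normr_le0.
  apply: (eps_0 (2 * (A * expR (a * t)))) => [|n].
    by rewrite mulr_ge0 // mulr_ge0 // expR_ge0.
  have h1 := hy t n.+1; rewrite max_l // in h1.
  have h2 : `|step y t - step (picard n) t| <= 2 * A / 2 ^+ n / 2 * expR (a * t).
    apply: (step_dist ly (picard_lip n)) => //.
      by rewrite divr_ge0 ?exprn_ge0 // mulr_ge0.
    by move=> s s0; have := hy s n; rewrite max_l // mulrA mulrAC.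
  have E : picard n.+1 t = step (picard n) t by rewrite /= max_l.
  rewrite -E in h2.
  have -> : y t - step y t = (y t - picard n.+1 t) - (step y t - picard n.+1 t).
    by rewrite opprB addrA subrK.
  apply: le_trans (ler_normB _ _) _; apply: le_trans (lerD h1 h2) _.
  rewrite le_eqVlt; apply/orP; left; apply/eqP.
  by rewrite exprS; field; rewrite expf_neq0.
(* y and [step y] agree for nonnegative times, but y is constant before 0 and may have a corner
   there, whereas [step y] has a two-sided derivative at 0. *)
exists (step y); split.
  by apply/rowP => i; rewrite !mxE prim0 addr0.
move=> t t0 i; rewrite -(yE t t0).
have t1 : -1 < t by apply: lt_le_trans t0; rewrite ltrN10.
have h := is_derive_prim (lipF ly (i := i)) t1.
have -> : (fun s => step y s 0 i) = cst (x0 0 i) + prim (fun s => F (y s) 0 i).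
  by apply/funext => s; rewrite !mxE.
by apply: is_derive_eq; rewrite add0r.
Qed.

End picard.

(** * Local estimates for the flow *)

Lemma near_pair_ball (R : realType) (V : normedModType R) (x : V) (P : V * V -> Prop) :
  (\forall z \near (x, x), P z) ->
  exists2 d, 0 < d & forall r s, `|r - x| <= d -> `|s - x| <= d -> P (r, s).
Proof.
move=> [[A B] /= [/nbhs_ballP[a /= a0 hA] /nbhs_ballP[b /= b0 hB]] AB].
exists (Num.min a b / 2); first by rewrite divr_gt0 // lt_min a0.
have ab : Num.min a b / 2 < Num.min a b by rewrite ltr_pdivrMr // ltr_pMr ?ltr1n // lt_min a0.
move=> r s hr hs; apply: AB; split => /=.
  apply: hA; rewrite -ball_normE /ball_ /= distrC; apply: le_lt_trans hr _.
  by apply: lt_le_trans ab _; rewrite ge_min lexx.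
apply: hB; rewrite -ball_normE /ball_ /= distrC; apply: le_lt_trans hs _.
by apply: lt_le_trans ab _; rewrite ge_min lexx orbT.
Qed.

Section linear_forms.
Variables (R : realType) (N : nat).
Implicit Types (L : 'rV[R]_N -> R).

Definition linear_form L := forall a u v, L (a *: u + v) = a * L u + L v.

Lemma linear_form_coord i : linear_form (fun u => u 0 i).
Proof. by move=> a u v; rewrite !mxE. Qed.

Lemma linear_formZ c L : linear_form L -> linear_form (fun u => c * L u).
Proof. by move=> h a u v; rewrite h; ring. Qed.

Lemma linear_form_sum (I : finType) (P : pred I) (L : I -> 'rV[R]_N -> R) :
  (forall i, P i -> linear_form (L i)) -> linear_form (fun u => \sum_(i | P i) L i u).
Proof.
move=> h a u v; rewrite mulr_sumr -big_split /=.
by apply: eq_bigr => i Pi; rewrite h.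
Qed.

Lemma linear_form_dcurv (K : {set {set 'I_N}}) r i : linear_form (dcurv K r i).
Proof.
have h m : linear_form (dbend r m) by apply: linear_formZ; exact: linear_form_coord.
have hf t m : linear_form (dface r t m).
  rewrite /dface => a u v.
  have h1 : linear_form (fun u => \sum_(j in t) dbend r j u).
    by apply: linear_form_sum => j _.
  have h2 : linear_form (fun u => \sum_(j in t) face_slope r t j * dbend r j u).
    by apply: linear_form_sum => j _; exact: linear_formZ.
  by rewrite h1 h2 h; ring.
move=> a u v; rewrite /dcurv.
have hS : linear_form (fun u => \sum_(t in tetrahedra K | i \in t)
   (angle_unit R * (2 * \sum_(m in t | m != i) dface r t m u))).
  apply: linear_form_sum => t _; apply: linear_formZ; apply: linear_formZ.
  by apply: linear_form_sum => m _.
by rewrite hS; ring.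
Qed.

Lemma linear_form_continuous L : linear_form L -> continuous L.
Proof.
move=> h.
have -> : L = fun u => \sum_i L (delta_mx 0 i) * u 0 i.
  apply/funext => u; rewrite {1}(row_sum_delta u).
  have L0 : L 0 = 0.
    by have := h 1 0 0; rewrite scale1r addr0 mul1r => /eqP; rewrite -subr_eq0 opprD addrA subrr add0r oppr_eq0 => /eqP.
  elim/big_rec2 : _ => [//|i y x _ <-].
  by rewrite h mulrC.
move=> x; rewrite -fct_sumE; elim/big_ind : _ => [|a b ca cb|m _].
- exact: cst_continuous.
- exact: continuousD.
- by apply: continuousM; [exact: cst_continuous|exact: coord_continuous].
Qed.

(** The constant is the minimum of q on the compact unit sphere, which is empty when N = 0. *)
Lemma quadratic_lower_bound (q : 'rV[R]_N -> R) : continuous q ->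
  (forall k u, q (k *: u) = k ^+ 2 * q u) -> (forall u, u != 0 -> 0 < q u) ->
  exists2 l, 0 < l & forall u, l * `|u| ^+ 2 <= q u.
Proof.
move=> cq qZ q0.
have qq0 : q 0 = 0 by have := qZ 0 0; rewrite scale0r expr0n mul0r.
pose S : set 'rV[R]_N := [set u | `|u| = 1].
have [[v Sv]|nS] := pselect (S !=set0).
  have cS : compact S.
    apply: bounded_closed_compact.
      exists 1; split; first exact: num_real.
      by move=> x x1 u Su; rewrite /= (Su : `|u| = 1); exact: ltW.
    have -> : S = (fun u : 'rV[R]_N => `|u|) @^-1` [set 1] by [].
    apply: closed_comp; last exact: closed_eq.
    by move=> u _; exact: norm_continuous.
  have [m Sm hm] := EVT_min_rV (ex_intro _ v Sv) cS (continuous_subspaceT cq).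
  have m0 : m != 0 by apply/eqP => e; move: Sm; rewrite inE /S /= e normr0 => /esym/eqP; rewrite oner_eq0.
  exists (q m); first exact: q0.
  move=> u; have [->|u0] := eqVneq u 0; first by rewrite normr0 expr0n mulr0 qq0.
  have nu : `|u| != 0 by rewrite normr_eq0.
  have Su : `|u|^-1 *: u \in S.
    by rewrite inE /S /= normrZ normfV normr_id mulVf.
  have := hm _ Su; rewrite qZ => h.
  have n2 : 0 < `|u| ^+ 2 by rewrite exprn_gt0 // lt_neqAle eq_sym nu normr_ge0.
  by rewrite -ler_pdivlMr // mulrC -exprVn.
exists 1 => // u; have [->|u0] := eqVneq u 0; first by rewrite normr0 expr0n mulr0 qq0.
exfalso; apply: nS; exists (`|u|^-1 *: u).
by rewrite /S /= normrZ normfV normr_id mulVf // normr_eq0.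
Qed.

End linear_forms.

Section flow_field.
Variables (R : realType) (N : nat) (K : {set {set 'I_N}}).
Implicit Types (r s u : 'rV[R]_N).

(** The right-hand side of the flow with R_i r_i^2 = K_i substituted; [radius_speed] follows from it
    by the chain rule for r_i^2. *)
Definition metric_speed r i : R :=
  average_curv K r * r 0 i ^+ 2 - curvK K r i.

Definition radius_speed r i : R := metric_speed r i / (2 * r 0 i).

(** To leading order the weights cancel the division by 2 r_i in [radius_speed], so that the form
    u.Lu appears unweighted in the derivative. *)
Definition weighted_dist (x r : 'rV[R]_N) : R := \sum_i x 0 i * (r 0 i - x 0 i) ^+ 2.

Lemma exists_positive_lower_bound (x : 'rV[R]_N) : (forall i, 0 < x 0 i) ->
  exists2 m, 0 < m & forall i, m <= x 0 i.
Proof.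
move=> x0; exists (\big[Num.min/1]_i x 0 i).
  by elim/big_ind : _ => // a b a0 b0; rewrite lt_min a0.
by move=> i; exact: bigmin_le_cond.
Qed.

Variables (x : 'rV[R]_N) (c : R).
Hypotheses (xK : packing_metric K x) (x1 : sphere3 x) (c0 : c <= 0).
Hypothesis xc : forall i, curvK K x i = c * x 0 i ^+ 2.
Hypothesis simplexwise : forall w : 'I_N -> R,
  (forall t, t \in tetrahedra K -> forall i j, i \in t -> j \in t -> w i = w j) ->
  forall i j, w i = w j.

Let x0 i : 0 < x 0 i. Proof. by case: xK. Qed.

Let average_x : average_curv K x = c.
Proof.
rewrite /average_curv x1 divr1; under eq_bigr do rewrite xc.
rewrite (eq_bigr (fun i => c * x 0 i ^+ 3)) => [|i _]; last by ring.
by rewrite -mulr_sumr x1 mulr1.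
Qed.

Lemma metric_speed_at i : metric_speed x i = 0.
Proof. by rewrite /metric_speed average_x xc subrr. Qed.

Lemma radius_speed_at i : radius_speed x i = 0.
Proof. by rewrite /radius_speed metric_speed_at mul0r. Qed.

(* The last term is the squared differential of the constraint sphere3: it is
   of order 4 along the flow, and makes the form definite on the whole space. *)
Let q u : R := \sum_i u 0 i * dcurv K x i u
  - 2 * c * (\sum_i x 0 i * u 0 i ^+ 2) + (\sum_i x 0 i ^+ 2 * u 0 i) ^+ 2.

Let qE : exists2 l, 0 < l & forall u, l * `|u| ^+ 2 <= q u.
Proof.
have coordc i : continuous (fun u : 'rV[R]_N => u 0 i) by exact: coord_continuous.
have sumc (f : 'I_N -> 'rV[R]_N -> R) : (forall i, continuous (f i)) ->
    continuous (fun u => \sum_i f i u).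
  move=> cf y; rewrite -fct_sumE; elim/big_ind : _ => [|a b ca cb|m _].
  - exact: cst_continuous.
  - exact: continuousD.
  - exact: cf.
apply: quadratic_lower_bound.
- have contD (f g : 'rV[R]_N -> R) : continuous f -> continuous g ->
      continuous (fun u => f u + g u).
    by move=> cf cg y; exact: (continuousD (cf y) (cg y)).
  have contB (f g : 'rV[R]_N -> R) : continuous f -> continuous g ->
      continuous (fun u => f u - g u).
    by move=> cf cg y; exact: (continuousB (cf y) (cg y)).
  have contM (f g : 'rV[R]_N -> R) : continuous f -> continuous g ->
      continuous (fun u => f u * g u).
    by move=> cf cg y; exact: (continuousM (cf y) (cg y)).
  have contC (a : R) : continuous (fun _ : 'rV[R]_N => a) by move=> y; exact: cst_continuous.
  have h : continuous (fun u : 'rV[R]_N => \sum_i x 0 i ^+ 2 * u 0 i).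
    by apply: (sumc) => i; apply: (contM).
  apply: (contD); last by apply: (contM).
  apply: (contB).
    apply: (sumc) => i; apply: (contM) => //.
    exact: (linear_form_continuous (@linear_form_dcurv _ _ K x i)).
  apply: (contM) => //; apply: (sumc) => i; apply: (contM) => //.
  by apply: (contM).
- move=> k u; rewrite /q.
  have dZ i : dcurv K x i (k *: u) = k * dcurv K x i u.
    have h := @linear_form_dcurv R N K x i.
    have h0 : dcurv K x i 0 = 0.
      by have := h 1 0 0; rewrite scale1r addr0 mul1r; lra.
    by have := h k u 0; rewrite addr0 h0 addr0.
  rewrite (eq_bigr (fun i => k ^+ 2 * (u 0 i * dcurv K x i u))); last first.
    by move=> i _; rewrite dZ mxE; ring.
  rewrite [X in _ - _ * X](eq_bigr (fun i => k ^+ 2 * (x 0 i * u 0 i ^+ 2))); last first.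
    by move=> i _; rewrite mxE; ring.
  rewrite [X in _ + X ^+ 2](eq_bigr (fun i => k * (x 0 i ^+ 2 * u 0 i))); last first.
    by move=> i _; rewrite mxE; ring.
  by rewrite -!mulr_sumr; ring.
move=> u; apply: contra_neqP => /negP; rewrite -leNgt /q.
have [h1 h2] := dcurv_form u xK.
have h3 : 0 <= - 2 * c * (\sum_i x 0 i * u 0 i ^+ 2).
  rewrite mulr_ge0 ?sumr_ge0 //; last by move=> i _; rewrite mulr_ge0 ?sqr_ge0 // ltW.
  by have := c0; lra.
have h4 := sqr_ge0 (\sum_i x 0 i ^+ 2 * u 0 i).
move=> h5.
have e1 : \sum_i u 0 i * dcurv K x i u = 0 by lra.
have e2 : (\sum_i x 0 i ^+ 2 * u 0 i) ^+ 2 = 0 by lra.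
(* Since c may be 0, the middle term gives no information. The first makes u proportional to x, and
   the constraint term, where x pairs to the sum of the x_i^3, makes the factor vanish. *)
have w : forall i j, u 0 i / x 0 i = u 0 j / x 0 j.
  apply: simplexwise => t tK i j it jt; have [a ha] := h2 e1 t tK.
  by rewrite !ha // !mulfK // gt_eqF.
apply/rowP => i; rewrite mxE.
have uE j : u 0 j = u 0 i / x 0 i * x 0 j by rewrite (w i j) divfK // gt_eqF.
move/eqP: e2; rewrite sqrf_eq0 (eq_bigr (fun j => u 0 i / x 0 i * x 0 j ^+ 3)).
  rewrite -mulr_sumr x1 mulr1 mulf_eq0 invr_eq0 (gt_eqF (x0 i)) orbF => /eqP //.
by move=> j _; rewrite {1}uE; ring.
Qed.

(** The linearised [metric_speed]. The differential D of the average curvature stays abstract: it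
    will only be multiplied by the sum of x_i^2 u_i, which is of second order on the constraint
    surface. *)
Let dL (D : 'rV[R]_N -> R) i u : R :=
  D u * x 0 i ^+ 2 + 2 * c * x 0 i * u 0 i - dcurv K x i u.

Let speed_diff : exists2 D : 'rV[R]_N -> R,
  (exists C, forall v, `|D v| <= C * `|v|) &
  forall i, strict_diff (fun r => metric_speed r i) x (dL D i) /\
    strict_diff (fun r => radius_speed r i) x (fun u => dL D i u / (2 * x 0 i)).
Proof.
have hK i := strict_diff_curvK i xK.
have hc i := strict_diff_coord x i.
have h1 := @strict_diff_sum _ _ _ predT _ _ x (fun i (_ : true) => strict_diffM (hK i) (hc i)).
have h2 := @strict_diff_sum _ _ _ predT _ _ x (fun i (_ : true) =>
  strict_diffM (hc i) (strict_diffM (hc i) (hc i))).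
have n0 : \sum_i x 0 i * (x 0 i * x 0 i) != 0.
  rewrite (eq_bigr (fun i => x 0 i ^+ 3)) => [|i _]; last by ring.
  by rewrite x1 oner_eq0.
have h3 := strict_diff_comp h2 (strict_inv n0).
have h4 := strict_diffM h1 h3.
set D := (X in strict_diff _ _ X) in h4.
have hA : strict_diff (average_curv K) x D.
  apply: strict_diff_ext h4; near=> r; rewrite /average_curv; congr (_ / _).
exists D; first by case: hA.
move=> i.
have hm : strict_diff (fun r => metric_speed r i) x (dL D i).
  have h5 := strict_diffB (strict_diffM hA (strict_diffM (hc i) (hc i))) (hK i).
  have h6 : strict_diff (fun r => metric_speed r i) x
    (fun v => average_curv K x * (x 0 i * v 0 i + x 0 i * v 0 i) + x 0 i * x 0 i * D v - dcurv K x i v).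
    by apply: strict_diff_ext h5; near=> r; rewrite /metric_speed expr2.
  apply: strict_diff_extL h6 => v; rewrite average_x /dL; ring.
split => //.
have n2 : 2 * x 0 i != 0 by rewrite mulf_neq0 // gt_eqF.
have := strict_diffM hm (strict_diff_comp (strict_diffZ 2 (hc i)) (strict_inv n2)).
by apply: strict_diff_extL => v; rewrite metric_speed_at mul0r add0r mulrC.
Unshelve. all: by end_near. Qed.

Let X := \sum_i x 0 i.
Let X0 : 0 <= X. Proof. by apply: sumr_ge0 => i _; exact: ltW. Qed.

Lemma weighted_dist_le r : weighted_dist x r <= X * `|r - x| ^+ 2.
Proof.
rewrite /weighted_dist /X mulr_suml; apply: ler_sum => i _.
rewrite ler_wpM2l ?(ltW (x0 i)) // -real_normK ?num_real //.
by rewrite ler_pXn2r ?nnegrE // coord_dist_le_norm.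
Qed.

(** Expanding the cubes of x + u, the constraint says that the first order term is minus the sum of
    the x_i u_i^2 + u_i^3 / 3; for |u| <= 1 the cubic part is dominated by a square. *)
Let sphere_chord r : sphere3 r -> `|r - x| <= 1 ->
  `|\sum_i x 0 i ^+ 2 * (r - x) 0 i| <= (X + N%:R) * `|r - x| ^+ 2.
Proof.
move=> r1 rx.
have E : \sum_i x 0 i ^+ 2 * (r - x) 0 i =
    - \sum_i (x 0 i * (r - x) 0 i ^+ 2 + (r - x) 0 i ^+ 3 / 3).
  apply/eqP; rewrite -subr_eq0 opprK -big_split /=; apply/eqP.
  have Z : (\sum_i r 0 i ^+ 3 - \sum_i x 0 i ^+ 3) / 3 = 0 by rewrite r1 x1 subrr mul0r.
  by rewrite -[RHS]Z -sumrB mulr_suml; apply: eq_bigr => i _; rewrite !mxE; field.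
rewrite E normrN; apply: le_trans (ler_norm_sum _ _ _) _.
have -> : (X + N%:R) * `|r - x| ^+ 2 = \sum_i (x 0 i * `|r - x| ^+ 2 + `|r - x| ^+ 2).
  rewrite big_split /= -mulr_suml sumr_const card_ord -/X -[_ *+ N]mulr_natl; ring.
apply: ler_sum => i _; apply: le_trans (ler_normD _ _) _.
have ui := coord_le_norm (r - x) i; move: ((r - x) 0 i) ui => a ua.
have ua2 : `|a| ^+ 2 <= `|r - x| ^+ 2 by rewrite ler_pXn2r ?nnegrE.
apply: lerD.
  by rewrite normrM (gtr0_norm (x0 i)) normrX ler_wpM2l // ltW.
rewrite normrM normrX normfV (gtr0_norm (_ : 0 < 3)) //.
rewrite ler_pdivrMr // exprS; have := normr_ge0 a; have := sqr_ge0 `|a|.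
have : `|a| * `|a| ^+ 2 <= 1 * `|a| ^+ 2 by rewrite ler_wpM2r ?sqr_ge0 // (le_trans ua).
by lra.
Qed.

Lemma local_estimates : exists rho C mu : R, [/\ 0 < rho, 0 < C, 0 < mu,
    forall r, `|r - x| <= rho -> packing_metric K r &
    [/\ forall r i, `|r - x| <= rho -> x 0 i / 2 <= r 0 i,
     forall r s i, `|r - x| <= rho -> `|s - x| <= rho ->
      `|metric_speed r i - metric_speed s i| <= C * `|r - s|,
     forall r s i, `|r - x| <= rho -> `|s - x| <= rho ->
      `|radius_speed r i - radius_speed s i| <= C * `|r - s| &
     forall r, `|r - x| <= rho -> sphere3 r ->
      \sum_i x 0 i * (2 * (r 0 i - x 0 i) * radius_speed r i) <= - mu * weighted_dist x r]].
Proof.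
have [l l0 hl] := qE.
have [D [C3 hD] hd] := speed_diff.
(* The bound l |u|^2 of [q] is spent in quarters: [e], [d5] and [d6] limit the linearisation error,
   the term D u * s1 and the term s1^2 to l / 4 |u|^2 each, and the last quarter dominates mu W. *)
pose e := l / (8 * (X + 1)).
have e0 : 0 < e by rewrite divr_gt0 // mulr_gt0 // ltr_wpDl.
have pos_max (f : 'I_N -> R) : (forall i, 0 <= f i) -> forall i, f i <= \sum_j f j.
  by move=> f0 i; rewrite (bigD1 i) //= lerDl sumr_ge0.
have lipm i := strict_diff_lip (hd i).1.
have lipr i := strict_diff_lip (hd i).2.
have C1E : exists2 C1, 0 <= C1 & \forall z \near (x, x), forall i,
    `|metric_speed z.1 i - metric_speed z.2 i| <= C1 * `|z.1 - z.2|.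
  have [C1 hC1] := choice (fun i => let: ex_intro2 a b d := lipm i in
    ex_intro (fun a => 0 <= a /\ \forall z \near (x, x), `|metric_speed z.1 i - metric_speed z.2 i| <= a * `|z.1 - z.2|) a (conj b d)).
  exists (\sum_i C1 i); first by apply: sumr_ge0 => i _; exact: (hC1 i).1.
  apply: (@filter_forall _ _ (fun i (z : 'rV[R]_N * 'rV[R]_N) => `|metric_speed z.1 i - metric_speed z.2 i| <= (\sum_i C1 i) * `|z.1 - z.2|) (nbhs (x, x))) => i.
  apply: filterS (hC1 i).2 => z h; apply: le_trans h _; rewrite ler_wpM2r //.
  by apply: pos_max => j; exact: (hC1 j).1.
have C2E : exists2 C1, 0 <= C1 & \forall z \near (x, x), forall i,
    `|radius_speed z.1 i - radius_speed z.2 i| <= C1 * `|z.1 - z.2|.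
  have [C1 hC1] := choice (fun i => let: ex_intro2 a b d := lipr i in
    ex_intro (fun a => 0 <= a /\ \forall z \near (x, x), `|radius_speed z.1 i - radius_speed z.2 i| <= a * `|z.1 - z.2|) a (conj b d)).
  exists (\sum_i C1 i); first by apply: sumr_ge0 => i _; exact: (hC1 i).1.
  apply: (@filter_forall _ _ (fun i (z : 'rV[R]_N * 'rV[R]_N) => `|radius_speed z.1 i - radius_speed z.2 i| <= (\sum_i C1 i) * `|z.1 - z.2|) (nbhs (x, x))) => i.
  apply: filterS (hC1 i).2 => z h; apply: le_trans h _; rewrite ler_wpM2r //.
  by apply: pos_max => j; exact: (hC1 j).1.
have [C1 C1_ge0 /near_pair_ball[d1 d1_gt0 hC1]] := C1E.
have [C2 C2_ge0 /near_pair_ball[d2 d2_gt0 hC2]] := C2E.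
have : \forall z \near (x, x), forall i, `|radius_speed z.1 i - radius_speed z.2 i -
     dL D i (z.1 - z.2) / (2 * x 0 i)| <= e * `|z.1 - z.2|.
  apply: (@filter_forall _ _ (fun i (z : 'rV[R]_N * 'rV[R]_N) => `|radius_speed z.1 i - radius_speed z.2 i -
     dL D i (z.1 - z.2) / (2 * x 0 i)| <= e * `|z.1 - z.2|) (nbhs (x, x))) => i.
  by have [_ [_ h]] := hd i; exact: h.
move=> /near_pair_ball[d3 d3_gt0 hE].
have [d4 d4_gt0 hP] := near_pair_ball (near_pair1 (near_packing_metric xK)).
have [m m0 hm] := exists_positive_lower_bound x0.
pose XN := X + N%:R.
have XN0 : 0 <= XN by rewrite addr_ge0.
pose d5 := l / (4 * (`|C3| * XN + 1)).
have k5 : 0 < `|C3| * XN + 1 by rewrite ltr_wpDl // mulr_ge0.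
have d5_gt0 : 0 < d5 by rewrite divr_gt0 // mulr_gt0.
pose d6 := l / (4 * (XN ^+ 2 + 1)).
have k6 : 0 < XN ^+ 2 + 1 by rewrite ltr_wpDl // sqr_ge0.
have d6_gt0 : 0 < d6 by rewrite divr_gt0 // mulr_gt0.
have [rho [rho0 [[g1 g2 g3 g4] [g5 g6 g7 g8]]]] : exists rho, 0 < rho /\ [/\ [/\ rho <= d1, rho <= d2, rho <= d3 & rho <= d4] &
   [/\ rho <= d5, rho <= d6, rho <= 1 & rho <= m / 2]].
  exists (Num.min (Num.min (Num.min d1 d2) (Num.min d3 d4)) (Num.min (Num.min d5 d6) (Num.min 1 (m / 2)))).
  by rewrite !lt_min !ge_min !lexx ?orbT d1_gt0 d2_gt0 d3_gt0 d4_gt0 d5_gt0 d6_gt0 ltr01 divr_gt0.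
exists rho, (C1 + C2 + 1), (l / (4 * (X + 1))); split => //.
- by rewrite ltr_wpDl // addr_ge0.
- by rewrite divr_gt0 // mulr_gt0 // ltr_wpDl.
- by move=> r hr; have [] := hP r r (le_trans hr g4) (le_trans hr g4).
split.
- move=> r i hr; have := coord_dist_le_norm r x i; rewrite ler_norml => /andP[h _].
  by have := hm i; have := g8; lra.
- move=> r s i hr hs; apply: le_trans (hC1 r s (le_trans hr g1) (le_trans hs g1) i) _.
  by rewrite ler_wpM2r //=; lra.
- move=> r s i hr hs; apply: le_trans (hC2 r s (le_trans hr g2) (le_trans hs g2) i) _.
  by rewrite ler_wpM2r //=; lra.
move=> r hr r1.
set u := r - x; have u0 : 0 <= `|u| by [].
have xx : `|x - x| <= d3 by rewrite subrr normr0 ltW.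
pose err i := radius_speed r i - dL D i u / (2 * x 0 i).
have herr i : `|err i| <= e * `|u|.
  have := hE r x (le_trans hr g3) xx i; rewrite /= radius_speed_at subr0 //.
set s1 := \sum_i x 0 i ^+ 2 * u 0 i.
have hs1 : `|s1| <= XN * `|u| ^+ 2 by apply: sphere_chord => //; exact: le_trans hr g7.
(* [s1 ^+ 2] is added back because [q] contains it. *)
have E : \sum_i x 0 i * (2 * (r 0 i - x 0 i) * radius_speed r i) =
   D u * s1 - q u + s1 ^+ 2 + \sum_i 2 * x 0 i * u 0 i * err i.
  rewrite (eq_bigr (fun i => D u * (x 0 i ^+ 2 * u 0 i) + 2 * c * (x 0 i * u 0 i ^+ 2)
     - u 0 i * dcurv K x i u + 2 * x 0 i * u 0 i * err i)); last first.
    move=> i _; rewrite /err /dL {1 2 3 5}/u !mxE.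
    by field; rewrite gt_eqF.
  rewrite big_split /= sumrB big_split /= -!mulr_sumr -/s1 /q -/s1; ring.
have hsum : \sum_i 2 * x 0 i * u 0 i * err i <= l / 4 * `|u| ^+ 2.
  apply: (@le_trans _ _ (\sum_i x 0 i * (2 * e * `|u| ^+ 2))).
    apply: ler_sum => i _; apply: le_trans (ler_norm _) _.
    rewrite !normrM (gtr0_norm (x0 i)) (gtr0_norm (_ : 0 < 2)) //.
    have -> : 2 * x 0 i * `|u 0 i| * `|err i| = x 0 i * (2 * (`|u 0 i| * `|err i|)) by ring.
    rewrite ler_wpM2l ?(ltW (x0 i)) // -mulrA ler_wpM2l //.
    have -> : e * `|u| ^+ 2 = `|u| * (e * `|u|) by ring.
    by apply: ler_pM => //; exact: coord_le_norm.
  rewrite -mulr_suml -/X mulrA ler_wpM2r ?sqr_ge0 // /e.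
  have -> : X * (2 * (l / (8 * (X + 1)))) = l / 4 * (X / (X + 1)) by field; rewrite gt_eqF // ltr_wpDl.
  by rewrite ler_piMr ?(ltW (divr_gt0 _ _)) // ler_pdivrMr ?ltr_wpDl // mul1r lerDl.
have hDs : D u * s1 <= l / 4 * `|u| ^+ 2.
  apply: le_trans (ler_norm _) _; rewrite normrM.
  apply: (@le_trans _ _ ((`|C3| * `|u|) * (XN * `|u| ^+ 2))).
    apply: ler_pM => //; apply: le_trans (hD _) _; rewrite ler_wpM2r //; exact: ler_norm.
  have -> : `|C3| * `|u| * (XN * `|u| ^+ 2) = (`|C3| * XN * `|u|) * `|u| ^+ 2 by ring.
  rewrite ler_wpM2r ?sqr_ge0 //.
  have : `|u| * (4 * (`|C3| * XN + 1)) <= l.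
    by rewrite -ler_pdivlMr ?mulr_gt0 //; exact: le_trans hr g5.
  have -> : `|u| * (4 * (`|C3| * XN + 1)) = 4 * (`|C3| * XN * `|u|) + 4 * `|u| by ring.
  by move: (`|C3| * XN * `|u|) `|u| u0 => k v v0 h; lra.
have hss : s1 ^+ 2 <= l / 4 * `|u| ^+ 2.
  rewrite -real_normK ?num_real //; apply: (@le_trans _ _ ((XN * `|u| ^+ 2) ^+ 2)).
    by rewrite ler_pXn2r ?nnegrE // mulr_ge0 ?sqr_ge0.
  have -> : (XN * `|u| ^+ 2) ^+ 2 = (XN ^+ 2 * `|u| ^+ 2) * `|u| ^+ 2 by ring.
  rewrite ler_wpM2r ?sqr_ge0 //.
  have : `|u| * (4 * (XN ^+ 2 + 1)) <= l.
    by rewrite -ler_pdivlMr ?mulr_gt0 //; exact: le_trans hr g6.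
  have : XN ^+ 2 * `|u| ^+ 2 <= XN ^+ 2 * `|u|.
    rewrite ler_wpM2l ?sqr_ge0 // expr2 ler_piMr //; exact: le_trans hr g7.
  have -> : `|u| * (4 * (XN ^+ 2 + 1)) = 4 * (XN ^+ 2 * `|u|) + 4 * `|u| by ring.
  by move: (XN ^+ 2 * `|u| ^+ 2) (XN ^+ 2 * `|u|) `|u| u0 => p k v v0 h1 h2; lra.
have hW : l / (4 * (X + 1)) * weighted_dist x r <= l / 4 * `|u| ^+ 2.
  apply: (@le_trans _ _ (l / (4 * (X + 1)) * (X * `|u| ^+ 2))).
    by rewrite ler_wpM2l ?weighted_dist_le // ltW // divr_gt0 // mulr_gt0 // ltr_wpDl.
  rewrite mulrA ler_wpM2r ?sqr_ge0 //.
  have -> : l / (4 * (X + 1)) * X = l / 4 * (X / (X + 1)) by field; rewrite gt_eqF // ltr_wpDl.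
  by rewrite ler_piMr ?(ltW (divr_gt0 _ _)) // ler_pdivrMr ?ltr_wpDl // mul1r lerDl.
by rewrite E; have := hl u; lra.
Qed.

End flow_field.

(** * Trapping, uniqueness and convergence *)

Section one_sided_derivative.
Variable R : realType.
Implicit Types (u : R -> R) (t l : R).

(** Both notions of derivative are brought to the same epsilon-delta form, in which they can be
    compared. *)
Lemma is_derive_epsP u t l : is_derive t (1 : R) u l <->
  forall e, 0 < e -> exists2 d, 0 < d & forall s, s != t -> `|s - t| < d ->
    `|l - (u s - u t) / (s - t)| <= e.
Proof.
pose q h := h^-1 *: ((u \o shift t) (h *: (1 : R)) - u t).
have qE s : s != t -> q (s - t) = (u s - u t) / (s - t).
  by move=> st; rewrite /q /GRing.scale /= mulr1 subrK mulrC.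
split.
  move=> [du <-] e e0.
  have /cvgrPdist_le /(_ e e0) [d /= d0 hd] : q h @[h --> 0^'] --> 'D_1 u t by exact: du.
  exists d => // s st sd; rewrite -qE //; apply: hd => /=.
    by rewrite sub0r normrN.
  by rewrite subr_eq0.
move=> h.
have ql : q h @[h --> 0^'] --> l.
  apply/cvgrPdist_le => e e0; have [d d0 hd] := h e e0.
  exists d => //= s /=; rewrite sub0r normrN => sd s0.
  have st : s + t != t by rewrite -subr_eq0 addrK.
  by have := hd (s + t) st; rewrite -qE // addrK; apply.
split; first by apply/cvg_ex; exists l.
by apply: cvg_lim => //.
Qed.

Lemma has_derivative_from0_epsP u t l : has_derivative_from0 u t l <->
  forall e, 0 < e -> exists2 d, 0 < d & forall s, 0 <= s -> s != t ->
    `|s - t| < d -> `|l - (u s - u t) / (s - t)| <= e.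
Proof.
split.
  move=> /cvgrPdist_le h e e0.
  have [d /= d0 hd] := h e e0; exists d => // s s0 st sd.
  by apply: hd => //=; rewrite distrC.
move=> h; apply/cvgrPdist_le => e e0; have [d d0 hd] := h e e0.
exists d => //= s sd st s0; apply: hd => //.
by rewrite distrC.
Qed.

Lemma is_derive_from0 u t l : is_derive t (1 : R) u l -> has_derivative_from0 u t l.
Proof.
move=> /is_derive_epsP h; apply/has_derivative_from0_epsP => e e0.
by have [d d0 hd] := h e e0; exists d => // s _; exact: hd.
Qed.

Lemma has_derivative_from0_is_derive u t l : 0 < t ->
  has_derivative_from0 u t l -> is_derive t (1 : R) u l.
Proof.
move=> t0 /has_derivative_from0_epsP h; apply/is_derive_epsP => e e0.
have [d d0 hd] := h e e0; exists (Num.min d t); first by rewrite lt_min d0.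
move=> s st; rewrite lt_min => /andP[sd sst]; apply: hd => //.
by move: sst; rewrite ltr_norml => /andP[]; lra.
Qed.

Lemma has_derivative_from0_continuous u t l : has_derivative_from0 u t l ->
  forall e, 0 < e -> exists2 d, 0 < d & forall s, 0 <= s -> `|s - t| < d ->
    `|u s - u t| <= e.
Proof.
move=> /has_derivative_from0_epsP h e e0; have [d d0 hd] := h 1 ltr01.
have l1 : 0 < `|l| + 1 by rewrite ltr_wpDl.
exists (Num.min d (e / (`|l| + 1))); first by rewrite lt_min d0 divr_gt0.
move=> s s0; rewrite lt_min => /andP[sd se].
have [->|st] := eqVneq s t; first by rewrite subrr normr0 ltW.
have hk := hd s s0 st sd; have st0 : s - t != 0 by rewrite subr_eq0.
rewrite -[leLHS](congr1 _ (divfK st0 (u s - u t))).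
move: ((u s - u t) / (s - t)) hk => k hk; rewrite normrM.
have kl : `|k| <= `|l| + 1.
  have -> : k = l - (l - k) by ring.
  by apply: le_trans (ler_normB _ _) _; rewrite lerD.
apply: (@le_trans _ _ ((`|l| + 1) * (e / (`|l| + 1)))).
  by apply: ler_pM => //; exact: ltW.
by rewrite mulrC divfK // gt_eqF.
Qed.

End one_sided_derivative.

Section clamp.
Variables (R : realType) (N : nat) (x : 'rV[R]_N) (rho : R).
Hypothesis rho0 : 0 < rho.

(** Projection onto the closed sup-norm ball about x. It does not increase distances, so composing
    the locally Lipschitz speed with it gives the globally bounded and Lipschitz field that
    [ode_exists] requires, unchanged inside the ball. *)
Definition clamp (r : 'rV[R]_N) : 'rV[R]_N :=
  \row_i Num.max (x 0 i - rho) (Num.min (x 0 i + rho) (r 0 i)).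

Lemma clamp_near r : `|clamp r - x| <= rho.
Proof.
apply: norm_le_coord => [|i]; first exact: ltW.
rewrite !mxE ler_norml.
have h1 : x 0 i - rho <= Num.max (x 0 i - rho) (Num.min (x 0 i + rho) (r 0 i)).
  by rewrite le_max lexx.
have h2 : Num.max (x 0 i - rho) (Num.min (x 0 i + rho) (r 0 i)) <= x 0 i + rho.
  rewrite ge_max ge_min lexx /= andbT.
  by have := rho0; lra.
by apply/andP; split; lra.
Qed.

Lemma clamp_id r : `|r - x| <= rho -> clamp r = r.
Proof.
move=> rx; apply/rowP => i; rewrite !mxE.
have := le_trans (coord_dist_le_norm r x i) rx; rewrite ler_norml => /andP[h1 h2].
rewrite min_r; last by lra.
by rewrite max_r //; lra.
Qed.

Lemma clamp_lip r s : `|clamp r - clamp s| <= `|r - s|.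
Proof.
apply: norm_le_coord => // i; apply: le_trans (coord_dist_le_norm r s i).
have min_lip (a p q : R) : `|Num.min a p - Num.min a q| <= `|p - q|.
  have := ler_norm (p - q); have := ler_norm (q - p); rewrite (distrC q) ler_norml.
  move: `|p - q| => n h1 h2.
  by have [?|?] := leP a p; have [?|?] := leP a q; apply/andP; split; lra.
have max_lip (a p q : R) : `|Num.max a p - Num.max a q| <= `|p - q|.
  have := ler_norm (p - q); have := ler_norm (q - p); rewrite (distrC q) ler_norml.
  move: `|p - q| => n h1 h2.
  by have [?|?] := leP a p; have [?|?] := leP a q; apply/andP; split; lra.
by rewrite !mxE; exact: le_trans (max_lip _ _ _) (min_lip _ _ _).
Qed.

End clamp.

Section scalar_helpers.
Variable R : realType.

Lemma is_derive_sum_fun (N : nat) (h : 'I_N -> R -> R) (dh : 'I_N -> R) (t : R) :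
  (forall i, is_derive t (1 : R) (h i) (dh i)) ->
  is_derive t (1 : R) (fun s => \sum_i h i s) (\sum_i dh i).
Proof.
move=> hd.
have -> : (fun s => \sum_i h i s) = \sum_i h i by apply/funext => s; rewrite fct_sumE.
exact: is_derive_sum.
Qed.

Lemma is_derive_mul_fun (f g : R -> R) (df dg t : R) :
  is_derive t (1 : R) f df -> is_derive t (1 : R) g dg ->
  is_derive t (1 : R) (fun s => f s * g s) (f t * dg + g t * df).
Proof. by move=> hf hg; exact: (is_deriveM hf hg). Qed.

Lemma is_derive_sub_fun (f g : R -> R) (df dg t : R) :
  is_derive t (1 : R) f df -> is_derive t (1 : R) g dg ->
  is_derive t (1 : R) (fun s => f s - g s) (df - dg).
Proof. by move=> hf hg; exact: (is_deriveB hf hg). Qed.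

Lemma is_derive_opp_fun (f : R -> R) (df t : R) :
  is_derive t (1 : R) f df -> is_derive t (1 : R) (fun s => - f s) (- df).
Proof. by move=> hf; exact: (is_deriveN hf). Qed.

(** Provides the limit step of [real_induction]. *)
Lemma left_limit_le (G : R -> R) (t l c : R) : 0 < t -> is_derive t (1 : R) G l ->
  (forall s, 0 <= s < t -> G s <= c) -> G t <= c.
Proof.
move=> t0 hG Gc; rewrite leNgt; apply/negP => cG.
have e0 : 0 < (G t - c) / 2 by rewrite divr_gt0 // subr_gt0.
have [d d0 hd] := has_derivative_from0_continuous (is_derive_from0 hG) e0.
pose s := Num.max 0 (t - d / 2).
have s0 : 0 <= s by rewrite le_max lexx.
have st : s < t by rewrite gt_max t0 /= ltrBlDr ltrDl divr_gt0.
have sd : t - d / 2 <= s by rewrite le_max lexx orbT.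
have := hd s s0; have := Gc s; rewrite s0 st => /(_ isT) Gs.
rewrite distrC ger0_norm ?subr_ge0 ?(ltW st) // => /(_ (ltac:(lra))).
by rewrite ler_norml => /andP[]; lra.
Qed.

Definition continuous_from0 (u : R -> R) (t : R) : Prop :=
  forall e, 0 < e -> exists2 d, 0 < d & forall s, 0 <= s -> `|s - t| < d ->
    `|u s - u t| <= e.

Lemma row_continuous_from0 (N : nat) (z : R -> 'rV[R]_N) (t : R) :
  (forall i, continuous_from0 (fun s => z s 0 i) t) ->
  forall e, 0 < e -> exists2 d, 0 < d & forall s, 0 <= s -> `|s - t| < d ->
    `|z s - z t| <= e.
Proof.
move=> h e e0.
have hd i : exists d, 0 < d /\ forall s, 0 <= s -> `|s - t| < d ->
    `|z s 0 i - z t 0 i| <= e.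
  by have [d d0 hd] := h i e e0; exists d.
pose d : 'rV[R]_N := \row_i projT1 (choice hd) i.
have dP i := projT2 (choice hd) i.
have [|m m0 hm] := @exists_positive_lower_bound _ _ d.
  by move=> i; rewrite mxE; exact: (dP i).1.
exists m => // s s0 st; apply: norm_le_coord => [|i]; first exact: ltW.
rewrite !mxE; apply: (dP i).2 => //; apply: lt_le_trans st _.
by have := hm i; rewrite mxE.
Qed.

Lemma continuous_from0_within (u : R -> R) (a b : R) : 0 <= a ->
  (forall p, a <= p <= b -> continuous_from0 u p) -> {within `[a, b], continuous u}.
Proof.
move=> a0 hu; apply/subspace_continuousP => p /=; rewrite in_itv /= => pab.
apply/cvgrPdist_le => e e0; have [d d0 hd] := hu p pab e e0.
exists d => //= s sd; rewrite in_itv /= => /andP[as_ sb].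
rewrite distrC; apply: hd; first exact: le_trans as_.
by rewrite distrC.
Qed.

Lemma sqr_dist_le (a b m : R) : 0 < m -> 0 <= a -> m <= b ->
  `|a - b| <= `|a ^+ 2 - b ^+ 2| / m.
Proof.
move=> m0 a0 mb; rewrite ler_pdivlMr // subr_sqr normrM ler_wpM2l //.
by rewrite ger0_norm; lra.
Qed.

End scalar_helpers.

(** * The trapped solution: existence, uniqueness and convergence *)

Section stability.
Variables (R : realType) (N : nat) (K : {set {set 'I_N}}).
Variables (x : 'rV[R]_N) (rho C mu : R).
Hypotheses (rho0 : 0 < rho) (C0 : 0 < C) (mu0 : 0 < mu).
Hypotheses (x0 : forall i, 0 < x 0 i) (x1 : sphere3 x).
Hypothesis speed_x : forall i, radius_speed K x i = 0.
Hypothesis near_packing : forall r, `|r - x| <= rho -> packing_metric K r.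
Hypothesis near_ge : forall (r : 'rV[R]_N) i, `|r - x| <= rho -> x 0 i / 2 <= r 0 i.
Hypothesis metric_lip : forall r s i, `|r - x| <= rho -> `|s - x| <= rho ->
  `|metric_speed K r i - metric_speed K s i| <= C * `|r - s|.
Hypothesis radius_lip : forall r s i, `|r - x| <= rho -> `|s - x| <= rho ->
  `|radius_speed K r i - radius_speed K s i| <= C * `|r - s|.
Hypothesis decay : forall r, `|r - x| <= rho -> sphere3 r ->
  \sum_i x 0 i * (2 * (r 0 i - x 0 i) * radius_speed K r i) <= - mu * weighted_dist x r.

Variable m : R.
Hypotheses (m0 : 0 < m) (hm : forall i, m <= x 0 i).

Let near_gt0 r i : `|r - x| <= rho -> 0 < r 0 i.
Proof. by move=> h; apply: lt_le_trans (near_ge i h); rewrite divr_gt0. Qed.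

Let norm_le_weighted r (w : R) : weighted_dist x r <= w -> `|r - x| <= Num.sqrt (w / m).
Proof.
move=> rw; apply: norm_le_coord => [|i]; first exact: sqrtr_ge0.
rewrite -sqrtr_sqr; apply: ler_wsqrtr; rewrite ler_pdivlMr //.
apply: le_trans rw; rewrite /weighted_dist (bigD1 i) //= mulrC !mxE.
apply: (@le_trans _ _ (x 0 i * (r 0 i - x 0 i) ^+ 2)).
  by rewrite ler_wpM2r ?sqr_ge0.
by rewrite lerDl sumr_ge0 // => j _; rewrite mulr_ge0 ?sqr_ge0 // ltW.
Qed.

Let sum_cube_gt0 r : `|r - x| <= rho -> 0 < \sum_i r 0 i ^+ 3.
Proof.
move=> rx; apply: (@lt_le_trans _ _ (\sum_i x 0 i ^+ 3 / 8)).
  by rewrite -mulr_suml x1 mul1r invr_gt0.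
apply: ler_sum => i _; have := near_ge i rx; have := x0 i.
move: (x 0 i) (r 0 i) => a b a0 ab.
have -> : a ^+ 3 / 8 = (a / 2) ^+ 3 by field.
by rewrite ler_pXn2r ?nnegrE //; lra.
Qed.

(** The average curvature is exactly the multiplier for which the sum of the r_i^3 is conserved. *)
Let speed_tangent r : `|r - x| <= rho ->
  \sum_i 3 * r 0 i ^+ 2 * radius_speed K r i = 0.
Proof.
move=> rx; have S0 := sum_cube_gt0 rx.
rewrite (eq_bigr (fun i => 3 / 2 * (average_curv K r * r 0 i ^+ 3 - curvK K r i * r 0 i))).
  rewrite -mulr_sumr sumrB -mulr_sumr /average_curv divfK ?gt_eqF //.
  by rewrite subrr mulr0.
move=> i _; rewrite /radius_speed /metric_speed; field.
by rewrite gt_eqF // near_gt0.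
Qed.

Variable r0 : 'rV[R]_N.
Hypotheses (r0_sphere : sphere3 r0) (r0_near : weighted_dist x r0 < m * rho ^+ 2).

Let w0 := weighted_dist x r0.

Let w0_ge0 : 0 <= w0.
Proof. by apply: sumr_ge0 => i _; rewrite mulr_ge0 ?sqr_ge0 // ltW. Qed.

(** The sublevel set W <= w0 lies in the ball of this radius. Being smaller than rho, it leaves a
    margin for the open step of the induction. *)
Let rad := Num.sqrt (w0 / m).

Let rad_lt : rad < rho.
Proof.
rewrite /rad -[ltRHS](ger0_norm (ltW rho0)) -sqrtr_sqr ltr_sqrt ?exprn_gt0 //.
by rewrite ltr_pdivrMr // mulrC.
Qed.

Let field_at (r : 'rV[R]_N) : 'rV[R]_N := \row_i radius_speed K (clamp x rho r) i.

Lemma exists_trapped_solution : exists z : R -> 'rV[R]_N, [/\ z 0 = r0,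
  forall t : R, 0 <= t -> forall i,
    is_derive t (1 : R) (fun s => z s 0 i) (radius_speed K (z t) i),
  forall t : R, 0 <= t -> `|z t - x| <= rad &
  forall t : R, 0 <= t -> weighted_dist x (z t) * expR (mu * t) <= w0].
Proof.
have FB r i : `|field_at r 0 i| <= C * rho.
  rewrite mxE; have := @radius_lip (clamp x rho r) x i (clamp_near x rho0 r).
  rewrite subrr normr0 speed_x subr0 => /(_ (ltW rho0)) h; apply: le_trans h _.
  by rewrite ler_wpM2l ?(ltW C0) // (clamp_near x rho0).
have FL r s i : `|field_at r 0 i - field_at s 0 i| <= C * `|r - s|.
  rewrite !mxE; apply: le_trans (radius_lip i (clamp_near x rho0 r) (clamp_near x rho0 s)) _.
  by rewrite ler_wpM2l ?(ltW C0) // clamp_lip.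
have [z [z0 zd]] := ode_exists r0 (mulr_ge0 (ltW C0) (ltW rho0)) C0 FB FL.
have fieldE r i : `|r - x| <= rho -> field_at r 0 i = radius_speed K r i.
  by move=> h; rewrite mxE clamp_id.
pose G t := weighted_dist x (z t) * expR (mu * t).
pose dW t := \sum_i x 0 i * (2 * (z t 0 i - x 0 i) * field_at (z t) 0 i).
have hG (t : R) : 0 <= t -> is_derive t (1 : R) G ((dW t + mu * weighted_dist x (z t)) * expR (mu * t)).
  move=> t0; rewrite /G.
  have hW : is_derive t (1 : R) (fun s => weighted_dist x (z s)) (dW t).
    rewrite /weighted_dist /dW; apply: is_derive_sum_fun => i.
    have h1 : is_derive t (1 : R) (fun s => z s 0 i - x 0 i) (field_at (z t) 0 i).
      have := is_deriveB (zd t t0 i) (is_derive_cst (x 0 i) t (1 : R)).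
      by rewrite subr0.
    have := is_derive_mul_fun (is_derive_cst (x 0 i) t (1 : R)) (is_derive_mul_fun h1 h1).
    by congr is_derive; rewrite /cst; ring.
  have hE : is_derive t (1 : R) (fun s => expR (mu * s)) (mu * expR (mu * t)).
    have := is_derive_expR_scale mu t (lt0r_neq0 mu0).
    by rewrite divff ?gt_eqF //; congr is_derive; apply/funext => s; rewrite mul1r.
  have := is_derive_mul_fun hW hE; congr is_derive; ring.
have hS (t : R) : 0 <= t -> is_derive t (1 : R) (fun s => \sum_i z s 0 i ^+ 3)
    (\sum_i 3 * z t 0 i ^+ 2 * field_at (z t) 0 i).
  move=> t0; apply: is_derive_sum_fun => i.
  have := is_derive_mul_fun (zd t t0 i) (is_derive_mul_fun (zd t t0 i) (zd t t0 i)).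
  congr is_derive; ring.
(* Bootstrap: P confines z to the ball of radius [rad]; by continuity z stays a little longer in the
   ball of radius rho, where the clamped field is the true one, and there tangency and decay extend
   P. *)
pose P t := G t <= w0 /\ sphere3 (z t).
have Prad (t : R) : 0 <= t -> P t -> `|z t - x| <= rad.
  move=> t0 [Gt _]; apply: norm_le_weighted; apply: le_trans Gt; rewrite /G.
  rewrite ler_peMr //; first by apply: sumr_ge0 => i _; rewrite mulr_ge0 ?sqr_ge0 // ltW.
  by apply: le_trans (expR_ge1Dx _); rewrite lerDl mulr_ge0 // ltW.
have PT : forall t : R, 0 <= t -> P t.
  apply: real_induction.
  - by rewrite /P /G z0 mulr0 expR0 mulr1.
  - move=> t t0 Pt.
    have e0 : 0 < rho - rad by rewrite subr_gt0.
    have zc i : continuous_from0 (fun s => z s 0 i) t.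
      exact: has_derivative_from0_continuous (is_derive_from0 (zd t t0 i)).
    have [d d0 hd] := row_continuous_from0 zc e0.
    have near s : t <= s <= t + d / 2 -> `|z s - x| <= rho.
      move=> /andP[ts std].
      have -> : z s - x = (z s - z t) + (z t - x) by rewrite addrA subrK.
      have zst : `|z s - z t| <= rho - rad.
        apply: hd; first exact: le_trans t0 ts.
        by rewrite ger0_norm ?subr_ge0 //; lra.
      apply: le_trans (ler_normD _ _) _.
      by have := Prad t t0 Pt; lra.
    exists (d / 2); first by rewrite divr_gt0.
    move=> s /andP[ts std].
    have sub p : t <= p <= s -> t <= p <= t + d / 2.
      by move=> /andP[-> ps] /=; exact: le_trans std.
    have sphere p : t <= p <= s -> sphere3 (z p).
      move=> /andP[tp ps].
      have := @derive_bound _ (fun s => \sum_i z s 0 i ^+ 3) (fun=> 0) (cst 0) (cst 0) t p tp.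
      rewrite subrr => h; rewrite /sphere3 /=.
      have : `|(\sum_i z p 0 i ^+ 3) - (\sum_i z t 0 i ^+ 3)| <= 0.
        apply: h => //.
          move=> y /andP[ty yp]; have y0 := le_trans t0 ty.
          have nx : `|z y - x| <= rho by apply: near; apply: sub; rewrite ty (le_trans yp).
          have := hS y y0; congr is_derive; rewrite -[RHS](speed_tangent nx).
          by apply: eq_bigr => i _; rewrite fieldE.
        by move=> *; rewrite normr0.
      by rewrite normr_le0 subr_eq0 => /eqP ->; exact: Pt.2.
    split; last by apply: sphere; rewrite ts lexx.
    apply: le_trans Pt.1; rewrite -lerN2.
    pose dG y := (dW y + mu * weighted_dist x (z y)) * expR (mu * y).
    have hNG (y : R) : t <= y -> is_derive y (1 : R) (fun y => - G y) (- dG y).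
      by move=> ty; apply: is_deriveN; exact: (hG y (le_trans t0 ty)).
    apply: (@le_of_derive_ge0 _ (fun y => - G y) (fun y => - dG y) t s ts).
    + apply: derivable_within_continuous => y; rewrite in_itv /= => /andP[ty _].
      by have [] := hNG y ty.
    + by move=> y /andP[/ltW ty _]; exact: hNG.
    move=> y /andP[/ltW ty /ltW ys]; rewrite /dG -mulNr mulr_ge0 ?expR_ge0 //.
    have tys : t <= y <= s by rewrite ty.
    have nx : `|z y - x| <= rho by apply: near; exact: sub.
    have := decay nx (sphere y tys); rewrite /dW.
    under eq_bigr do rewrite -fieldE //.
    by rewrite mulNr; lra.
  - move=> t t0 Pt; split.
      by apply: left_limit_le (hG t (ltW t0)) _ => // s /Pt [].
    have hSt := hS t (ltW t0).
    apply/eqP; rewrite eq_le; apply/andP; split.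
      by apply: left_limit_le hSt _ => // s /Pt [_ ->].
    rewrite -lerN2; apply: (@left_limit_le _ (fun s => - \sum_i z s 0 i ^+ 3) t _ (-1) t0 (is_deriveN hSt)).
    by move=> s /Pt [_ ->].
exists z; split => //.
- move=> t t0 i; have := zd t t0 i; rewrite fieldE //.
  exact: le_trans (Prad t t0 (PT t t0)) (ltW rad_lt).
- by move=> t t0; exact: Prad (PT t t0).
- by move=> t /PT [].
Qed.

Let rad_ge0 : 0 <= rad. Proof. exact: sqrtr_ge0. Qed.

Lemma metric_derivative (z : R -> 'rV[R]_N) (t : R) i : `|z t - x| <= rho ->
  is_derive t (1 : R) (fun s => z s 0 i) (radius_speed K (z t) i) ->
  is_derive t (1 : R) (fun s => z s 0 i ^+ 2) (metric_speed K (z t) i).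
Proof.
move=> zt h; have := is_derive_mul_fun h h; congr is_derive.
rewrite /radius_speed; field; by rewrite gt_eqF // near_gt0.
Qed.

Lemma metric_speed_curv (r : 'rV[R]_N) i : 0 < r 0 i ->
  (average_curv K r - scalar_curv K r i) * r 0 i ^+ 2 = metric_speed K r i.
Proof.
by move=> r_gt0; rewrite /scalar_curv /metric_speed; field; rewrite gt_eqF.
Qed.

(** A solution is only known through its squares, and may have any sign outside its interval of
    existence; continuity is therefore first obtained for the absolute value. *)
Lemma abs_continuous_from0 (u : R -> R) (t : R) : u t != 0 ->
  continuous_from0 (fun s => u s ^+ 2) t -> continuous_from0 (fun s => `|u s|) t.
Proof.
move=> ut h e e0; have a0 : 0 < `|u t| by rewrite normr_gt0.
have [d d0 hd] := h (e * `|u t|) (mulr_gt0 e0 a0).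
exists d => // s s0 st; apply: le_trans (sqr_dist_le a0 (normr_ge0 _) (lexx _)) _.
by rewrite !real_normK ?num_real // ler_pdivrMr // hd.
Qed.

Variable z : R -> 'rV[R]_N.
Hypothesis z_init : z 0 = r0.
Hypothesis z_derive : forall t : R, 0 <= t -> forall i,
  is_derive t (1 : R) (fun s => z s 0 i) (radius_speed K (z t) i).
Hypothesis z_near : forall t : R, 0 <= t -> `|z t - x| <= rad.

Let z_rho (t : R) : 0 <= t -> `|z t - x| <= rho.
Proof. by move=> t0; exact: le_trans (z_near t0) (ltW rad_lt). Qed.

Lemma trapped_solution : yamabe_solution K r0 +oo%E z.
Proof.
split=> // t t0 _; split; first exact: near_packing (z_rho t0).
move=> i; apply: is_derive_from0; rewrite metric_speed_curv ?near_gt0 ?z_rho //.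
exact: metric_derivative (z_rho t0) (z_derive t0 i).
Qed.

(** Gronwall's argument for E, the squared distance between the metrics r_i^2, whose derivatives the
    flow prescribes. Each induction step first keeps r' in the ball where the speeds are
    Lipschitz. *)
Lemma trapped_unique (T : \bar R) (r' : R -> 'rV[R]_N) :
  yamabe_solution K r0 T r' -> forall t, 0 <= t -> (t%:E < T)%E -> r' t = z t.
Proof.
move=> [r'0 r'P].
have r'_gt0 (t : R) i : 0 <= t -> (t%:E < T)%E -> 0 < r' t 0 i.
  by move=> t0 tT; have [[]] := r'P t t0 tT.
have r'_der (t : R) i : 0 <= t -> (t%:E < T)%E ->
    has_derivative_from0 (fun s => r' s 0 i ^+ 2) t (metric_speed K (r' t) i).
  move=> t0 tT; have [_ /(_ i)] := r'P t t0 tT.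
  by rewrite metric_speed_curv // r'_gt0.
apply: real_induction; first by rewrite r'0 z_init.
- move=> t t0 Pt.
  (* Beyond T the claim is vacuous. *)
  have [tT|Tt] := boolP (t%:E < T)%E; last first.
    exists 1 => // s /andP[ts _] sT; exfalso; move/negP: Tt; apply.
    by apply: le_lt_trans sT; rewrite lee_fin.
  have {Pt}rt := Pt tT.
  have [d1 d1_gt0 hd1] : exists2 d, 0 < d & forall s, s <= t + d -> (s%:E < T)%E.
    case: T tT {r'P r'_gt0 r'_der} => [T'| |//] tT; last by exists 1 => // s _; rewrite ltry.
    move: tT; rewrite lte_fin => tT; exists ((T' - t) / 2); first by rewrite divr_gt0 // subr_gt0.
    by move=> s st; rewrite lte_fin; lra.
  pose y s : 'rV[R]_N := \row_i `|r' s 0 i|.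
  have yE s : 0 <= s -> s <= t + d1 -> y s = r' s.
    move=> s0 st; apply/rowP => i; rewrite mxE gtr0_norm //.
    by apply: r'_gt0 => //; exact: hd1.
  have yc i : continuous_from0 (fun s => y s 0 i) t.
    have -> : (fun s => y s 0 i) = (fun s => `|r' s 0 i|) by apply/funext => s; rewrite mxE.
    apply: abs_continuous_from0; first by rewrite gt_eqF // r'_gt0.
    exact: has_derivative_from0_continuous (r'_der t i t0 tT).
  have e0 : 0 < rho - rad by rewrite subr_gt0.
  have [d2 d2_gt0 hd2] := row_continuous_from0 yc e0.
  pose d := Num.min d1 (d2 / 2).
  have d_gt0 : 0 < d by rewrite lt_min d1_gt0 divr_gt0.
  have dd1 : d <= d1 by rewrite ge_min lexx.
  have dd2 : d <= d2 / 2 by rewrite ge_min lexx orbT.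
  have r'_rho s : t <= s <= t + d -> `|r' s - x| <= rho.
    move=> /andP[ts sd]; have s0 := le_trans t0 ts.
    have tt1 : t <= t + d1 by rewrite lerDl ltW.
    have h : `|r' s - r' t| <= rho - rad.
      rewrite -(yE s s0) ?(le_trans sd) ?lerD2l // -(yE t t0 tt1).
      by apply: hd2 => //; rewrite ger0_norm ?subr_ge0 //; lra.
    have -> : r' s - x = (r' s - r' t) + (r' t - x) by rewrite addrA subrK.
    apply: le_trans (ler_normD _ _) _; rewrite [in X in _ + X]rt.
    by have := z_near t0; lra.
  exists d => // s /andP[ts sd] sT.
  have s0 := le_trans t0 ts.
  pose g p i := r' p 0 i ^+ 2 - z p 0 i ^+ 2.
  pose E p := \sum_i g p i ^+ 2.
  have E0 p : 0 <= E p by apply: sumr_ge0 => i _; exact: sqr_ge0.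
  pose dg p i := metric_speed K (r' p) i - metric_speed K (z p) i.
  (* Near x the sum of two radii is at least m, so |r' - z| <= sqrt E / m; each of the N coordinates
     then contributes at most 2 C / m * E to the derivative of E. *)
  pose k := N%:R * (2 * C / m).
  have gE p i : `|g p i| <= Num.sqrt (E p).
    rewrite -sqrtr_sqr; apply: ler_wsqrtr; rewrite /E (bigD1 i) //= lerDl.
    by apply: sumr_ge0 => j _; exact: sqr_ge0.
  have W p : t <= p <= s -> t <= p <= t + d.
    by move=> /andP[-> ps] /=; exact: le_trans sd.
  have pT p : t <= p <= s -> (p%:E < T)%E.
    by move=> /andP[_ ps]; apply: hd1; apply: le_trans ps _; apply: le_trans sd _; rewrite lerD2l.
  have dist p : t <= p <= s -> `|r' p - z p| <= Num.sqrt (E p) / m.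
    move=> tps; have p0 : 0 <= p by case/andP: tps => tp _; exact: le_trans tp.
    apply: norm_le_coord => [|i]; first by rewrite divr_ge0 ?sqrtr_ge0 // ltW.
    rewrite !mxE ler_pdivlMr //; apply: le_trans (gE p i).
    rewrite /g subr_sqr normrM ler_wpM2l //.
    have h1 := near_ge i (r'_rho p (W p tps)); have h2 := near_ge i (z_rho p0).
    have h3 := hm i; have h4 := x0 i; rewrite ger0_norm; lra.
  have dgE p i : t <= p <= s -> 2 * (g p i * dg p i) <= 2 * C / m * E p.
    move=> tps; have p0 : 0 <= p by case/andP: tps => tp _; exact: le_trans tp.
    have h1 := metric_lip i (r'_rho p (W p tps)) (z_rho p0).
    have -> : 2 * C / m * E p = 2 * (Num.sqrt (E p) * (C * (Num.sqrt (E p) / m))).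
      by rewrite -{1}(sqr_sqrtr (E0 p)); field; rewrite gt_eqF.
    rewrite ler_pM2l //; apply: le_trans (ler_norm _) _; rewrite normrM.
    apply: ler_pM => //; apply: le_trans h1 _.
    by rewrite ler_wpM2l ?dist // ltW.
  pose H p := - (E p * expR (- k * p)).
  pose dE p := \sum_i 2 * (g p i * dg p i).
  have hH p : t < p < s -> is_derive p (1 : R) H ((k * E p - dE p) * expR (- k * p)).
    move=> /andP[tp ps]; have p_gt0 : 0 < p by exact: le_lt_trans tp.
    have tps : t <= p <= s by rewrite !ltW.
    have hE : is_derive p (1 : R) E (dE p).
      apply: is_derive_sum_fun => i.
      have hr := has_derivative_from0_is_derive p_gt0 (r'_der p i (ltW p_gt0) (pT p tps)).
      have hz := metric_derivative (z_rho (ltW p_gt0)) (z_derive (ltW p_gt0) i).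
      have hg : is_derive p (1 : R) (fun q => g q i) (dg p i).
        exact: (is_derive_sub_fun hr hz).
      have := is_derive_mul_fun hg hg; congr is_derive; ring.
    have he : is_derive p (1 : R) (fun q => expR (- k * q)) (- k * expR (- k * p)).
      (* [is_derive_expR_scale] divides by the rate; k vanishes only when N = 0. *)
      have [k0|k0] := eqVneq k 0.
        have -> : (fun q => expR (- k * q)) = cst 1.
          by apply/funext => q; rewrite k0 oppr0 mul0r expR0.
        by rewrite k0 oppr0 mul0r; exact: is_derive_cst.
      have k0' : - k != 0 by rewrite oppr_eq0.
      have := is_derive_expR_scale (- k) p k0'.
      by rewrite divff //; congr is_derive; apply/funext => q; rewrite mul1r.
    have := is_derive_opp_fun (is_derive_mul_fun hE he); congr is_derive; ring.
  (* If t = 0, [r'] has only a right derivative there, so continuity up to the endpoints is proved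
     separately from differentiability inside. *)
  have cH : {within `[t, s], continuous H}.
    have cg i : {within `[t, s], continuous (fun p => g p i)}.
      have c1 : {within `[t, s], continuous (fun p => r' p 0 i ^+ 2)}.
        apply: continuous_from0_within => // p tps.
        have p0 : 0 <= p by case/andP: tps => tp _; exact: le_trans tp.
        exact: has_derivative_from0_continuous (r'_der p i p0 (pT p tps)).
      have c2 : {within `[t, s], continuous (fun p => z p 0 i ^+ 2)}.
        apply: derivable_within_continuous => p; rewrite in_itv /= => /andP[tp _].
        have p0 := le_trans t0 tp.
        by have [] := metric_derivative (z_rho p0) (z_derive p0 i).
      by move=> p; exact: (continuousB (c1 p) (c2 p)).
    have cE : {within `[t, s], continuous E}.
      have -> : E = \sum_i (fun p => g p i * g p i).
        by apply/funext => p; rewrite fct_sumE.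
      elim/big_ind : _ => [p|a b ca cb p|i _ p].
      - exact: cst_continuous.
      - exact: (continuousD (ca p) (cb p)).
      - exact: (continuousM (cg i p) (cg i p)).
    have ce : {within `[t, s], continuous (fun p => expR (- k * p))}.
      apply: continuous_subspaceT => p; apply: continuous_comp; last exact: continuous_expR.
      by apply: continuousM; [exact: cst_continuous|exact: id].
    by move=> p; exact: (continuousN (continuousM (cE p) (ce p))).
  have dH p : t < p < s -> 0 <= (k * E p - dE p) * expR (- k * p).
    move=> /andP[/ltW tp /ltW ps]; rewrite mulr_ge0 ?expR_ge0 // subr_ge0 /dE.
    apply: (@le_trans _ _ (\sum_(i < N) 2 * C / m * E p)).
      by apply: ler_sum => i _; apply: dgE; rewrite tp.
    by rewrite sumr_const card_ord -[_ *+ N]mulr_natl /k mulrA.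
  have := le_of_derive_ge0 ts cH hH dH.
  have -> : H t = 0.
    rewrite /H /E big1 ?mul0r ?oppr0 // => i _.
    by rewrite /g rt subrr expr0n.
  rewrite /H oppr_ge0 pmulr_lle0 ?expR_gt0 // => Es.
  apply/rowP => i.
  have /eqP : E s = 0 by apply/eqP; rewrite eq_le Es E0.
  rewrite /E psumr_eq0 => [|j _]; last exact: sqr_ge0.
  move=> /allP /(_ i (mem_index_enum _)) /=; rewrite sqrf_eq0 /g subr_eq0.
  rewrite eqrXn2 // => [/eqP //||]; apply: ltW; first exact: r'_gt0.
  exact: near_gt0 (z_rho s0).
- move=> t t0 Pt tT; have t0' := ltW t0.
  apply/rowP => i.
  have hr := has_derivative_from0_is_derive t0 (r'_der t i t0' tT).
  have hz := metric_derivative (z_rho t0') (z_derive t0' i).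
  have eq0 s : 0 <= s < t -> r' s 0 i ^+ 2 - z s 0 i ^+ 2 = 0.
    move=> s0t; rewrite (Pt s s0t) ?subrr //.
    by case/andP: s0t => _ st; apply: lt_trans tT; rewrite lte_fin.
  have h1 := left_limit_le t0 (is_derive_sub_fun hr hz) (fun s s0t => eq_ind_r (fun a => a <= 0) (lexx 0) (eq0 s s0t)).
  have h2 := left_limit_le t0 (is_derive_opp_fun (is_derive_sub_fun hr hz)) (c := 0).
  have : r' t 0 i ^+ 2 == z t 0 i ^+ 2.
    rewrite -subr_eq0 eq_le; apply/andP; split; first exact: h1.
    by rewrite -oppr_le0; apply: h2 => s s0t; rewrite (eq0 s s0t) oppr0.
  rewrite eqrXn2 // => [/eqP //||]; apply: ltW; first exact: r'_gt0.
  exact: near_gt0 (z_rho t0').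
Qed.

Hypothesis z_decay : forall t : R, 0 <= t ->
  weighted_dist x (z t) * expR (mu * t) <= w0.

Lemma trapped_cvg : z t @[t --> +oo] --> x.
Proof.
apply/cvgrPdist_le => e e0.
have me : 0 < m * e ^+ 2 by rewrite mulr_gt0 // exprn_gt0.
(* Past this time w0 / (mu t) < m e^2, which suffices because expR (mu t) >= mu t; the 1 keeps t
   positive. *)
exists (Num.max 1 (w0 / (mu * (m * e ^+ 2)))); split; first exact: num_real.
move=> t; rewrite gt_max => /andP[t1 tw].
have t_gt0 : 0 < t by exact: lt_trans t1.
rewrite distrC -[leRHS](ger0_norm (ltW e0)) -[leRHS]sqrtr_sqr.
rewrite (_ : e ^+ 2 = m * e ^+ 2 / m); last by field; rewrite gt_eqF.
apply: norm_le_weighted.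
have W0 : 0 <= weighted_dist x (z t).
  by apply: sumr_ge0 => i _; rewrite mulr_ge0 ?sqr_ge0 // ltW.
have h1 : weighted_dist x (z t) * (mu * t) <= w0.
  apply: le_trans (z_decay (ltW t_gt0)); rewrite ler_wpM2l //.
  by apply: le_trans (expR_ge1Dx _); rewrite lerDr.
have mt : 0 < mu * t by rewrite mulr_gt0.
rewrite -(ler_pM2r mt); apply: le_trans h1 _.
move: tw; rewrite ltr_pdivrMr ?mulr_gt0 // => /ltW h; apply: le_trans h _.
by rewrite le_eqVlt; apply/orP; left; apply/eqP; ring.
Qed.

End stability.

Theorem theorem1p8 (R : realType) (M : topologicalType) (N : nat)
    (K : {set {set 'I_N}}) (rstar : 'rV[R]_N)
    (M_manifold : manifold3 R M)
    (M_compact : compact [set: M])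
    (M_connected : connected [set: M])
    (K_triangulation : triangulation R M K)
    (rstar_metric : packing_metric K rstar)
    (rstar_sphere : sphere3 rstar)
    (rstar_curv : nonpositive_constant_curv K rstar) :
  exists2 eps : R, 0 < eps &
    forall r0 : 'rV[R]_N, packing_metric K r0 -> sphere3 r0 ->
      enorm (r0 - rstar) ^+ 2 < eps ->
      exists r : R -> 'rV[R]_N,
        [/\ yamabe_solution K r0 +oo%E r,
            forall (T : \bar R) (r' : R -> 'rV[R]_N),
              yamabe_solution K r0 T r' ->
              forall t : R, 0 <= t -> (t%:E < T)%E -> r' t = r t &
            r t @[t --> +oo] --> rstar].
Proof.
have [c c0 hc] := rstar_curv.
have x0 i : 0 < rstar 0 i by case: rstar_metric.
have xc i : curvK K rstar i = c * rstar 0 i ^+ 2.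
  by rewrite -(hc i) /scalar_curv divfK // expf_neq0 // gt_eqF.
have simplexwise w := @simplexwise_constant R M N K w M_connected K_triangulation.
have [rho [C [mu [rho0 C0 mu0 near_packing [near_ge metric_lip radius_lip decay]]]]] :=
  local_estimates rstar_metric rstar_sphere c0 xc simplexwise.
have speed_x := radius_speed_at rstar_sphere xc.
have [m m0 hm] := exists_positive_lower_bound x0.
pose X := \sum_i rstar 0 i.
have X0 : 0 <= X by apply: sumr_ge0 => i _; exact: ltW.
have X1 : 0 < X + 1 by rewrite ltr_wpDl.
(* Every weight x_i is at most X + 1, so W is at most X + 1 times the squared Euclidean distance and
   starts below m rho^2. *)
exists (m * rho ^+ 2 / (X + 1)); first by rewrite divr_gt0 // mulr_gt0 // exprn_gt0.
move=> r0 r0K r0S; rewrite ltr_pdivlMr // => r0e.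
have dist0 : weighted_dist rstar r0 < m * rho ^+ 2.
  apply: le_lt_trans r0e; rewrite /enorm sqr_sqrtr; last first.
    by apply: sumr_ge0 => i _; exact: sqr_ge0.
  rewrite mulr_suml; apply: ler_sum => i _; rewrite mulrC !mxE.
  rewrite ler_wpM2l ?sqr_ge0 // (le_trans (_ : _ <= X)) ?lerDl //.
  by rewrite /X (bigD1 i) //= lerDl sumr_ge0 // => j _; exact: ltW.
have [z [z0 zd znear zdecay]] := exists_trapped_solution rho0 C0 mu0 x0 rstar_sphere
  speed_x near_ge radius_lip decay m0 hm r0S dist0.
exists z; split.
- exact: (trapped_solution rho0 x0 near_packing near_ge m0 dist0 z0 zd znear).
- exact: (trapped_unique rho0 C0 x0 near_ge metric_lip m0 hm dist0 z0 zd znear).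
- exact: (trapped_cvg mu0 x0 m0 hm zdecay).
Qed.
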